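(* Let $X\subset\mathbb{C}^n$ be a compact set, and $1\le m\le n$. (a) Let $u:X\to[-\infty,\infty)$ be upper semicontinuous. Then $u\in\mathcal{SH}_m(X)\cap\mathcal{C}(X)$ if, and only if, there is a sequence $u_j\in\mathcal{SH}_m^o(X)$ such that $u_j\nearrow u$ on $X$ (pointwise increasing convergence). (b) Let $u:X\to[-\infty,\infty)$. Then $u\in\mathcal{SH}_m(X)$ if, and only if, there is a sequence $u_j\in\mathcal{SH}_m^o(X)$ such that $u_j\searrow u$ on $X$ (pointwise decreasing convergence).
   Context: Let $1\le m\le n$ and $\beta=dd^c|z|^2$ on $\mathbb{C}^n$. Let $\Gamma_m$ be the set of real $(1,1)$-forms $\alpha$ with constant coefficients such that $\alpha^k\wedge\beta^{n-k}\ge 0$ for $k=1,\dots,m$. An upper semicontinuous function $u:U\to[-\infty,\infty)$ on an open set $U\subset\mathbb{C}^n$ is $m$-subharmonic if on each connected component of $U$ it is either identically $-\infty$, or subharmonic with $dd^cu\wedge\alpha_1\wedge\dots\wedge\alpha_{m-1}\wedge\beta^{n-m}\ge 0$ in the sense of currents for all $\alpha_1,\dots,\alpha_{m-1}\in\Gamma_m$. For $X\subset\mathbb{C}^n$ compact, $\mathcal{SH}_m^o(X)$ is the set of restrictions to $X$ of real-valued functions that are continuous and $m$-subharmonic on some open neighborhood of $X$. For $z\in X$, $\mathcal{J}_z^m(X)$ is the set of regular Borel probability measures $\mu$ on $X$ such that $u(z)\le\int_X u\,d\mu$ for all $u\in\mathcal{SH}_m^o(X)$. An upper semicontinuous function $u:X\to[-\infty,\infty)$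 is $m$-subharmonic on $X$, written $u\in\mathcal{SH}_m(X)$, if $u(z)\le\int_X u\,d\mu$ for all $z\in X$ and all $\mu\in\mathcal{J}_z^m(X)$. $\mathcal{C}(X)$ denotes the real-valued continuous functions on $X$. *)

(* Defs.v *)
From HB Require Import structures.
From mathcomp Require Import all_boot all_order all_algebra all_fingroup.
From mathcomp Require Import complex.
From mathcomp Require Import all_classical all_reals all_analysis.
From mathcomp Require Import measurable_realfun ring.
Set Implicit Arguments.
Unset Strict Implicit.
Unset Printing Implicit Defensive.
Import Order.TTheory GRing.Theory Num.Theory.
Import numFieldNormedType.Exports.
Local Open Scope classical_set_scope.
Local Open Scope complex_scope.
Local Open Scope ring_scope.

Notation borel R N := (g_sigma_algebraType (@open 'rV[R]_N)).

Section measurability.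
Context {R : realType}.

Lemma open_borel N (U : set 'rV[R]_N) : open U -> measurable (U : set (borel R N)).
Proof. exact: sub_sigma_algebra. Qed.

Lemma measurable_coord N (i : 'I_N) :
  measurable_fun setT (fun v : borel R N => v ord0 i).
Proof.
apply: (measurability _ (RGenOpens.measurableE R)) => _ [_ [a [b ->]] <-].
rewrite setTI; apply: open_borel.
apply: open_comp; last exact: interval_open.
by move=> x _; exact: coord_continuous.
Qed.

Lemma open_ratbox N (U : set 'rV[R]_N) : open U ->
  U = \bigcup_(p in [set p : {ffun 'I_N -> rat} * rat |
        [set y : 'rV[R]_N | forall i, `|ratr (p.1 i) - y ord0 i| < ratr p.2]
          `<=` U])
      [set y | forall i, `|ratr (p.1 i) - y ord0 i| < ratr p.2].
Proof.
move=> oU; apply/seteqP; split => [x Ux|x [p sub /=]]; last exact: sub.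
have /nbhs_ballP[e /= e0 eU] : nbhs x U by exact: open_nbhs_nbhs.
have [r [r0 re]] : exists r : rat, 0 < ratr r :> R /\ ratr r < e / 2.
  have [r] := rat_in_itvoo (divr_gt0 e0 (ltr0Sn R 1)).
  by rewrite in_itv /= => /andP[? ?]; exists r.
have H i : exists q : rat, `|ratr q - x ord0 i| < ratr r.
  have : x ord0 i - ratr r < x ord0 i + ratr r.
    by rewrite ltrD2l gtrN.
  move=> /rat_in_itvoo[q]; rewrite in_itv /= => /andP[h1 h2]; exists q.
  by rewrite ltr_distl h1.
pose q := [ffun i => projT1 (cid (H i))].
exists (q, r) => /= [y Hy|i]; last by rewrite ffunE; exact: (projT2 (cid (H i))).
have rre : ratr r + ratr r < e by rewrite (splitr e) ltrD.
apply: eU; split=> // i j; rewrite (ord1 i); apply: ball_sym.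
rewrite -ball_normE /= /ball_; apply: le_lt_trans rre.
rewrite distrC (le_trans (ler_distD (ratr (q j)) _ _)) // lerD //; apply/ltW; last exact: Hy.
by rewrite distrC ffunE; exact: (projT2 (cid (H j))).
Qed.

Lemma measurable_fun_rV d (T : measurableType d) N (f : T -> borel R N) :
  (forall i, measurable_fun setT (fun t => f t ord0 i)) -> measurable_fun setT f.
Proof.
move=> mf; apply: (@measurability _ _ T (borel R N) setT f (@open 'rV[R]_N) erefl) => _ [U oU <-].
rewrite setTI (open_ratbox oU) preimage_bigcup bigcup_mkcond.
apply: countable_bigcupT_measurable => // p.
case: ifPn => // _.
rewrite (_ : _ @^-1` _ = \big[setI/setT]_(i < N)
   [set t | `|ratr (p.1 i) - f t ord0 i| < ratr p.2]); last first.
  apply/seteqP; split => t /=.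
    by move=> h; rewrite -bigcap_seq => i _ /=; exact: h.
  by rewrite -bigcap_seq => h i; apply: h => /=; exact: mem_index_enum.
apply: big_ind => // [|i _]; first exact: measurableI.
rewrite (_ : [set t | _] = (fun t => f t ord0 i) @^-1`
  ball (ratr (p.1 i) : R) (ratr p.2)) //.
rewrite -[X in measurable X]setTI; apply: mf => //.
exact: measurable_ball.
Qed.

Definition rV_cons N (p : measurableTypeR R * borel R N) : borel R N.+1 :=
  row_mx (\row_(i < 1) p.1 : 'rV_1) (p.2 : 'rV_N).

Definition rV_uncons N (v : borel R N.+1) : measurableTypeR R * borel R N :=
  (v ord0 ord0, rsubmx (v : 'rV_(1 + N))).

Lemma rV_consK N : cancel (@rV_cons N) (@rV_uncons N).
Proof.
move=> [x v]; rewrite /rV_cons /rV_uncons; congr pair => /=.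
  have -> : ord0 = lshift N (ord0 : 'I_1) :> 'I_(1 + N) by apply/val_inj.
  by rewrite (@row_mxEl _ 1 1 N) mxE.
by rewrite row_mxKr.
Qed.

Lemma measurable_rV_cons N : measurable_fun setT (@rV_cons N).
Proof.
apply: measurable_fun_rV => i; rewrite /rV_cons.
case: (splitP (i : 'I_(1 + N))) => j /eqP ij.
  have -> : i = lshift N j by apply/val_inj/eqP.
  apply: (eq_measurable_fun fst) => [p _|].
    by rewrite (@row_mxEl _ 1 1 N) mxE.
  exact: measurable_fst.
have -> : i = rshift 1 j by apply/val_inj/eqP.
apply: (eq_measurable_fun ((fun v : borel R N => v ord0 j) \o snd)) => [p _|].
  by rewrite /= (@row_mxEr _ 1 1 N).
by apply: measurableT_comp => //; exact: measurable_coord.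
Qed.

Lemma measurable_rV_uncons N : measurable_fun setT (@rV_uncons N).
Proof.
apply: measurable_fun_pair; first exact: measurable_coord.
apply: measurable_fun_rV => i.
apply: (eq_measurable_fun
    (fun v : borel R N.+1 => v ord0 (rshift 1 i : 'I_(1 + N)))) => [v _|].
  by rewrite mxE.
exact: measurable_coord.
Qed.

(* The library's canonical sigma-finite structure on [m1 \x m2] only fires for
   finite [m1] and [m2], hence this lemma. *)
Lemma sigma_finite_product d1 d2 (T1 : measurableType d1) (T2 : measurableType d2)
    (m1 : {sigma_finite_measure set T1 -> \bar R})
    (m2 : {sigma_finite_measure set T2 -> \bar R}) :
  sigma_finite setT (m1 \x m2)%E.
Proof.
have /sigma_finiteP[F [TF ndF Foo]] := sigma_finiteT m1.
have /sigma_finiteP[G [TG ndG Goo]] := sigma_finiteT m2.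
exists (fun n => F n `*` G n).
  rewrite -setXTT TF TG predeqE => -[x y]; split.
    move=> [/= [n _ Fnx] [k _ Gky]]; exists (maxn n k) => //; split.
    - by move: x Fnx; exact/subsetPset/ndF/leq_maxl.
    - by move: y Gky; exact/subsetPset/ndG/leq_maxr.
  by move=> [n _ []/= ? ?]; split; exists n.
move=> k; have [? ?] := Foo k; have [? ?] := Goo k.
split; first exact: measurableX.
by rewrite product_measure1E// lte_mul_pinfty// ge0_fin_numE.
Qed.

Section lebesgue_rV_step.
Local Open Scope ereal_scope.
Variables (N : nat) (mu : {sigma_finite_measure set (borel R N) -> \bar R}).

Definition lebesgue_rVS : set (borel R N.+1) -> \bar R :=
  pushforward (@lebesgue_measure R \x mu) (@rV_cons N).

Let lebesgue_rVS0 : lebesgue_rVS set0 = 0.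
Proof. by rewrite /lebesgue_rVS /pushforward preimage_set0 measure0. Qed.

Let lebesgue_rVS_ge0 A : 0 <= lebesgue_rVS A.
Proof. by rewrite /lebesgue_rVS /pushforward measure_ge0. Qed.

Let lebesgue_rVS_sigma_additive : semi_sigma_additive lebesgue_rVS.
Proof.
exact: (@measure_semi_sigma_additive _ _ _
  (measure_function_pushforward__canonical__measure_function_Measure
    (@lebesgue_measure R \x mu) (@measurable_rV_cons N))).
Qed.

HB.instance Definition _ := isMeasure.Build _ _ _ lebesgue_rVS
  lebesgue_rVS0 lebesgue_rVS_ge0 lebesgue_rVS_sigma_additive.

Let lebesgue_rVS_sigma_finite : sigma_finite setT lebesgue_rVS.
Proof.
have [F FT mF] := sigma_finite_product (@lebesgue_measure R) mu.
exists (fun k => @rV_uncons N @^-1` F k).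
  by rewrite -preimage_bigcup -FT preimage_setT.
move=> k; have [mFk Foo] := mF k; split.
  by rewrite -[X in measurable X]setTI; exact: measurable_rV_uncons.
rewrite /lebesgue_rVS /pushforward -comp_preimage.
rewrite (_ : _ \o _ = id) ?preimage_id //.
by apply/funext => x /=; rewrite rV_consK.
Qed.

HB.instance Definition _ :=
  Measure_isSigmaFinite.Build _ _ _ lebesgue_rVS lebesgue_rVS_sigma_finite.

End lebesgue_rV_step.

Fixpoint lebesgue_rV N : {sigma_finite_measure set (borel R N) -> \bar R} :=
  match N with
  | 0 => \d_(0 : borel R 0)
  | N.+1 => lebesgue_rVS (lebesgue_rV N)
  end.

Lemma measurable_box N (A : 'I_N -> set (measurableTypeR R)) :
  (forall i, measurable (A i)) ->
  measurable [set v : borel R N | forall i, A i (v ord0 i)].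
Proof.
move=> mA; rewrite (_ : [set v | _] = \big[setI/setT]_(i < N)
   [set v : borel R N | A i (v ord0 i)]); last first.
  apply/seteqP; split => t /=.
    by move=> h; rewrite -bigcap_seq => i _ /=; exact: h.
  by rewrite -bigcap_seq => h i; apply: h => /=; exact: mem_index_enum.
apply: big_ind => // [|i _]; first exact: measurableI.
rewrite -[X in measurable X]setTI.
exact: (@measurable_coord N i measurableT (A i) (mA i)).
Qed.

Lemma lebesgue_rV_box N (A : 'I_N -> set (measurableTypeR R)) :
  (forall i, measurable (A i)) ->
  lebesgue_rV N [set v | forall i, A i (v ord0 i)] =
  (\big[*%E/1]_(i < N) lebesgue_measure (A i))%E.
Proof.
elim: N A => [|N IH] A mA.
  by rewrite big_ord0 /= diracE (_ : _ \in _) //; apply: mem_set; case.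
have mA' i : measurable (A (lift ord0 i)) by exact: mA.
rewrite big_ord_recl -(IH (fun i => A (lift ord0 i)) mA').
rewrite -(product_measure1E _ _ (mA ord0) (measurable_box mA')).
rewrite /= /lebesgue_rVS /pushforward; congr (product_measure1 _ _ _).
apply/seteqP; split => -[x v] /=.
  move=> h; split => [|i].
    have := h (lshift N (ord0 : 'I_1)).
    by rewrite (@row_mxEl _ 1 1 N) mxE; congr (A _ _); exact/val_inj.
  have := h (rshift 1 i).
  by rewrite (@row_mxEr _ 1 1 N); congr (A _ _); exact/val_inj.
move=> [h0 h] i; rewrite /rV_cons.
case: (splitP (i : 'I_(1 + N))) => j /eqP ij.
  have -> : i = lshift N j by apply/val_inj/eqP.
  rewrite (@row_mxEl _ 1 1 N) mxE; move: h0; congr (A _ _).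
  by rewrite (ord1 j); exact/val_inj.
have -> : i = rshift 1 j by apply/val_inj/eqP.
rewrite (@row_mxEr _ 1 1 N); move: (h j); congr (A _ _).
exact/val_inj.
Qed.

End measurability.

(* The point z of C^n with z_j = x_j + i y_j is the row vector
   (x_1, ..., x_n, y_1, ..., y_n). *)
Notation Cn R n := 'rV[R]_(n + n).

Section forms.
Context {R : realType} {n : nat}.

Definition ex (j : 'I_n) : Cn R n := delta_mx ord0 (lshift n j).
Definition ey (j : 'I_n) : Cn R n := delta_mx ord0 (rshift n j).

(* A constant-coefficient (1,1)-form i * sum_(j,k) a_jk dz_j /\ dzbar_k is
   represented by its coefficient matrix (a_jk); it is real iff that matrix is
   Hermitian. *)
Definition real11 (a : 'M[R[i]]_n) : Prop := forall j k, a k j = Num.conj (a j k).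

(* For n forms of type (1,1), expanding the wedge product by multilinearity
   leaves the products
     (i dz_s(1) /\ dzbar_t(1)) /\ ... /\ (i dz_s(n) /\ dzbar_t(n))
   with s, t permutations, and each equals sgn(s) sgn(t) times
     (i dz_1 /\ dzbar_1) /\ ... /\ (i dz_n /\ dzbar_n),
   which is 2^n times the standard volume form. [wedge l] is the coefficient of
   the wedge product of the list [l] with respect to that form; it is only
   meaningful when [size l = n]. *)
Definition wedge (l : seq 'M[R[i]]_n) : R[i] :=
  \sum_(s : 'S_n) \sum_(t : 'S_n)
    (-1) ^+ s * (-1) ^+ t * \prod_(p < n) (nth 0 l p) (s p) (t p).

(* dd^c = 2 i ddbar (with d^c = i (dbar - d)), and
   4 d^2 phi / dz_j dzbar_k = (d/dx_j - i d/dy_j) (d/dx_k + i d/dy_k) phi. *)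
Definition ddc (phi : Cn R n -> R) (z : Cn R n) : 'M[R[i]]_n :=
  \matrix_(j, k) (2^-1 *
    (('D_(ex j) ('D_(ex k) phi) z + 'D_(ey j) ('D_(ey k) phi) z) +i*
     ('D_(ex j) ('D_(ey k) phi) z - 'D_(ey j) ('D_(ex k) phi) z))).

Definition sqnorm (z : Cn R n) : R := \sum_k z ord0 k ^+ 2.

Definition beta : 'M[R[i]]_n := ddc sqnorm 0.

Definition Gamma (m : nat) : set 'M[R[i]]_n :=
  [set a | real11 a /\
    forall k, (1 <= k <= m)%N -> 0 <= wedge (nseq k a ++ nseq (n - k) beta)].

Lemma is_derive_coord (k : 'I_(n + n)) (v z : Cn R n) :
  is_derive z v (fun z : Cn R n => z ord0 k) (v ord0 k).
Proof.
have H : (fun h : R => h^-1 *: ((h *: v + z) ord0 k - z ord0 k)) h @[h --> 0^']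
    --> v ord0 k.
  apply: cvg_near_cst; near=> h.
  rewrite !mxE addrK /GRing.scale /= mulKf //; near: h; exact: nbhs_dnbhs_neq.
split; first by apply/cvg_ex; exists (v ord0 k); exact: H.
exact: cvg_lim H.
Unshelve. all: by end_near. Qed.

Lemma derive_lin (c : 'I_(n + n) -> R) (v z : Cn R n) :
  'D_v (fun z : Cn R n => \sum_k c k * z ord0 k) z = \sum_k c k * v ord0 k.
Proof.
rewrite (_ : (fun _ => _) = \sum_k (c k \*: (fun z : Cn R n => z ord0 k))); last first.
  by apply/funext => w; rewrite fct_sumE.
apply: derive_val; apply: is_derive_sum => k.
exact: is_deriveZ (is_derive_coord k v z).
Qed.

Lemma derive_sqnorm (v : Cn R n) :
  'D_v sqnorm = fun z => \sum_k (2 * v ord0 k) * z ord0 k.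
Proof.
apply/funext => z.
rewrite (_ : sqnorm = \sum_k (fun z : Cn R n => z ord0 k) ^+ 2); last first.
  by apply/funext => w; rewrite fct_sumE.
apply: derive_val; apply: is_derive_sum => k.
apply: is_derive_eq (is_deriveX 2 (is_derive_coord k v z)) _.
by rewrite expr1 /GRing.scale /= mulrAC.
Qed.

Lemma derive2_sqnorm (v w z : Cn R n) :
  'D_v ('D_w sqnorm) z = 2 * \sum_k w ord0 k * v ord0 k.
Proof.
by rewrite derive_sqnorm derive_lin mulr_sumr; apply: eq_bigr => k _; rewrite mulrA.
Qed.

Lemma ddc_sqnorm (z : Cn R n) : ddc sqnorm z = 2%:M.
Proof.
have H p q : \sum_k (delta_mx ord0 p : Cn R n) ord0 k * (delta_mx ord0 q : Cn R n) ord0 k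
    = (p == q)%:R.
  rewrite (bigD1 p) //= big1 ?addr0 => [|k kp]; rewrite !mxE !eqxx /=.
    by rewrite mul1r.
  by rewrite (negPf kp) mul0r.
apply/matrixP => j k; rewrite !mxE !derive2_sqnorm !H.
rewrite !(inj_eq (@lshift_inj _ _)) !(inj_eq (@rshift_inj _ _)) eq_lrshift eq_rlshift.
rewrite mulr0 subr0 eq_sym -[RHS]mulr_natr.
apply: (mulfI (_ : 2 != 0 :> R[i])); first by rewrite pnatr_eq0.
rewrite mulrA mulfV ?pnatr_eq0 // mul1r.
rewrite [RHS]mulrA -[in RHS]natrM -[in RHS]natrM.
rewrite -[RHS](rmorph_nat (real_complex R)) /=.
by congr (_ +i* 0); rewrite !natrM; ring.
Qed.

End forms.

Section msubharmonic.
Context {R : realType} {n : nat}.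
Local Open Scope ereal_scope.

Definition smooth (phi : Cn R n -> R) : Prop :=
  forall vs : seq (Cn R n),
    let psi := foldr (fun v f => 'D_v f) phi vs in
    continuous psi /\ forall z v, derivable psi z v.

Definition test_fun (D : set (Cn R n)) (phi : Cn R n -> R) : Prop :=
  [/\ smooth phi, compact (closure [set z | phi z != 0%R]) &
      closure [set z | phi z != 0%R] `<=` D].

Definition usc_on (A : set (Cn R n)) (u : Cn R n -> \bar R) : Prop :=
  forall z, A z -> forall a : R, u z < a%:E ->
    \forall w \near within A (nbhs z), u w < a%:E.

Definition eball (a : Cn R n) (r : R) : set (Cn R n) :=
  [set z | (sqnorm (z - a) <= r ^+ 2)%R].

Definition subharmonic (D : set (Cn R n)) (u : Cn R n -> \bar R) : Prop :=
  [/\ usc_on D u, forall z, D z -> u z < +oo &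
    forall a r, (0 < r)%R -> eball a r `<=` D ->
      u a <= ((fine (lebesgue_rV (n + n) (eball a r)))^-1)%:E *
             \int[lebesgue_rV (n + n)]_(z in eball a r) u z].

(* dd^c u /\ w_1 /\ ... /\ w_(n-1) >= 0 on [D] in the sense of currents, i.e.
   u dd^c phi /\ w_1 /\ ... /\ w_(n-1) has a nonnegative integral for every
   test function phi >= 0; the factor 2^n of [wedge] is dropped. *)
Definition ddc_wedge_ge0 (D : set (Cn R n)) (u : Cn R n -> \bar R)
    (w : seq 'M[R[i]]_n) : Prop :=
  forall phi : Cn R n -> R, test_fun D phi -> (forall z, 0 <= phi z)%R ->
    0 <= \int[lebesgue_rV (n + n)]_(z in D)
           (u z * (complex.Re (wedge (ddc phi z :: w)))%:E).

Definition msubharmonic (m : nat) (U : set (Cn R n)) (u : Cn R n -> \bar R) : Prop :=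
  [/\ usc_on U u, forall z, U z -> u z < +oo &
    forall z, U z ->
      let D := connected_component U z in
      (forall w, D w -> u w = -oo) \/
      (subharmonic D u /\
       forall a : (m.-1).-tuple 'M[R[i]]_n, (forall i, Gamma m (tnth a i)) ->
         ddc_wedge_ge0 D u (a ++ nseq (n - m) beta))].

(* Functions on [X] are represented by functions on C^n of which only the values
   on [X] matter; likewise measures on [X] by Borel measures on C^n carried by
   [X]. *)
Definition SHo (m : nat) (X : set (Cn R n)) (v : Cn R n -> R) : Prop :=
  exists (U : set (Cn R n)) (w : Cn R n -> R),
    [/\ open U, X `<=` U, {within U, continuous w},
        msubharmonic m U (EFin \o w) & forall z, X z -> v z = w z].

Definition regular_measure (mu : {measure set (borel R (n + n)) -> \bar R}) : Prop :=
  forall A : set (borel R (n + n)), measurable A ->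
    mu A = ereal_inf [set mu V | V in [set V : set (Cn R n) | open V /\ A `<=` V]] /\
    mu A = ereal_sup [set mu K | K in [set K : set (Cn R n) | compact K /\ K `<=` A]].

Definition Jensen (m : nat) (X : set (Cn R n)) (z : Cn R n)
    (mu : probability (borel R (n + n)) R) : Prop :=
  [/\ regular_measure mu, mu X = 1 &
      forall v, SHo m X v -> (v z)%:E <= \int[mu]_(w in X) (v w)%:E].

Definition usc_fun (X : set (Cn R n)) (u : Cn R n -> \bar R) : Prop :=
  usc_on X u /\ forall z, X z -> u z < +oo.

Definition SH (m : nat) (X : set (Cn R n)) (u : Cn R n -> \bar R) : Prop :=
  usc_fun X u /\
  forall z, X z -> forall mu : probability (borel R (n + n)) R, Jensen m X z mu ->
    u z <= \int[mu]_(w in X) u w.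

Definition real_continuous (X : set (Cn R n)) (u : Cn R n -> \bar R) : Prop :=
  exists2 f : Cn R n -> R, {within X, continuous f} & forall z, X z -> u z = (f z)%:E.

End msubharmonic.

(* Main.v *)
(* Since SHo m X is a convex cone containing the constants, Hahn-Banach and Riesz
   give Edwards' duality: for phi continuous on X, the supremum of v z over the
   v <= phi in SHo m X is the infimum of the integrals of phi against the Jensen
   measures of z. So if u in SH m X lies strictly below phi, then near each point
   some v in SHo m X lies between u and phi, and since X is compact a finite
   maximum of such v does so on all of X. Squeezing such functions between u and
   continuous functions tending to u yields both sequences; the converses follow
   from semicontinuity and monotone convergence.

   That SHo m X is stable under maxima rests on Garding's theory of hyperbolic
   polynomials: for a_1, ..., a_(m-1) in Gamma m the form
   dd^c phi /\ a_1 /\ ... /\ a_(m-1) /\ beta^(n-m) is a sum of second directional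
   derivatives of phi. Positivity of such an operator on u is equivalent to a
   bound - C t^3 from below for the corresponding second differences of the
   mollifications of u, and second differences behave well under maxima. *)
Require Import Defs.
From HB Require Import structures.
From mathcomp Require Import all_boot all_order all_algebra all_fingroup.
From mathcomp Require Import complex.
From mathcomp Require Import all_classical all_reals all_analysis.
From mathcomp Require Import measurable_realfun ring lra zify spectral.
Set Implicit Arguments.
Unset Strict Implicit.
Unset Printing Implicit Defensive.
Import Order.TTheory GRing.Theory Num.Theory.
Import numFieldNormedType.Exports.
Local Open Scope classical_set_scope.
Local Open Scope complex_scope.
Local Open Scope ring_scope.
(** * Wedge products along pencils of forms *)

Section wedge_algebra.
Context {R : realType} {n : nat}.
Notation C := R[i].
Implicit Types (A B a x y z : 'M[C]_n) (l : seq 'M[C]_n).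

(** The conditions on a test form are linear in u and say nothing pointwise about a maximum, which
    is why the operator is discretized. A second difference carries its only negative coefficient at
    the centre, so lower bounds pass to maxima; but this requires pure second derivatives with
    nonnegative weights. Such weights exist because the operator, as a linear functional of the
    matrix of dd^c phi, is nonnegative on positive rank-one matrices; as those lie in the cone, this
    is a case of Garding's inequality for mixed products. The inequality is obtained by locating
    zeros of one-variable polynomials: zeros are followed along segments of forms, and
    differentiation, which polarizes a power into a mixed product, keeps them in a half plane. The
    exponent in C t^3 is the error of a symmetric difference of a smooth function; it is o(t^2), and
    one divides by t^2 before t tends to 0, with C fixed. In the duality, strictness of u < phi
    yields a uniform gap on the compact X, and this gap makes the weak inequality delivered by
    Hahn-Banach contradictory. *)

Lemma wedge_perm l l' : size l = n -> perm_eq l l' -> wedge l = wedge l'.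
Proof.
move=> sl pll'; have sl' : size l' = n by rewrite -(perm_size pll').
have [sg hs] : exists sg : 'S_n, forall p : 'I_n, nth 0 l' p = nth 0 l (sg p).
  have /tuple_permP[sg hs] : perm_eq l' (Tuple (introT eqP sl)) by rewrite perm_sym.
  exists sg => p; rewrite hs (nth_map p) ?size_enum_ord // nth_ord_enum.
  by rewrite (tnth_nth 0).
(* Both [s] and [t] are shifted by the same permutation, so its sign enters twice and cancels. *)
rewrite /wedge (reindex_inj (mulgI (sg^-1)%g)); apply: eq_bigr => s _.
rewrite (reindex_inj (mulgI (sg^-1)%g)); apply: eq_bigr => t _.
rewrite !odd_permM (signr_addb _ sg^-1%g s) (signr_addb _ sg^-1%g t).
congr (_ * _); first by rewrite mulrACA -[X in X * _](signr_addb _ sg^-1%g) addbb mul1r.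
rewrite (reindex_inj (@perm_inj _ sg)) /=.
by apply: eq_bigr => p _; rewrite !permM hs permK.
Qed.

Lemma wedge_linear_head (c : C) A B l : (0 < n)%N ->
  wedge ((c *: A + B) :: l) = c * wedge (A :: l) + wedge (B :: l).
Proof.
case: n A B l => // n' A B l _; rewrite /wedge mulr_sumr -big_split /=.
apply: eq_bigr => s _; rewrite mulr_sumr -big_split /=; apply: eq_bigr => t _.
rewrite !big_ord_recl -[nth _ _ _]/(c *: A + B) -[nth _ (A :: l) _]/A -[nth _ (B :: l) _]/B !mxE.
have E X : \prod_(i < n') nth 0 (X :: l) (lift ord0 i) (s (lift ord0 i)) (t (lift ord0 i))
   = \prod_(i < n') nth 0 l i (s (lift ord0 i)) (t (lift ord0 i)) by exact: eq_bigr.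
rewrite [X in _ * (_ * X)]E [X in c * (_ * (_ * X))]E [X in _ + _ * (_ * X)]E.
by rewrite mulrDl mulrDr; congr (_ + _); rewrite [RHS]mulrCA !mulrA.
Qed.

(* [wpoly z a l k] is the polynomial [s |-> wedge (nseq k (z + s a) ++ l)]. *)
Fixpoint wpoly z a l (k : nat) : {poly C} :=
  if k is k'.+1 then wpoly z a (z :: l) k' + 'X * wpoly z a (a :: l) k'
  else (wedge l)%:P.

Lemma wpoly_perm z a l l' k : (size l + k = n)%N -> perm_eq l l' ->
  wpoly z a l k = wpoly z a l' k.
Proof.
elim: k l l' => [|k IH] l l' sl pl /=.
  by rewrite (wedge_perm _ pl) //; lia.
congr (_ + _ * _); apply: IH; rewrite ?perm_cons //=; lia.
Qed.

Lemma horner_wpoly z a l k s : (size l + k = n)%N ->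
  (wpoly z a l k).[s] = wedge (nseq k (z + s *: a) ++ l).
Proof.
elim: k l => [|k IH] l sl /=; first by rewrite hornerC.
have n0 : (0 < n)%N by lia.
rewrite hornerD hornerM hornerX !IH /=; [|lia..].
rewrite [LHS]addrC [X in wedge (X :: _)]addrC wedge_linear_head //; congr (_ * _ + _); apply: wedge_perm.
1,3: by rewrite size_cat size_nseq /=; lia.
1,2: by apply/seq.permP => P; rewrite /= !count_cat /= ?count_cat /=; lia.
Qed.

(** Leibniz's rule: differentiation in [s] turns one factor [z + s a] into [a]. This polarization
    carries properties of powers over to mixed products. *)
Lemma deriv_wpoly z a l k : (size l + k = n)%N ->
  (wpoly z a l k)^`() = (wpoly z a (a :: l) k.-1) *+ k.
Proof.
elim: k l => [|k IH] l sl /=; first by rewrite derivC mulr0n.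
rewrite derivD derivM derivX mul1r !IH /=; try lia.
case: k IH sl => [|k] IH sl; first by rewrite !mulr0n mulr0 addr0 add0r mulr1n.
rewrite /= (@wpoly_perm z a (a :: z :: l) (z :: a :: l)) /=; last 2 first.
- by lia.
- by rewrite -(cat1s a) -(cat1s z) perm_catCA.
by rewrite [RHS]mulrS [_ + 'X * _]/= mulrnAr mulrnDl /=; ring.
Qed.

Lemma size_wpoly z a l k : (size (wpoly z a l k) <= k.+1)%N.
Proof.
elim: k l => [|k IH] l /=; first exact: size_polyC_leq1.
rewrite (leq_trans (size_polyD _ _)) // geq_max (leq_trans (IH _)) //=.
by rewrite (leq_trans (size_polyMleq _ _)) // size_polyX /= ltnS.
Qed.

Lemma coef_wpoly z a l k j : (size l + k = n)%N -> (j <= k)%N ->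
  (wpoly z a l k)`_j = wedge (nseq j a ++ nseq (k - j) z ++ l) *+ 'C(k, j).
Proof.
elim: k l j => [|k IH] l j sl jk /=.
  by move: jk; rewrite leqn0 => /eqP ->; rewrite coefC /= bin0 mulr1n.
rewrite coefD coefXM; case: j jk => [|j] jk /=.
  rewrite addr0 IH /=; [|lia..]; rewrite !bin0 !subn0 /=; congr (_ *+ _).
  apply: wedge_perm; rewrite ?size_cat ?size_nseq /=; first by lia.
  by rewrite -(cat1s z l) -(cat1s z (_ ++ _)) perm_catCA.
rewrite binS mulrnDr subSS (IH (a :: l)) /=; [|lia..]; congr (_ + _); last first.
  congr (_ *+ _); apply: wedge_perm; rewrite ?size_cat ?size_nseq /=; first by lia.
  by apply/seq.permP => P; rewrite /= !count_cat /= ?count_cat /=; lia.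
move: jk; rewrite ltnS leq_eqVlt => /orP[/eqP <-|jk].
  by rewrite bin_small // mulr0n nth_default // size_wpoly.
rewrite IH /=; [|lia..]; congr (_ *+ _); apply: wedge_perm.
  by rewrite /= ?size_cat ?size_nseq /=; lia.
have -> : (k - j = (k - j.+1).+1)%N by lia.
by apply/seq.permP => P; rewrite /= !count_cat /= ?count_cat /=; lia.
Qed.

End wedge_algebra.
(** * Complex polynomials without roots in the upper half plane *)

Section complex_poly.
Context {R : realType}.
Notation C := R[i].
Notation Im := complex.Im.
Notation Re := complex.Re.
Notation nm := Normc.normc.
Implicit Types (p : {poly C}) (r s t z c : C).

Lemma ImB z s : Im (z - s) = Im z - Im s.
Proof. by case: z s => [a b] [c d]. Qed.

Lemma ImD z s : Im (z + s) = Im z + Im s.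
Proof. by case: z s => [a b] [c d]. Qed.

Lemma ImV_lt0 z : 0 < Im z -> Im z^-1 < 0.
Proof.
case: z => a b /= b0; rewrite oppr_lt0 divr_gt0 //.
by rewrite ltr_wpDl ?sqr_ge0 // exprn_gt0.
Qed.

Lemma Im_le_norm z : `|Im z| <= nm z.
Proof.
case: z => a b /=; rewrite -[`|b|]sqrtr_sqr ler_sqrt; last by rewrite addr_ge0 ?sqr_ge0.
by rewrite ler_wpDl ?sqr_ge0.
Qed.

Lemma nmD z s : nm (z + s) <= nm z + nm s.
Proof. exact: le_normcD. Qed.

Lemma nm_ge0 z : 0 <= nm z.
Proof. exact: le_trans (Im_le_norm z). Qed.

Lemma nm_gt0 z : z != 0 -> 0 < nm z.
Proof.
by move=> z0; rewrite lt_neqAle nm_ge0 andbT eq_sym; apply: contra z0 => /eqP/Normc.eq0_normc ->.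
Qed.

Lemma logderiv p t : p.[t] != 0 ->
  exists rs : seq C, [/\ forall r, r \in rs -> root p r, size rs = (size p).-1 &
    p^`().[t] = p.[t] * \sum_(r <- rs) (t - r)^-1].
Proof.
have [rs prs] := closed_field_poly_normal p; move=> pt; exists rs.
have p0 : p != 0 by apply: contra pt => /eqP ->; rewrite horner0.
have c0 : lead_coef p != 0 by rewrite lead_coef_eq0.
split.
- move=> r rrs; rewrite prs rootZ // root_prod_XsubC //.
- by rewrite prs size_scale // size_prod_XsubC.
have {}pt : (\prod_(z <- rs) ('X - z%:P)).[t] != 0.
  by apply: contra pt; rewrite prs hornerZ => /eqP ->; rewrite mulr0.
rewrite prs derivZ !hornerZ -mulrA; congr (_ * _).
elim: rs {prs} pt => [|r rs IH]; first by rewrite !big_nil derivC horner0 mulr0.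
rewrite !big_cons hornerM !hornerXsubC mulf_eq0 negb_or => /andP[tr /IH{}IH].
rewrite derivM derivXsubC mul1r hornerD hornerM hornerXsubC IH.
by rewrite mulrDr mulrAC mulfV // mul1r !mulrA.
Qed.

(** At a point [t] above all roots every term [(t - r)^-1] of the logarithmic derivative has
    negative imaginary part, so the sum cannot vanish. *)
Lemma gauss_lucas p t : (1 < size p)%N ->
  (forall r, root p r -> Im r < Im t) -> p^`().[t] != 0.
Proof.
move=> sp pr; have pt : p.[t] != 0 by apply/negP => /pr; rewrite ltxx.
have [rs [rrs srs ->]] := logderiv pt.
rewrite mulf_neq0 //; apply: contraTneq sp => s0.
have H : forall r, r \in rs -> Im (t - r)^-1 < 0.
  by move=> r /rrs/pr rt; rewrite ImV_lt0 // ImB subr_gt0.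
case: rs rrs srs s0 H => [|r rs] rrs srs s0 H; first by rewrite -leqNgt; move: srs => /=; lia.
have : Im (\sum_(r <- r :: rs) (t - r)^-1) < 0.
  rewrite big_cons ImD ltr_nwDl ?H ?mem_head //.
  have : forall r, r \in rs -> Im (t - r)^-1 < 0 by move=> r' h; apply: H; rewrite inE h orbT.
  elim: rs {rrs srs s0 H} => [|r' rs IH] H; first by rewrite big_nil.
  rewrite big_cons ImD; apply: (@le_trans _ _ (0 + 0)); last by rewrite addr0.
  apply: lerD; first by rewrite ltW // H ?mem_head.
  by apply: IH => r'' h; apply: H; rewrite inE h orbT.
by rewrite s0 ltxx.
Qed.

(** The logarithmic derivative at 0 is now a sum of positive terms. In the order of [R[i]] the
    hypotheses also say that the value at 0 and the roots are real. *)
Lemma deriv0_gt0 p : (1 < size p)%N -> 0 < p.[0] ->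
  (forall r, root p r -> r < 0) -> 0 < p^`().[0].
Proof.
move=> sp p0 pr; have pt : p.[0] != 0 by rewrite gt_eqF.
have [rs [rrs srs ->]] := logderiv pt; rewrite mulr_gt0 //.
case: rs rrs srs => [|r rs] rrs srs; first by move: sp srs; case: (size p) => [|[]].
rewrite big_cons ltr_pwDl //; first by rewrite invr_gt0 sub0r oppr_gt0 pr ?rrs ?mem_head.
rewrite big_seq sumr_ge0 // => r' h.
by rewrite invr_ge0 sub0r oppr_ge0 ltW // pr // rrs // inE h orbT.
Qed.

(** The distance [D] from [s] to [r] is at least [nm s - nm r] and at least [- Im r]. Hence
    [1 + nm s] is at most [D + (1 + nm r)], whose second summand is at most [(1 + nm r) / - Im r]
    times [D]; this fixes [k]. *)
Lemma dist_lower_root r : Im r < 0 ->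
  exists2 k : R, 0 < k & forall s, 0 <= Im s -> k * (1 + nm s) <= nm (s - r).
Proof.
move=> r0; have d0 : 0 < - Im r by rewrite oppr_gt0.
have e0 : 0 < 1 + (1 + nm r) / - Im r.
  by rewrite ltr_pwDl // divr_ge0 ?addr_ge0 ?nm_ge0 // ltW.
exists (1 + (1 + nm r) / - Im r)^-1 => [|s s0]; first by rewrite invr_gt0.
rewrite ler_pdivrMl // mulrDl mul1r.
have h1 : nm s <= nm (s - r) + nm r by rewrite -[in leLHS](subrK r s) nmD.
have h2 : - Im r <= nm (s - r).
  by apply: le_trans (Im_le_norm _); rewrite (le_trans _ (ler_norm _)) // ImB lerDr.
have : 1 + nm r <= (1 + nm r) / - Im r * nm (s - r).
  by rewrite -mulrA ler_peMr ?addr_ge0 ?nm_ge0 // ler_pdivlMl // mulr1.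
by lra.
Qed.

(** The bound grows in [s] like the perturbations allowed in [lower_roots_homotopy], so it keeps
    roots of nearby polynomials out of the whole closed upper half plane at once, large [s]
    included. *)
Lemma nm_horner_ge p : p != 0 -> (forall r, root p r -> Im r < 0) ->
  exists2 k : R, 0 < k & forall s, 0 <= Im s -> k * (1 + nm s) ^+ (size p).-1 <= nm p.[s].
Proof.
have [rs prs] := closed_field_poly_normal p; move=> p0 pr.
have c0 : lead_coef p != 0 by rewrite lead_coef_eq0.
have {}pr : forall r, r \in rs -> Im r < 0.
  by move=> r rrs; apply: pr; rewrite prs rootZ // root_prod_XsubC.
have [k k0 H] : exists2 k : R, 0 < k & forall s, 0 <= Im s ->
    k * (1 + nm s) ^+ size rs <= nm (\prod_(z <- rs) ('X - z%:P)).[s].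
  elim: rs {prs} pr => [|r rs IH] pr.
    by exists 1 => // s _; rewrite big_nil hornerC Normc.normc1 mulr1.
  have [|k k0 H] := IH; first by move=> r' h; apply: pr; rewrite inE h orbT.
  have [k' k'0 H'] := dist_lower_root (pr r (mem_head _ _)).
  exists (k' * k) => [|s s0]; first by rewrite mulr_gt0.
  rewrite big_cons hornerM hornerXsubC Normc.normcM /= exprS mulrACA.
  by rewrite ler_pM ?H ?H' // mulr_ge0 ?exprn_ge0 ?addr_ge0 ?nm_ge0 // ltW.
exists (nm (lead_coef p) * k) => [|s s0]; first by rewrite mulr_gt0 ?nm_gt0.
rewrite [in leRHS]prs hornerZ Normc.normcM -mulrA ler_wpM2l ?nm_ge0 //.
by rewrite (le_trans _ (H s s0)) // prs size_scale // size_prod_XsubC.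
Qed.

(** The constant depends on the leading coefficient but not on the position of the roots, so the
    bound is uniform in a family with fixed leading coefficient and survives a limit. *)
Lemma nm_horner_ge_Im p s : 0 <= Im s -> (forall r, root p r -> Im r <= 0) ->
  nm (lead_coef p) * Im s ^+ (size p).-1 <= nm p.[s].
Proof.
move=> s0; have [->|p0] := eqVneq p 0.
  by rewrite lead_coef0 horner0 Normc.normc0 mul0r.
have [rs prs] := closed_field_poly_normal p.
have c0 : lead_coef p != 0 by rewrite lead_coef_eq0.
move=> pr; rewrite [in leRHS]prs hornerZ Normc.normcM ler_wpM2l ?nm_ge0 //.
have -> : (size p).-1 = size rs by rewrite prs size_scale // size_prod_XsubC.
have {}pr : forall r, r \in rs -> Im r <= 0.
  by move=> r rrs; apply: pr; rewrite prs rootZ // root_prod_XsubC.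
elim: rs {prs} pr => [|r rs IH] pr; first by rewrite big_nil hornerC Normc.normc1.
rewrite big_cons hornerM hornerXsubC Normc.normcM exprS ler_pM ?exprn_ge0 //.
  rewrite (le_trans _ (Im_le_norm _)) // (le_trans _ (ler_norm _)) // ImB.
  by rewrite lerDl oppr_ge0 pr ?mem_head.
by apply: IH => r' h; apply: pr; rewrite inE h orbT.
Qed.

(* The leading coefficient is constant and no root crosses the real axis, so
   the roots stay in the lower half plane. *)
Lemma lower_roots_homotopy (F : R -> {poly C}) (m : nat) c (K : R) : c != 0 ->
  (forall t : R, 0 <= t <= 1 -> size (F t) = m.+1 /\ lead_coef (F t) = c) ->
  (forall (t u : R) s, 0 <= t <= 1 -> 0 <= u <= 1 ->
     nm ((F t).[s] - (F u).[s]) <= K * `|t - u| * (1 + nm s) ^+ m) ->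
  (forall (t : R) s, 0 <= t <= 1 -> root (F t) s -> Im s != 0) ->
  (forall s, root (F 0) s -> Im s < 0) -> forall s, root (F 1) s -> Im s < 0.
Proof.
move=> c0 Fs FK Fr F0.
pose good (t : R) := forall s, root (F t) s -> Im s < 0.
pose E := [set t : R | 0 <= t <= 1 /\ forall u, 0 <= u <= t -> good u].
have E0 : E 0.
  by split=> [|u]; [rewrite lexx ler01|rewrite -eq_le => /eqP <-].
have Eub : ubound E 1 by move=> t [/andP[]].
have hsE : has_sup E by split; [exists 0|exists 1].
pose t0 := sup E; have t00 : 0 <= t0 by exact: sup_upper_bound E0.
have t01 : t0 <= 1 by apply: ge_sup => //; exists 0.
have t0P : 0 <= t0 <= 1 by rewrite t00.
have lt_good (u : R) : 0 <= u -> u < t0 -> good u.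
  move=> u0 ut; have := ut; rewrite -subr_gt0 => /sup_adherent/(_ hsE)[e Ee].
  rewrite -/t0 subKr => ue.
  by apply: (proj2 Ee); rewrite u0 ltW.
pose K' := `|K| + 1; have K'0 : 0 < K' by rewrite ltr_wpDl.
have FK' (t u : R) s : 0 <= t <= 1 -> 0 <= u <= 1 ->
     nm ((F t).[s] - (F u).[s]) <= K' * `|t - u| * (1 + nm s) ^+ m.
  move=> ht hu; apply: le_trans (FK t u s ht hu) _.
  rewrite -!mulrA ler_wpM2r // ?mulr_ge0 ?exprn_ge0 ?addr_ge0 ?nm_ge0 //.
  by rewrite (le_trans (ler_norm _)) // lerDl.
have pw_gt0 s : 0 < (1 + nm s) ^+ m by rewrite exprn_gt0 // ltr_pwDl ?nm_ge0.
have good0 : good t0.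
  move: t00; rewrite le_eqVlt => /orP[/eqP <- //|t00'] s rs.
  rewrite lt_neqAle (Fr t0) //= leNgt; apply/negP => s0.
  pose A := nm c * Im s ^+ m; pose B := K' * (1 + nm s) ^+ m.
  have A0 : 0 < A by rewrite mulr_gt0 ?nm_gt0 // exprn_gt0.
  have B0 : 0 < B by rewrite mulr_gt0.
  (* Within [A / (2 * B)] of [t0], the value of [F u] at the root [s] of [F t0] is at most [A / 2],
     while [nm_horner_ge_Im] makes it at least [A]. *)
  pose u := Num.max 0 (t0 - A / (2 * B)).
  have AB : 0 < A / (2 * B) by rewrite divr_gt0 // mulr_gt0.
  have u0 : 0 <= u by rewrite le_max lexx.
  have ut : u < t0 by rewrite gt_max t00' ltrBlDr ltrDl.
  have uP : 0 <= u <= 1 by rewrite u0 (le_trans (ltW ut)).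
  have [su lu] := Fs u uP.
  have := nm_horner_ge_Im (ltW s0) (fun r h => ltW (lt_good u u0 ut r h)).
  rewrite su lu /= => h1; have := FK' u t0 s uP t0P.
  rewrite (rootP rs) subr0 => h2; have := le_trans h1 h2.
  rewrite -/A leNgt => /negP; apply.
  rewrite mulrAC -/B ltr0_norm ?subr_lt0 // opprB.
  rewrite mulrC -ltr_pdivlMr // (@le_lt_trans _ _ (A / (2 * B))) //.
    by rewrite lerBlDr addrC -lerBlDr le_max lexx orbT.
  by rewrite invfM mulrA ltr_pM2r ?invr_gt0 // ltr_pdivrMr // mulr_natr mulr2n ltrDl.
have [s00 l00] := Fs t0 t0P.
have F00 : F t0 != 0 by rewrite -size_poly_eq0 s00.
have [k k0 Hk] := nm_horner_ge F00 good0.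
(* Openness: for [u] this close to [t0] the perturbation is smaller than the lower bound for [F t0]
   throughout the closed upper half plane. *)
have near_good (u : R) : 0 <= u <= 1 -> `|u - t0| < k / K' -> good u.
  move=> uP uk s rs; rewrite ltNge; apply/negP => s0.
  have := Hk s s0; rewrite s00 /= => h; have := FK' t0 u s t0P uP.
  rewrite (rootP rs) subr0 => h2; have := le_trans h h2.
  by rewrite ler_pM2r // leNgt distrC mulrC -ltr_pdivlMr // uk.
move: t01; rewrite le_eqVlt => /orP[/eqP <- //|t01'].
pose v := Num.min 1 (t0 + k / K' / 2).
have kK : 0 < k / K' by rewrite divr_gt0.
have tv : t0 < v by rewrite lt_min t01' ltrDl divr_gt0.
have vP : 0 <= v <= 1 by rewrite ge_min lexx (le_trans t00) // ltW.
suff : E v by move/(sup_upper_bound hsE); rewrite leNgt tv.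
split=> // u /andP[u0 uv]; have [ut|tu] := ltP u t0; first exact: lt_good.
have uP : 0 <= u <= 1 by rewrite u0 (le_trans uv) // ge_min lexx.
apply: near_good => //; rewrite ger0_norm ?subr_ge0 // ltrBlDr.
rewrite (le_lt_trans uv) // gt_min; apply/orP; right.
by rewrite addrC ltrD2r ltr_pdivrMr // mulr_natr mulr2n ltrDl.
Qed.

End complex_poly.
(** * Hyperbolicity of the elementary symmetric forms *)

Section garding.
Context {R : realType} {n : nat}.
Notation C := R[i].
Notation Im := complex.Im.
Notation Re := complex.Re.
Notation nm := Normc.normc.
Notation I := (1%:M : 'M[C]_n).
Implicit Types (A B a b x y z : 'M[C]_n) (l : seq 'M[C]_n) (s t c : C).

(** This is k! (n - k)! times the elementary symmetric polynomial of degree [k] in the eigenvalues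
    of [z]. The identity stands in for [beta], which is twice the identity. *)
Definition esigma k z := wedge (nseq k z ++ nseq (n - k) I).

Lemma wedge_nseqZ c z l k : (size l + k = n)%N ->
  wedge (nseq k (c *: z) ++ l) = c ^+ k * wedge (nseq k z ++ l).
Proof.
elim: k l => [|k IH] l sl; first by rewrite expr0 mul1r.
have n0 : (0 < n)%N by lia.
have w0 l' : wedge (0 :: l') = 0.
  have := @wedge_linear_head R n 1 0 0 l' n0; rewrite scale1r addr0 mul1r.
  by move/eqP; rewrite -subr_eq subrr eq_sym => /eqP.
have := wedge_linear_head c z 0 (nseq k (c *: z) ++ l) n0.
rewrite addr0 w0 addr0 /= => ->.
rewrite exprS -mulrA; congr (_ * _).
rewrite (@wedge_perm _ _ _ (nseq k (c *: z) ++ z :: l)); last 2 first.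
- by rewrite /= size_cat size_nseq; lia.
- by apply/seq.permP => P; rewrite /= !count_cat /=; lia.
rewrite IH /=; last by lia.
congr (_ * _); apply: wedge_perm.
- by rewrite size_cat size_nseq /=; lia.
- by apply/seq.permP => P; rewrite /= !count_cat /=; lia.
Qed.

(** Taking adjoints of all factors exchanges the roles of [s] and [t] in [wedge]. *)
Lemma wedge_conj l l' :
  (forall (p : 'I_n) j k, (nth 0 l' p) k j = Num.conj ((nth 0 l p) j k)) ->
  wedge l' = Num.conj (wedge l).
Proof.
move=> hl; rewrite /wedge rmorph_sum /= exchange_big /=; apply: eq_bigr => s _.
rewrite rmorph_sum; apply: eq_bigr => t _.
rewrite !rmorphM !rmorph_sign [X in X * _ = _]mulrC; congr (_ * _).
by rewrite rmorph_prod; apply: eq_bigr => p _; rewrite /= -hl.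
Qed.

Lemma wedge_real l : (forall A, A \in l -> real11 A) -> size l = n ->
  wedge l \is Num.real.
Proof.
move=> hl sl; rewrite CrealE; apply/eqP/esym/wedge_conj => p j k.
by apply: hl; rewrite mem_nth // sl.
Qed.

Lemma wedge_det A : wedge (nseq n A) = n`!%:R * \det A.
Proof.
rewrite /wedge -(card_Sn n) -sum1_card natr_sum mulr_suml.
have -> : \sum_(s in {: 'S_n}) (1%N)%:R * \det A = \sum_(s : 'S_n) \det A.
  by apply: eq_big => // s _; rewrite mul1r.
apply: eq_bigr => s _; rewrite (reindex_inj (mulgI s)); apply: eq_bigr => t _.
rewrite odd_permM (signr_addb _ s t) mulrA -(signr_addb _ s s) addbb mul1r.
congr (_ * _); rewrite [RHS](reindex_inj (@perm_inj _ s)); apply: eq_bigr => p _.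
by rewrite nth_nseq ltn_ord permM.
Qed.

Lemma wedge_id : wedge (nseq n I) = n`!%:R.
Proof. by rewrite wedge_det det1 mulr1. Qed.

Lemma wedge_id_gt0 : 0 < wedge (nseq n I).
Proof. by rewrite wedge_id ltr0n fact_gt0. Qed.

Definition qform (x : 'M[C]_n) (v : 'rV[C]_n) : C :=
  \sum_j \sum_k v ord0 j * x j k * Num.conj (v ord0 k).

Lemma qformE x v : qform x v = (v *m x *m (map_mx Num.conj v)^T) ord0 ord0.
Proof.
rewrite /qform exchange_big mxE; apply: eq_bigr => k _.
by rewrite !mxE mulr_suml; apply: eq_bigr => j _.
Qed.

Lemma real11_id : real11 I.
Proof. by move=> j k; rewrite !mxE eq_sym rmorph_nat. Qed.

Lemma qform_real x v : real11 x -> qform x v \is Num.real.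
Proof.
move=> hx; rewrite CrealE; apply/eqP; rewrite /qform rmorph_sum exchange_big.
apply: eq_bigr => j _; rewrite rmorph_sum; apply: eq_bigr => k _.
rewrite !rmorphM /= conjCK -hx.
by rewrite mulrC [X in _ * X = _]mulrC mulrA.
Qed.

Lemma qform_id_gt0 v : v != 0 -> 0 < qform I v.
Proof.
move=> v0; have [j vj] : exists j, v ord0 j != 0.
  apply/existsP; apply: contraNT v0; rewrite negb_exists => /forallP h.
  by apply/eqP/rowP => j; rewrite mxE; apply/eqP; have := h j; rewrite negbK.
have E i : \sum_k v ord0 i * I i k * Num.conj (v ord0 k) = `|v ord0 i| ^+ 2.
  rewrite (bigD1 i) //= big1 ?addr0 => [|k ki]; rewrite mxE ?eqxx ?mulr1 ?normCK //.
  by rewrite eq_sym (negPf ki) mulr0 mul0r.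
rewrite /qform (eq_bigr _ (fun i _ => E i)) (bigD1 j) //= ltr_pwDl //.
  by rewrite exprn_gt0 // normr_gt0.
by apply: sumr_ge0 => i _; rewrite exprn_ge0.
Qed.

(** Pairing a null vector of [x + t I] with itself exhibits [- t] as a Rayleigh quotient: real when
    [x] is Hermitian, nonnegative when [x] is positive semidefinite. *)
Lemma det_shift0 x t : \det (x + t *: I) = 0 ->
  exists2 v : 'rV[C]_n, v != 0 & t = - (qform x v / qform I v).
Proof.
move/eqP/det0P => [v v0 vx]; exists v => //.
have := congr1 (fun w : 'rV_n => (w *m (map_mx Num.conj v)^T) ord0 ord0) vx.
rewrite /= mulmxDr mulmxDl mxE -qformE -scalemxAr -scalemxAl mxE -qformE mul0mx mxE.
have q0 : qform I v != 0 by rewrite gt_eqF // qform_id_gt0.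
by move/eqP; rewrite addr_eq0 => /eqP ->; rewrite mulNr opprK mulfK.
Qed.

Lemma real_Im0 t : (t \is Num.real) = (Im t == 0).
Proof. by case: t => u v; rewrite complex_real. Qed.

(** For [k = n] this is the reality of eigenvalues. As a function of [t], the form of degree [k - 1]
    is a multiple of the derivative of the form of degree [k], so Gauss-Lucas descends from [k] to
    [k - 1]. *)
Lemma esigma_shift_upper x k t : real11 x -> (k <= n)%N -> 0 < Im t ->
  esigma k (x + t *: I) != 0.
Proof.
move=> hx kn t0; rewrite /esigma.
have {kn} [j -> jn] : exists2 j, k = (n - j)%N & (j <= n)%N by exists (n - k)%N; lia.
rewrite subKn //; elim: j jn t t0 => [|j IH] jn t t0.
  rewrite subn0 cats0 wedge_det; apply: mulf_neq0; first by rewrite pnatr_eq0 -lt0n fact_gt0.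
  apply/negP => /eqP/det_shift0[v v0 tE]; move: t0; rewrite tE.
  have : - (qform x v / qform I v) \is Num.real.
    by rewrite realN realM ?realV ?qform_real //; exact: real11_id.
  by rewrite real_Im0 => /eqP ->; rewrite ltxx.
have sj : (size (nseq j I) + (n - j) = n)%N by rewrite size_nseq; lia.
pose p := wpoly x I (nseq j I) (n - j).
have : p^`().[t] != 0.
  apply: gauss_lucas.
    rewrite ltnNge; apply/negP => sp.
    have : p`_(n - j) = 0 by rewrite nth_default // (leq_trans sp) // subn_gt0.
    rewrite coef_wpoly // binn mulr1n subnn /= -nseqD subnK; last by lia.
    by move/eqP; rewrite gt_eqF // wedge_id_gt0.
  move=> r rp; apply: le_lt_trans t0; rewrite leNgt; apply/negP => r0.
  have := IH (ltnW jn) r r0; rewrite -(horner_wpoly _ _ _ sj).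
  by rewrite (rootP rp) eqxx.
rewrite deriv_wpoly // hornerMn horner_wpoly; last by rewrite /= size_nseq; lia.
by rewrite mulrn_eq0 negb_or => /andP[_]; rewrite (_ : (n - j).-1 = n - j.+1)%N //; lia.
Qed.

Lemma esigmaN k z : (k <= n)%N -> esigma k (- z) = (-1) ^+ k * esigma k z.
Proof.
by move=> kn; rewrite /esigma -scaleN1r wedge_nseqZ // size_nseq; lia.
Qed.

Lemma esigmaZ k c z : (k <= n)%N -> esigma k (c *: z) = c ^+ k * esigma k z.
Proof. by move=> kn; rewrite /esigma wedge_nseqZ // size_nseq; lia. Qed.

Lemma real11N x : real11 x -> real11 (- x).
Proof. by move=> h j k; rewrite !mxE h rmorphN. Qed.

Lemma real11D x y : real11 x -> real11 y -> real11 (x + y).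
Proof. by move=> hx hy j k; rewrite !mxE hx hy rmorphD. Qed.

Lemma real11Z c x : c \is Num.real -> real11 x -> real11 (c *: x).
Proof. by move=> hc hx j k; rewrite !mxE hx rmorphM /= (CrealP hc). Qed.

Lemma esigma_shift_neq0 x k t : real11 x -> (k <= n)%N -> Im t != 0 ->
  esigma k (x + t *: I) != 0.
Proof.
move=> hx kn; rewrite neq_lt => /orP[t0|]; last exact: esigma_shift_upper.
have := @esigma_shift_upper (- x) k (- t) (real11N hx) kn.
rewrite scaleNr -opprD esigmaN // mulf_eq0 negb_or => h; apply: (proj2 (andP (h _))).
by case: t t0 {h} => u v /=; rewrite oppr_gt0.
Qed.

(** [Gamma m] lies in [closed_cone m]. Locating roots needs strict inequalities, so the theory is
    developed on [open_cone m] and extended to the closed cone by adding small multiples of the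
    identity. *)
Definition open_cone m a := real11 a /\ forall k, (k <= m)%N -> 0 < esigma k a.
Definition closed_cone m a := real11 a /\ forall k, (k <= m)%N -> 0 <= esigma k a.

Lemma horner_ge_term (p : {poly C}) k s : (forall i, 0 <= p`_i) -> 0 <= s ->
  p`_k * s ^+ k <= p.[s].
Proof.
move=> p0 s0; rewrite horner_coef; have [kp|pk] := ltnP k (size p).
  rewrite (bigD1 (Ordinal kp)) //= lerDl sumr_ge0 // => i _.
  by rewrite mulr_ge0 ?exprn_ge0.
by rewrite nth_default // mul0r sumr_ge0 // => i _; rewrite mulr_ge0 ?exprn_ge0.
Qed.

Lemma coef_esigma_shift a k j : (k <= n)%N -> (j <= k)%N ->
  (wpoly a I (nseq (n - k) I) k)`_j = esigma (k - j) a *+ 'C(k, j).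
Proof.
move=> kn jk; rewrite coef_wpoly ?size_nseq //; last by lia.
congr (_ *+ _); rewrite /esigma; apply: wedge_perm.
  by rewrite !size_cat !size_nseq; lia.
by apply/seq.permP => P; rewrite !count_cat !count_nseq; lia.
Qed.

Lemma horner_esigma a b k s : (k <= n)%N ->
  (wpoly a b (nseq (n - k) I) k).[s] = esigma k (a + s *: b).
Proof. by move=> kn; rewrite horner_wpoly // size_nseq; lia. Qed.

Lemma coef_esigma_shift_ge0 m a k i : (m <= n)%N -> closed_cone m a -> (k <= m)%N ->
  0 <= (wpoly a I (nseq (n - k) I) k)`_i.
Proof.
move=> mn [ha ea] km; have [ik|ki] := leqP i k.
  by rewrite coef_esigma_shift ?mulrn_wge0 ?ea //; lia.
by rewrite nth_default // (leq_trans (size_wpoly _ _ _ _)).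
Qed.

Lemma open_closed_cone m a : open_cone m a -> closed_cone m a.
Proof. by move=> [ha h]; split=> // k km; rewrite ltW ?h. Qed.

(** The coefficients of [esigma k (a + s I)] in [s] are binomial multiples of the
    [esigma (k - j) a], hence nonnegative, and a single positive one suffices: here the constant
    term, in [closed_cone_shift] the leading one. *)
Lemma open_cone_shift m a s : (m <= n)%N -> open_cone m a -> 0 <= s ->
  open_cone m (a + s *: I).
Proof.
move=> mn ha s0; split=> [|k km].
  by apply: real11D; [case: ha|apply: real11Z; [exact: ger0_real|exact: real11_id]].
rewrite -horner_esigma; last by lia.
apply: lt_le_trans (horner_ge_term 0 _ s0) => [|i].
  by rewrite expr0 mulr1 coef_esigma_shift ?subn0 ?bin0 ?(proj2 ha) //; lia.
exact: coef_esigma_shift_ge0 mn (open_closed_cone ha) km.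
Qed.

Lemma closed_cone_shift m a s : (m <= n)%N -> closed_cone m a -> 0 < s ->
  open_cone m (a + s *: I).
Proof.
move=> mn ha s0; split=> [|k km].
  by apply: real11D; [case: ha|apply: real11Z; [exact: gtr0_real|exact: real11_id]].
rewrite -horner_esigma; last by lia.
apply: lt_le_trans (horner_ge_term k _ (ltW s0)) => [|i].
  rewrite coef_esigma_shift ?binn ?subnn //; last by lia.
  by rewrite mulr_gt0 ?exprn_gt0 // /esigma subn0 wedge_id_gt0.
exact: coef_esigma_shift_ge0 mn ha km.
Qed.

Lemma open_coneZ m a s : (m <= n)%N -> open_cone m a -> 0 < s -> open_cone m (s *: a).
Proof.
move=> mn [ha h] s0; split=> [|k km]; first by apply: real11Z => //; exact: gtr0_real.
by rewrite esigmaZ ?mulr_gt0 ?exprn_gt0 ?h //; lia.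
Qed.

Lemma open_cone_id m : (m <= n)%N -> open_cone m I.
Proof.
move=> mn; split=> [|k km]; first exact: real11_id.
by rewrite /esigma -nseqD subnKC ?wedge_id_gt0 //; lia.
Qed.

End garding.

(** * Hyperbolicity with respect to the open cone, and its convexity *)

Section garding_hyperbolic.
Context {R : realType} {n : nat}.
Notation C := R[i].
Notation Im := complex.Im.
Notation Re := complex.Re.
Notation nm := Normc.normc.
Notation I := (1%:M : 'M[C]_n).
Implicit Types (A B a b x y z : 'M[C]_n) (l : seq 'M[C]_n) (s t c : C).

Lemma nm_sum (J : Type) (r : seq J) (F : J -> C) :
  nm (\sum_(i <- r) F i) <= \sum_(i <- r) nm (F i).
Proof.
elim: r => [|i r IH]; first by rewrite !big_nil Normc.normc0.
by rewrite !big_cons (le_trans (nmD _ _)) // lerD2l.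
Qed.

Lemma nmX s k : nm (s ^+ k) = nm s ^+ k.
Proof.
by elim: k => [|k IH]; rewrite ?expr0 ?Normc.normc1 // !exprS Normc.normcM IH.
Qed.

Lemma nm_real (u : R) : nm u%:C = `|u|.
Proof. by rewrite /= expr0n addr0 sqrtr_sqr. Qed.

Lemma nm_horner_le (p : {poly C}) k s : (size p <= k.+1)%N ->
  nm p.[s] <= (\sum_(i < k.+1) nm p`_i) * (1 + nm s) ^+ k.
Proof.
move=> sp; rewrite (horner_coef_wide _ sp) (le_trans (nm_sum _ _)) // mulr_suml.
apply: ler_sum => i _; rewrite Normc.normcM nmX; apply: ler_wpM2l; first exact: nm_ge0.
apply: (@le_trans _ _ ((1 + nm s) ^+ i)).
  by rewrite lerXn2r ?nnegrE ?addr_ge0 ?nm_ge0 // lerDr.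
by rewrite ler_weXn2l ?lerDl ?nm_ge0 // -ltnS.
Qed.

Lemma expr_lip (t u : R) k : 0 <= t <= 1 -> 0 <= u <= 1 ->
  `|t ^+ k - u ^+ k| <= k%:R * `|t - u|.
Proof.
move=> /andP[t0 t1] /andP[u0 u1]; elim: k => [|k IH]; first by rewrite subrr normr0 mul0r.
have -> : t ^+ k.+1 - u ^+ k.+1 = t * (t ^+ k - u ^+ k) + (t - u) * u ^+ k.
  by rewrite !exprS; ring.
rewrite -[k.+1%:R]natr1 [leRHS]mulrDl mul1r; apply: le_trans (ler_normD _ _) _.
rewrite !normrM; apply: lerD; first by rewrite (le_trans _ IH) // ler_piMl // ger0_norm.
by rewrite ler_piMr // ger0_norm ?exprn_ge0 // exprn_ile1.
Qed.

(** In powers of the parameter, the [j]-th coefficient is a polynomial in [s] of degree at most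
    [m - j], and [t ^+ j] is Lipschitz on the unit interval. This is the continuity that
    [lower_roots_homotopy] asks for. *)
Lemma wedge_pencil_lip z a y l m : (size l + m = n)%N ->
  exists K : R, forall (t u : R) s, 0 <= t <= 1 -> 0 <= u <= 1 ->
    nm (wedge (nseq m (z + t%:C *: y + s *: a) ++ l) -
        wedge (nseq m (z + u%:C *: y + s *: a) ++ l)) <=
    K * `|t - u| * (1 + nm s) ^+ m.
Proof.
move=> lm; pose c j := wpoly z a (nseq j y ++ l) (m - j).
pose K := \sum_(j < m.+1) nm ('C(m, j)%:R) * (\sum_(i < (m - j).+1) nm (c j)`_i) * j%:R.
exists K => t u s tP uP.
have E v : wedge (nseq m (z + v *: y + s *: a) ++ l) =
    \sum_(j < m.+1) 'C(m, j)%:R * (c j).[s] * v ^+ j.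
  rewrite addrAC -horner_wpoly // (horner_coef_wide _ (size_wpoly _ _ _ _)).
  apply: eq_bigr => j _; congr (_ * _).
  rewrite coef_wpoly // ?horner_wpoly ?size_cat ?size_nseq; [|by have := ltn_ord j; lia..].
  rewrite mulr_natl; congr (_ *+ _); apply: wedge_perm.
    by rewrite !size_cat !size_nseq; have := ltn_ord j; lia.
  by rewrite perm_catCA.
rewrite !E -sumrB (le_trans (nm_sum _ _)) // !mulr_suml; apply: ler_sum => j _.
rewrite -mulrBr !Normc.normcM -!rmorphXn -rmorphB nm_real -!mulrA.
rewrite ler_wpM2l ?nm_ge0 //.
rewrite (le_trans (ler_wpM2r _ (nm_horner_le s (size_wpoly _ _ _ _)))) //.
rewrite -!mulrA ler_wpM2l ?sumr_ge0 // => [i _|]; first exact: nm_ge0.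
rewrite mulrC mulrA ler_pM ?exprn_ge0 ?addr_ge0 ?nm_ge0 //; first exact: expr_lip.
by rewrite ler_weXn2l ?lerDl ?nm_ge0 // leq_subr.
Qed.

Lemma size_lead_esigma a z m : (m <= n)%N -> esigma m a != 0 ->
  size (wpoly z a (nseq (n - m) I) m) = m.+1 /\
  lead_coef (wpoly z a (nseq (n - m) I) m) = esigma m a.
Proof.
move=> mn a0; set p := wpoly _ _ _ _.
have cE : p`_m = esigma m a.
  by rewrite coef_wpoly ?size_nseq ?binn ?subnn ?mulr1n //; lia.
have sE : size p = m.+1.
  apply/eqP; rewrite eqn_leq size_wpoly ltnNge; apply/negP => h.
  by move: a0; rewrite -cE nth_default ?eqxx.
by split=> //; rewrite lead_coefE sE.
Qed.

(** For [r != 0] the form vanishes at [a + r^-1 I] as well. Then [r^-1] is real by hyperbolicity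
    with respect to [I], and it is not positive because the cone is stable under positive shifts. *)
Lemma open_cone_root_lt0 m a r : (m <= n)%N -> open_cone m a ->
  esigma m (I + r *: a) = 0 -> r < 0.
Proof.
move=> mn ha; have [ra ea] := ha.
have [->|r0] := eqVneq r 0.
  by rewrite scale0r addr0 => h; have := proj2 (@open_cone_id R n m mn) m (leqnn m); rewrite h ltxx.
have -> : I + r *: a = r *: (a + r^-1 *: I).
  by rewrite scalerDr scalerA mulfV // scale1r addrC.
rewrite esigmaZ // => /eqP; rewrite mulf_eq0 expf_eq0 (negPf r0) andbF /= => /eqP h.
have ri : r^-1 \is Num.real.
  by rewrite real_Im0; apply: contraT => /(esigma_shift_neq0 ra mn); rewrite h eqxx.
rewrite -invr_lt0; have /orP[] // := real_leVge (real0 _) ri => [r1|].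
  by have := proj2 (open_cone_shift mn ha r1) m (leqnn m); rewrite h ltxx.
by rewrite le_eqVlt invr_eq0 (negPf r0).
Qed.

Lemma le_small_false (A D : R) : 0 < A ->
  (forall e : R, 0 < e -> e <= 1 -> A <= D * e) -> False.
Proof.
move=> A0 h; have D0 : 0 < `|D| + 1 by rewrite ltr_wpDl.
pose e := Num.min 1 (A / (2 * (`|D| + 1))).
have e0 : 0 < e by rewrite lt_min ltr01 divr_gt0 // mulr_gt0.
have /h : e <= 1 by rewrite ge_min lexx.
move=> /(_ e0) h1; have h2 : e * (2 * (`|D| + 1)) <= A.
  by rewrite -ler_pdivlMr ?mulr_gt0 // ge_min lexx orbT.
have h3 : D * e <= `|D| * e by rewrite ler_wpM2r ?ler_norm // ltW.
have : 0 <= `|D| * e by rewrite mulr_ge0 // ltW.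
by lra.
Qed.

(** [x] is first perturbed by a positive imaginary multiple of the identity, so that hyperbolicity
    with respect to [I] keeps roots off the real axis; a lower bound independent of the perturbation
    then lets it tend to 0. *)
Lemma esigma_hyperbolic_upper m a x s : (m <= n)%N -> open_cone m a -> real11 x ->
  0 < Im s -> esigma m (x + s *: a) != 0.
Proof.
move=> mn ha hx s0; have [ra ea] := ha; pose ii : C := 0 +i* 1.
have em0 : esigma m a != 0 by rewrite gt_eqF // ea.
have sl : (size (nseq (n - m) I) + m = n)%N by rewrite size_nseq subnK.
(* The term [y] is switched on gradually. For [t = 0] the roots are [i] times negative numbers; for
   real [q] the argument is a Hermitian matrix shifted by [i I], where the form does not vanish. *)
have upper y r : real11 y -> 0 <= Im r -> esigma m (ii *: I + y + r *: a) != 0.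
  move=> hy r0; pose F (t : R) := wpoly (ii *: I + t%:C *: y) a (nseq (n - m) I) m.
  have [K HK] := wedge_pencil_lip (ii *: I) a y sl.
  have FE (t : R) q : (F t).[q] = esigma m (ii *: I + t%:C *: y + q *: a) by exact: horner_esigma.
  have realS (t : R) q : Im q = 0 -> esigma m (ii *: I + t%:C *: y + q *: a) != 0.
    move=> q0; rewrite -addrA addrC; apply: esigma_shift_neq0 => //; last exact: oner_neq0.
    apply: real11D; apply: real11Z => //; rewrite real_Im0 //.
    exact/eqP.
  have := @lower_roots_homotopy R F m (esigma m a) K em0.
  move=> /(_ (fun (t : R) _ => size_lead_esigma _ mn em0)) H.
  rewrite -[y]scale1r -[1]/(1%:C) -FE; apply/negP => /H h.
  suff : Im r < 0 by rewrite ltNge r0.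
  apply: h => [t u q tP uP|t q _|q].
  - by rewrite !FE; exact: HK.
  - move=> /rootP; rewrite FE => h; apply/negP => /eqP /(realS t).
    by rewrite h eqxx.
  - move=> /rootP; rewrite FE scale0r addr0 => h.
    have ii0 : ii != 0 by rewrite eq_complex /= oner_eq0 andbF.
    have : ii *: I + q *: a = ii *: (I + (q / ii) *: a).
      by rewrite scalerDr scalerA mulrC mulfVK.
    move=> E; move: h; rewrite E esigmaZ // => /eqP.
    rewrite mulf_eq0 expf_eq0 (negPf ii0) andbF /= => /eqP/(open_cone_root_lt0 mn ha) h.
    have -> : q = (q / ii) * ii by rewrite mulfVK.
    move: h; case: (q / ii) => u v; rewrite ltcE /= => /andP[/eqP <- h].
    by rewrite mulr1 mulr0 addr0.
(* After scaling by [e] the previous case puts all roots in the lower half plane, and the resulting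
   bound no longer involves [e]. *)
have lower (e : R) : 0 < e ->
    nm (esigma m a) * Im s ^+ m <= nm (esigma m (x + e%:C *: (ii *: I) + s *: a)).
  move=> e0; have eC : e%:C != 0 by rewrite (inj_eq (@complexI _)) gt_eqF.
  have [sE lE] := @size_lead_esigma a (x + e%:C *: (ii *: I)) m mn em0.
  have := @nm_horner_ge_Im R (wpoly (x + e%:C *: (ii *: I)) a (nseq (n - m) I) m) s (ltW s0).
  rewrite sE lE /= horner_esigma //; apply => r /rootP; rewrite horner_esigma // => h.
  rewrite leNgt; apply/negP => r0.
  have : x + e%:C *: (ii *: I) + r *: a =
      e%:C *: (ii *: I + e^-1%:C *: x + (e^-1%:C * r) *: a).
    rewrite fmorphV !scalerDr !scalerA mulfV // !mulrA mulfV // mul1r scale1r.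
    by rewrite [x + _]addrC.
  move=> E; move: h; rewrite E esigmaZ // => /eqP.
  rewrite mulf_eq0 expf_eq0 (negPf eC) andbF /=; apply/negP; apply: upper.
    by apply: real11Z => //; rewrite real_Im0.
  case: r r0 {E} => u v /= v0; rewrite mul0r addr0 mulr_ge0 ?invr_ge0 // ltW //.
apply/negP => /eqP h0.
have [K HK] := wedge_pencil_lip x a (ii *: I) sl.
apply: (@le_small_false (nm (esigma m a) * Im s ^+ m) (K * (1 + nm s) ^+ m)).
  by rewrite mulr_gt0 ?exprn_gt0 // nm_gt0.
move=> e e0 e1; apply: le_trans (lower e e0) _.
have := HK e 0 s; rewrite !lexx ler01 e1 ltW // => /(_ isT isT).
rewrite scale0r addr0 -![wedge _]/(esigma m _) h0 !subr0 gtr0_norm //.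
by rewrite mulrAC.
Qed.

Lemma esigma_hyperbolic m a x s : (m <= n)%N -> open_cone m a -> real11 x ->
  Im s != 0 -> esigma m (x + s *: a) != 0.
Proof.
move=> mn ha hx; rewrite neq_lt => /orP[s0|]; last exact: esigma_hyperbolic_upper.
have := @esigma_hyperbolic_upper m a (- x) (- s) mn ha (real11N hx).
rewrite scaleNr -opprD esigmaN // mulf_eq0 negb_or => h; apply: (proj2 (andP (h _))).
by case: s s0 {h} => u v /=; rewrite oppr_gt0.
Qed.

Lemma horner_gt0 (p : {poly C}) u : 0 < lead_coef p -> 0 <= u ->
  (forall r, root p r -> r < 0) -> 0 < p.[u].
Proof.
have [rs prs] := closed_field_poly_normal p; move=> c0 u0 pr.
have {}pr : forall r, r \in rs -> r < 0.
  by move=> r rrs; apply: pr; rewrite prs rootZ ?gt_eqF // root_prod_XsubC.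
rewrite prs hornerZ mulr_gt0 // horner_prod big_seq prodr_gt0 // => r rrs.
by rewrite hornerXsubC subr_gt0 (lt_le_trans (pr r rrs)).
Qed.

(** All roots [r] of [esigma m (b + r *: a)] are shown to be negative, so the value at [r = 1] is
    positive. The substitution [r = - i q] sends negative [r] to the negative imaginary axis, and
    the homotopy from [I] to [b] is run in [q]. *)
Lemma esigmaD_gt0 m a b : (m <= n)%N -> open_cone m a -> open_cone m b ->
  0 < esigma m (a + b).
Proof.
move=> mn ha hb; have [ra ea] := ha; have [rb eb] := hb; pose ii : C := 0 +i* 1.
have em0 : esigma m a != 0 by rewrite gt_eqF // ea.
have ii0 : ii != 0 by rewrite eq_complex /= oner_eq0 andbF.
have eia : esigma m (- ii *: a) != 0.
  by rewrite esigmaZ // mulf_neq0 // expf_neq0 // oppr_eq0.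
have sl : (size (nseq (n - m) I) + m = n)%N by rewrite size_nseq subnK.
pose F (t : R) := wpoly (I + t%:C *: (b - I)) (- ii *: a) (nseq (n - m) I) m.
have FE (t : R) q : (F t).[q] = esigma m (I + t%:C *: (b - I) + (- ii * q) *: a).
  by rewrite /F horner_esigma // scalerA [q * _]mulrC.
have [K HK] := wedge_pencil_lip I (- ii *: a) (b - I) sl.
have rt (t : R) : real11 (I + t%:C *: (b - I)).
  apply: real11D; first exact: real11_id.
  apply: real11Z; first by rewrite real_Im0.
  by apply: real11D => //; apply: real11N; exact: real11_id.
have neg q : root (F 1) q -> Im q < 0.
  apply: (@lower_roots_homotopy R F m _ K eia).
  - by move=> t _; exact: size_lead_esigma.
  - by move=> t u r tP uP; rewrite /F !horner_esigma //; exact: HK.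
  (* On the real axis, [r != 0] gives a nonreal multiple of [a], excluded by hyperbolicity; [r = 0]
     gives a point of the segment from [I] to [b], where the form is positive. *)
  - move=> t r /andP[t0 t1] /rootP; rewrite FE => h; apply/negP => /eqP r0.
    have [r00|r00] := eqVneq r 0; last first.
      have : Im (- ii * r) != 0.
        case: r r0 r00 {h} => u v /= ->; rewrite mulr0 mulN1r add0r oppr_eq0.
        by apply: contra => /eqP ->.
      by move/(esigma_hyperbolic mn ha (rt t)); rewrite h eqxx.
    move: h; rewrite r00 mulr0 scale0r addr0.
    have -> : I + t%:C *: (b - I) = (1 - t)%:C *: I + t%:C *: b.
      by rewrite scalerBr rmorphB scalerBl scale1r addrA addrAC.
    move: t0; rewrite le_eqVlt => /orP[/eqP <-|t0].
      rewrite scale0r addr0 subr0 scale1r => h.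
      by have := proj2 (@open_cone_id R n m mn) m (leqnn m); rewrite h ltxx.
    have tC : t%:C != 0 by rewrite (inj_eq (@complexI _)) gt_eqF.
    have -> : (1 - t)%:C *: I + t%:C *: b = t%:C *: (b + ((1 - t) / t)%:C *: I).
      by rewrite scalerDr scalerA -rmorphM mulrC mulfVK ?gt_eqF // addrC.
    rewrite esigmaZ // => /eqP; rewrite mulf_eq0 expf_eq0 (negPf tC) andbF /=.
    apply/negP; rewrite gt_eqF //; apply: (proj2 (open_cone_shift mn hb _)) => //.
    by rewrite ler0c divr_ge0 ?subr_ge0 // ltW.
  - move=> r /rootP; rewrite FE scale0r addr0 => /(open_cone_root_lt0 mn ha).
    by case: r => u v; rewrite ltcE /= => /andP[_]; lra.
have := @horner_gt0 (wpoly b a (nseq (n - m) I) m) 1.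
rewrite horner_esigma // scale1r addrC; apply.
- by rewrite (proj2 (size_lead_esigma _ mn em0)) ea.
- exact: ler01.
move=> r /rootP; rewrite horner_esigma // => h.
have r0 : Im r = 0.
  by apply/eqP; apply: contraT => /(esigma_hyperbolic mn ha rb); rewrite h eqxx.
have : root (F 1) (ii * r).
  apply/rootP; rewrite FE scale1r addrCA subrr addr0 mulNr mulrA.
  by rewrite (_ : ii * ii = -1) ?mulN1r ?opprK // -expr2 sqr_i.
move/neg; case: r r0 {h} => u v /= ->; rewrite ltcE /= eqxx /=; lra.
Qed.

Lemma open_coneD m a b : (m <= n)%N -> open_cone m a -> open_cone m b ->
  open_cone m (a + b).
Proof.
move=> mn ha hb; split=> [|k km]; first by apply: real11D; [case: ha|case: hb].
have sub (c : 'M[C]_n) : open_cone m c -> open_cone k c.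
  by move=> [rc h]; split=> // j jk; apply: h; apply: leq_trans km.
by apply: esigmaD_gt0; [exact: leq_trans mn|exact: sub..].
Qed.

End garding_hyperbolic.

(** * Garding's inequality and the decomposition into squares *)

Section garding_inequality.
Context {R : realType} {n : nat}.
Notation C := R[i].
Notation Im := complex.Im.
Notation Re := complex.Re.
Notation I := (1%:M : 'M[C]_n).
Implicit Types (A B a b x y z : 'M[C]_n) (l : seq 'M[C]_n) (s t c : C).

Lemma lead_wpoly_gt1 z a l k : (size l + k.+1 = n)%N ->
  wedge (nseq k.+1 a ++ l) != 0 -> (1 < size (wpoly z a l k.+1))%N.
Proof.
move=> sl h; rewrite ltnNge; apply/negP => sp; move: h.
have : (wpoly z a l k.+1)`_k.+1 = 0 by rewrite nth_default // (leq_trans sp).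
by rewrite coef_wpoly // binn mulr1n subnn /= => ->; rewrite eqxx.
Qed.

(* Differentiating in the direction [a] preserves both the absence of zeros on
   the tube over the cone (Gauss-Lucas) and the positivity on the cone. *)
Lemma garding_tube m l k : (m <= n)%N -> (forall a, a \in l -> open_cone m a) ->
  (size l + k = m)%N -> (0 < k)%N ->
  (forall x y, real11 x -> open_cone m y ->
     wedge (nseq k (x + (0 +i* 1) *: y) ++ l ++ nseq (n - m) I) != 0) /\
  (forall y, open_cone m y -> 0 < wedge (nseq k y ++ l ++ nseq (n - m) I)).
Proof.
move=> mn; elim: l k => [|a l IH] k hl sk k0.
  have <- : m = k by rewrite -sk.
  split=> [x y hx hy|y [_ hy]]; last exact: hy.
  by apply: (esigma_hyperbolic mn hy hx); rewrite oner_eq0.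
have ha : open_cone m a by apply: hl; rewrite mem_head.
have hl' b : b \in l -> open_cone m b by move=> h; apply: hl; rewrite inE h orbT.
have [ne0 gt0] := IH k.+1 hl' ltac:(by move: sk => /=; lia) isT.
have sL : (size (l ++ nseq (n - m) I) + k.+1 = n)%N.
  by rewrite size_cat size_nseq; move: sk => /=; lia.
set L := l ++ nseq (n - m) I in ne0 gt0 sL *.
have sp z : (1 < size (wpoly z a L k.+1))%N.
  by apply: lead_wpoly_gt1 => //; rewrite gt_eqF // gt0.
have perm_aL z : wedge (nseq k z ++ (a :: l) ++ nseq (n - m) I) = wedge (nseq k z ++ a :: L) by [].
have Sder z : (wpoly z a L k.+1)^`().[0] = wedge (nseq k z ++ a :: L) *+ k.+1.
  by rewrite deriv_wpoly // hornerMn horner_wpoly /= ?scale0r ?addr0 //; lia.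
have root_im z r : root (wpoly z a L k.+1) r -> wedge (nseq k.+1 (z + r *: a) ++ L) = 0.
  by move=> /rootP; rewrite horner_wpoly.
have split_r (r : C) : r = (Re r)%:C + (0 +i* 1) * (Im r)%:C.
  by case: r => u v; apply/eqP; rewrite eq_complex /= ; apply/andP; split; apply/eqP; ring.
split=> [x y hx hy|y hy]; rewrite perm_aL.
  set z := x + _ *: y; have : (wpoly z a L k.+1)^`().[0] != 0.
    (* If [Im r >= 0], the imaginary part [y + (Im r) a] of [z + r a] is still in the cone, so
       [z + r a] is no zero. *)
    apply: gauss_lucas => // r /root_im h; rewrite ltNge; apply/negP => /= r0.
    have := ne0 (x + (Re r)%:C *: a) (y + (Im r)%:C *: a).
    rewrite scalerDr addrACA -/z scalerA -scalerDl -split_r h eqxx.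
    move=> H; suff : false by []; apply: H.
      by apply: real11D => //; apply: real11Z; [rewrite real_Im0|case: ha].
    move: r0; rewrite le_eqVlt => /orP[/eqP <-|r0]; first by rewrite scale0r addr0.
    by apply: open_coneD => //; apply: open_coneZ => //; rewrite ltcR.
  by rewrite Sder mulrn_eq0.
have : 0 < (wpoly y a L k.+1)^`().[0]; last by rewrite Sder pmulrn_lgt0.
have [ry _] := hy; have [ra _] := ha.
have pos r : 0 < r -> open_cone m (y + r *: a) by move=> r0; apply: open_coneD => //; exact: open_coneZ.
apply: deriv0_gt0 => //; first by rewrite horner_wpoly // scale0r addr0 gt0.
move=> r /root_im h.
have r0 : Im r = 0.
  (* A nonreal root produces a zero in the tube: directly if [Im r > 0], and after changing the sign
     of [y + r a] if [Im r < 0]. *)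
  apply/eqP; apply: contraT; rewrite neq_lt => /orP[] r0.
    have := ne0 (- (y + (Re r)%:C *: a)) ((- Im r)%:C *: a).
    have -> : - (y + (Re r)%:C *: a) + (0 +i* 1) *: ((- Im r)%:C *: a) = -1 *: (y + r *: a).
      rewrite scalerA [in RHS](split_r r) rmorphN mulrN scaleNr scaleN1r.
      by rewrite -opprD -addrA scalerDl.
    rewrite wedge_nseqZ // h mulr0 eqxx => H; suff : false by []; apply: H.
      by apply: real11N; apply: real11D => //; apply: real11Z => //; rewrite real_Im0.
    by apply: open_coneZ => //; rewrite ltcR oppr_gt0.
  have := ne0 (y + (Re r)%:C *: a) ((Im r)%:C *: a).
  rewrite scalerA -addrA -scalerDl -split_r h eqxx => H; suff : false by []; apply: H.
    by apply: real11D => //; apply: real11Z => //; rewrite real_Im0.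
  by apply: open_coneZ => //; rewrite ltcR.
rewrite real_ltNge ?real0 ?real_Im0 ?r0 //; apply/negP => rn.
have := @gt0 (y + r *: a); rewrite h ltxx => H; suff : false by []; apply: H.
move: rn; rewrite le_eqVlt => /orP[/eqP <-|]; first by rewrite scale0r addr0.
exact: pos.
Unshelve. all: by move: r0 => /=; rewrite ?real_Im0.
Qed.

Lemma garding_open m l : (m <= n)%N -> (forall a, a \in l -> open_cone m a) ->
  size l = m -> 0 < wedge (l ++ nseq (n - m) I).
Proof.
move=> mn; case: l => [|a l] hl sl.
  by move: sl => /= <-; rewrite subn0 wedge_id_gt0.
have hl' b : b \in l -> open_cone m b by move=> h; apply: hl; rewrite inE h orbT.
have [_ h] := @garding_tube m l 1 mn hl' ltac:(by move: sl => /=; lia) isT.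
by have := h a (hl a (mem_head _ _)).
Qed.

(** The members of [l] are replaced one at a time by [a + e I], which joins [l']. The product is
    affine in [e], so nonnegativity for all [e > 0] passes to [e = 0]. *)
Lemma garding_closed m l l' : (m <= n)%N -> (forall a, a \in l -> closed_cone m a) ->
  (forall a, a \in l' -> open_cone m a) -> (size l + size l' = m)%N ->
  0 <= wedge (l ++ l' ++ nseq (n - m) I).
Proof.
move=> mn; elim: l l' => [|a l IH] l' hl hl' sl.
  by rewrite /= ltW // garding_open.
have ha := hl a (mem_head _ _).
have hl2 b : b \in l -> closed_cone m b by move=> h; apply: hl; rewrite inE h orbT.
have n0 : (0 < n)%N by move: sl => /=; lia.
have re : wedge ((a :: l) ++ l' ++ nseq (n - m) I) \is Num.real.
  apply: wedge_real => [b|]; last by rewrite !size_cat size_nseq addnA sl subnKC.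
  rewrite !mem_cat => /or3P[/hl[]|/hl'[]|/nseqP[-> _]] //; exact: real11_id.
rewrite real_leNgt ?real0 //; apply/negP; set p := wedge _ in re * => p0.
pose q := wedge (I :: l ++ l' ++ nseq (n - m) I).
have h (e : C) : 0 < e -> 0 <= p + e * q.
  move=> e0; rewrite addrC -wedge_linear_head // addrC.
  rewrite (@wedge_perm _ _ _ (l ++ ((a + e *: I) :: l') ++ nseq (n - m) I)).
  - apply: IH => // [b|]; last by move: sl => /=; lia.
    by rewrite inE => /orP[/eqP ->|/hl' //]; exact: closed_cone_shift.
  - by move: sl; rewrite /= !size_cat size_nseq; lia.
  - by rewrite -cat1s perm_catCA.
have q0 : 0 <= p + 1 * q by exact: h.
have qp : 0 < q by rewrite mul1r in q0; rewrite -(addKr p q) ltr_wpDr // oppr_gt0.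
(* For this [e] the affine function takes the value [p / 2 < 0]. *)
have := h (- p / (2 * q)); rewrite divr_gt0 ?oppr_gt0 ?mulr_gt0 // => /(_ isT).
rewrite invfM mulrA mulfVK ?gt_eqF // mulNr -[X in X - _]mulr1 -mulrBr.
by rewrite nmulr_rge0 // subr_le0 invf_ge1 // lern1.
Qed.

(** Up to positive factors the [esigma k x] are the coefficients of the polynomial [det (x + t I)]
    in [t], which has nonpositive roots and a positive leading coefficient. *)
Lemma psd_closed_cone m x : (m <= n)%N -> real11 x ->
  (forall v : 'rV_n, 0 <= qform x v) -> closed_cone m x.
Proof.
move=> mn rx hx; split=> // k km.
have E : (wpoly x I (nseq (n - n) I) n)`_(n - k) = esigma k x *+ 'C(n, n - k).
  by rewrite coef_esigma_shift ?leq_subr // subKn //; lia.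
have : 0 <= (wpoly x I (nseq (n - n) I) n)`_(n - k); last first.
  by rewrite E pmulrn_lge0 // bin_gt0 leq_subr.
set p := wpoly _ _ _ _; have [rs prs] := closed_field_poly_normal p.
have en0 : esigma n I != 0 by rewrite gt_eqF // (proj2 (@open_cone_id R n n _)).
have [sp lp] := @size_lead_esigma R n I x n (leqnn n) en0.
have hrs r : r \in rs -> r <= 0.
  move=> rrs; have : root p r.
    by rewrite prs rootZ ?root_prod_XsubC // lp.
  move=> /rootP; rewrite horner_esigma // /esigma subnn cats0 wedge_det => /eqP.
  rewrite mulf_eq0 pnatr_eq0 -[_`! == _]negbK -lt0n fact_gt0 /= => /eqP/det_shift0[v v0 ->].
  by rewrite oppr_le0 divr_ge0 // ltW // qform_id_gt0.
rewrite prs coefZ mulr_ge0 //; first by rewrite lp ltW // (proj2 (@open_cone_id R n n _)).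
move: (n - k)%N => i; elim: rs hrs i {prs} => [|r rs IH] hrs i.
  by rewrite big_nil coefC; case: ifP.
have hrs' r' : r' \in rs -> r' <= 0 by move=> h; apply: hrs; rewrite inE h orbT.
rewrite big_cons mulrBl coefB coefXM coefCM addr_ge0 //.
  by case: ifP => // _; exact: IH.
by rewrite oppr_ge0 mulr_le0_ge0 ?IH // hrs ?mem_head.
Qed.

Lemma closed_cone_Gamma m a : (m <= n)%N -> Gamma m a -> closed_cone m a.
Proof.
move=> mn [ra ha]; split=> // k km.
case: k km => [|k] km; first by rewrite /esigma subn0 ltW // wedge_id_gt0.
have := ha k.+1; rewrite km => /(_ isT).
have -> : beta = (2 : C) *: I by rewrite /beta ddc_sqnorm scalemx1.
rewrite (@wedge_perm _ _ _ (nseq (n - k.+1) (2 *: I) ++ nseq k.+1 a)); last 2 first.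
- by rewrite size_cat !size_nseq; lia.
- by rewrite perm_catC.
rewrite wedge_nseqZ ?size_nseq; last by lia.
rewrite pmulr_rge0 ?exprn_gt0 // /esigma => h.
rewrite (@wedge_perm _ _ _ (nseq (n - k.+1) I ++ nseq k.+1 a)) //.
- by rewrite size_cat !size_nseq; lia.
- by rewrite perm_catC.
Qed.

Lemma wedge_sum_head (w : seq 'M[C]_n) (M : 'M[C]_n) : (0 < n)%N ->
  wedge (M :: w) = \sum_j \sum_k M j k * wedge (delta_mx j k :: w).
Proof.
move=> n0; pose f (A : 'M[C]_n) := wedge (A :: w).
have f0 : f 0 = 0.
  have := @wedge_linear_head R n 1 0 0 w n0; rewrite scale1r addr0 mul1r.
  by move/eqP; rewrite -subr_eq subrr eq_sym => /eqP.
have fD A B : f (A + B) = f A + f B by rewrite /f -[A]scale1r wedge_linear_head // mul1r scale1r.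
have fZ c A : f (c *: A) = c * f A.
  by rewrite /f -[c *: A]addr0 wedge_linear_head // -/(f 0) f0 addr0.
rewrite -/(f M) [in LHS](matrix_sum_delta M) (big_morph f fD f0).
by apply: eq_bigr => j _; rewrite (big_morph f fD f0); apply: eq_bigr => k _; rewrite fZ.
Qed.

(** As a linear functional of [M] the product is given by a matrix [B]. Garding's inequality on the
    rank-one forms [G v] makes [B] positive semidefinite, and the vectors [xi i] are its
    eigenvectors scaled by the square roots of the eigenvalues. *)
Lemma garding_sos m (l : (m.-1).-tuple 'M[C]_n) : (1 <= m <= n)%N ->
  (forall i, Gamma m (tnth l i)) ->
  exists xi : 'I_n -> 'I_n -> C, forall M : 'M[C]_n,
    wedge (M :: l ++ nseq (n - m) beta) =
    \sum_i \sum_j \sum_k M j k * (xi i j * Num.conj (xi i k)).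
Proof.
move=> /andP[m1 mn] hl; have n0 : (0 < n)%N by lia.
set w := l ++ _; have sw : size w = n.-1.
  by rewrite size_cat size_nseq size_tuple; lia.
have rw A : A \in w -> real11 A.
  rewrite mem_cat => /orP[/tnthP[i ->]|/nseqP[-> _]]; first by case: (hl i).
  by rewrite /beta ddc_sqnorm -scalemx1; apply: real11Z; [exact: ger0_real|exact: real11_id].
pose B : 'M[C]_n := \matrix_(j, k) wedge (delta_mx j k :: w).
have wB M : wedge (M :: w) = \sum_j \sum_k M j k * B j k.
  by rewrite wedge_sum_head //; apply: eq_bigr => j _; apply: eq_bigr => k _; rewrite mxE.
pose G (v : 'I_n -> C) : 'M[C]_n := \matrix_(j, k) (v j * Num.conj (v k)).
have Greal v : real11 (G v).
  by move=> j k; rewrite !mxE rmorphM /= conjCK mulrC.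
have psd v : 0 <= \sum_j \sum_k v j * Num.conj (v k) * B j k.
  have -> : \sum_j \sum_k v j * Num.conj (v k) * B j k = wedge (G v :: w).
    by rewrite wB; apply: eq_bigr => j _; apply: eq_bigr => k _; rewrite [in RHS]mxE.
  have -> : wedge (G v :: w) = 2 ^+ (n - m) * wedge ((G v :: l) ++ [::] ++ nseq (n - m) I).
    rewrite /w (_ : beta = (2 : C) *: I); last by rewrite /beta ddc_sqnorm scalemx1.
    rewrite (@wedge_perm _ _ _ (nseq (n - m) (2 *: I) ++ (G v :: l))); last 2 first.
    - by rewrite /= size_cat size_nseq size_tuple; lia.
    - by rewrite -cat_cons perm_catC.
    rewrite wedge_nseqZ; last by rewrite /= size_tuple; lia.
    congr (_ * _); apply: wedge_perm; last by rewrite perm_catC.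
    by rewrite size_cat size_nseq /= size_tuple; lia.
  rewrite mulr_ge0 ?exprn_ge0 //; apply: garding_closed => // [a|]; last by rewrite /= size_tuple; lia.
  rewrite inE => /orP[/eqP ->|/tnthP[i ->]]; last exact: closed_cone_Gamma.
  apply: psd_closed_cone => // u.
  have -> : qform (G v) u = (\sum_j u ord0 j * v j) * Num.conj (\sum_j u ord0 j * v j).
    rewrite rmorph_sum mulr_suml; apply: eq_bigr => j _; rewrite mulr_sumr.
    by apply: eq_bigr => k _; rewrite mxE rmorphM /=; ring.
  exact: mul_conjC_ge0.
have hB j k : B k j = Num.conj (B j k).
  rewrite !mxE; apply: wedge_conj => p u v.
  case: p => -[|p] hp /=; first by rewrite !mxE rmorph_nat andbC.
  by apply: rw; rewrite mem_nth // sw; lia.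
clearbody B.
have nB : B \is normalmx.
  have E : map_mx Num.conj B^T = B by apply/matrixP => j k; rewrite !mxE -hB.
  by apply/normalmxP; rewrite E.
have /orthomx_spectralP Bsp := nB; set P := spectralmx B in Bsp.
set d := spectral_diag B in Bsp.
have uP : P \is unitarymx by exact: spectral_unitarymx.
have Pi : invmx P = map_mx Num.conj P^T by exact: invmx_unitary.
have BE j k : B j k = \sum_i Num.conj (P i j) * d ord0 i * P i k.
  rewrite Bsp Pi mxE; apply: eq_bigr => i _; congr (_ * _).
  by rewrite mul_mx_diag !mxE.
have dge i : 0 <= d ord0 i.
  suff -> : d ord0 i = \sum_j \sum_k P i j * Num.conj (P i k) * B j k by exact: psd.
  have : (P *m B *m map_mx Num.conj P^T) i i = d ord0 i.
    rewrite Bsp -Pi !mulmxA mulmxV ?unitarymx_unit // mul1mx -mulmxA mulmxV ?unitarymx_unit // mulmx1.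
    by rewrite mxE eqxx mulr1n.
  move=> <-; rewrite mxE exchange_big; apply: eq_bigr => k _.
  by rewrite !mxE mulr_suml; apply: eq_bigr => j _; ring.
exists (fun i j => sqrtC (d ord0 i) * Num.conj (P i j)) => M.
rewrite wB [RHS]exchange_big; apply: eq_bigr => j _.
rewrite [RHS]exchange_big; apply: eq_bigr => k _.
rewrite -mulr_sumr BE; congr (_ * _); apply: eq_bigr => i _.
have sd : Num.conj (sqrtC (d ord0 i)) = sqrtC (d ord0 i).
  by apply: CrealP; rewrite ger0_real // sqrtC_ge0.
rewrite rmorphM /= conjCK sd -[d ord0 i in LHS]sqrtCK expr2.
by ring.
Qed.

End garding_inequality.
(** * Lebesgue measure and bounded functions with bounded support *)

Section lebesgue_rV_facts.
Context {R : realType}.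
Local Notation mu N := (@lebesgue_rV R N).

Lemma normrV_leP N (v : 'rV[R]_N) (r : R) : 0 <= r ->
  `|v| <= r <-> forall i, `|v ord0 i| <= r.
Proof.
move=> r0; rewrite [`|v|]/Num.norm /= mx_normrE; split=> [/bigmax_leP[_ h] i|h].
  exact: (h (ord0, i)).
by apply/bigmax_leP; split=> // -[i j] _ /=; rewrite (ord1 i).
Qed.

Lemma coord_le_norm N (v : 'rV[R]_N) i : `|v ord0 i| <= `|v|.
Proof. by apply: (proj1 (normrV_leP v (normr_ge0 v))). Qed.

Lemma normrV_ltP N (v : 'rV[R]_N) (r : R) : 0 < r ->
  `|v| < r <-> forall i, `|v ord0 i| < r.
Proof.
move=> r0; split=> [h i|h]; first exact: le_lt_trans (coord_le_norm _ _) h.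
rewrite [`|v|]/Num.norm /= mx_normrE; apply/bigmax_ltP; split=> // -[i j] _ /=.
by rewrite (ord1 i).
Qed.

Lemma measurable_continuous N (f : 'rV[R]_N -> R) : continuous f ->
  measurable_fun setT (f : borel R N -> measurableTypeR R).
Proof.
move=> cf; apply: (measurability _ (RGenOpens.measurableE R)) => _ [_ [a [b ->]] <-].
rewrite setTI; apply: open_borel; apply: open_comp; last exact: interval_open.
by move=> x _; exact: cf.
Qed.

Definition obox N (a b : 'I_N -> R) := [set v : 'rV[R]_N | forall i, v ord0 i \in `]a i, b i[].

Lemma obox_open N (a b : 'I_N -> R) : open (obox a b).
Proof.
rewrite (_ : obox a b = \big[setI/setT]_(i < N)
    ((fun v : 'rV[R]_N => v ord0 i) @^-1` `]a i, b i[)); last first.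
  apply/seteqP; split=> v; rewrite -bigcap_seq => h i /=; first by move=> _; exact: h.
  by apply: h => /=; exact: mem_index_enum.
apply: big_ind => [||i _]; [exact: openT|exact: openI|].
by apply: open_comp; [move=> x _; exact: coord_continuous|exact: interval_open].
Qed.

Lemma measurable_obox N (a b : 'I_N -> R) : measurable (obox a b : set (borel R N)).
Proof. by apply: open_borel; exact: obox_open. Qed.

Lemma lebesgue_obox N (a b : 'I_N -> R) :
  mu N (obox a b) = (\big[*%E/1]_(i < N) lebesgue_measure (`]a i, b i[%classic : set R))%E.
Proof.
rewrite -(@lebesgue_rV_box R N (fun i => `]a i, b i[%classic)); last first.
  by move=> i; exact: measurable_itv.
by congr (mu N _); apply/seteqP; split=> v.
Qed.

Definition oboxes N := [set A : set 'rV[R]_N | exists a b, A = obox a b].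

Lemma borel_oboxes N : @measurable _ (borel R N) = <<s @oboxes N >>.
Proof.
apply/seteqP; split; last first.
  apply: smallest_sub; first exact: sigma_algebra_measurable.
  by move=> _ [a [b ->]]; exact: measurable_obox.
apply: smallest_sub; first exact: smallest_sigma_algebra.
move=> U oU; rewrite (open_ratbox oU) bigcup_mkcond.
pose T : measurableType _ := g_sigma_algebraType (@oboxes N).
apply: (@countable_bigcupT_measurable _ T) => // p.
case: ifPn => _; last exact: (@measurable0 _ T).
apply: sub_sigma_algebra; exists (fun i => ratr (p.1 i) - ratr p.2), (fun i => ratr (p.1 i) + ratr p.2).
by apply/seteqP; split=> v /= h i; have := h i; rewrite in_itv /= distrC ltr_distl.
Qed.

Lemma setI_oboxes N : setI_closed (@oboxes N).
Proof.
move=> _ _ [a [b ->]] [c [d ->]].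
exists (fun i => Num.max (a i) (c i)), (fun i => Num.min (b i) (d i)).
apply/seteqP; split=> v /=.
  move=> [h h'] i; have := h i; have := h' i; rewrite !in_itv /= gt_max lt_min.
  by move=> /andP[-> ->] /andP[-> ->].
by move=> h; split=> i; have := h i; rewrite !in_itv /= gt_max lt_min;
  move=> /andP[/andP[h1 h2] /andP[h3 h4]]; apply/andP.
Qed.

Lemma lebesgue_oboxE N (a b : 'I_N -> R) :
  mu N (obox a b) = (\prod_(i < N) Num.max 0 (b i - a i))%:E.
Proof.
rewrite lebesgue_obox (big_morph _ (@EFinM R) (erefl _)); apply: eq_bigr => i _.
rewrite lebesgue_measure_itv /= lte_fin.
by case: ltP => ab; [rewrite max_r // subr_ge0 ltW|rewrite max_l // subr_le0].
Qed.

Lemma lebesgue_obox_lty N (a b : 'I_N -> R) : (mu N (obox a b) < +oo)%E.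
Proof. by rewrite lebesgue_oboxE ltry. Qed.

Lemma measurable_shift N (v : 'rV[R]_N) :
  measurable_fun setT ((fun x => x + v) : borel R N -> borel R N).
Proof.
apply: measurable_fun_rV => i.
rewrite (_ : (fun t => _) = (fun t : borel R N => t ord0 i + v ord0 i)); last first.
  by apply/funext => t; rewrite mxE.
by apply: measurable_funD; [exact: measurable_coord|exact: measurable_cst].
Qed.

(** The two measures agree on open boxes, a generating family stable under intersection, and cubes
    of finite measure exhaust the space. *)
Lemma lebesgue_shift N (v : 'rV[R]_N) (A : set (borel R N)) : measurable A ->
  pushforward (mu N) ((fun x => x + v) : borel R N -> borel R N) A = mu N A.
Proof.
pose g k : set 'rV[R]_N := obox (fun=> - k%:R) (fun=> k%:R).
move=> mA; pose m1 := measure_function_pushforward__canonical__measure_function_Measure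
  (mu N) (measurable_shift v).
apply/esym; apply: (@measure_unique _ _ (borel R N) (@oboxes N) g (@borel_oboxes N)
   (@setI_oboxes N) _ _ (mu N) m1) => //.
- by move=> k; exists (fun=> - k%:R), (fun=> k%:R).
- apply/seteqP; split=> // x _; exists (Num.trunc `|x|).+1 => // i.
  rewrite in_itv /= -ltr_norml (le_lt_trans (coord_le_norm _ _)) //.
  by have := truncnS_gt `|x|.
- move=> _ [a [b ->]]; rewrite /m1 /= /pushforward.
  rewrite (_ : _ @^-1` _ = obox (fun i => a i - v ord0 i) (fun i => b i - v ord0 i)).
    by rewrite !lebesgue_oboxE; congr (_%:E); apply: eq_bigr => i _; congr (Num.max _ _); ring.
  apply/seteqP; split=> x /= h i; have := h i; rewrite !in_itv /= mxE ?ltrBDr ?ltrBlDr ?ltrBrDr;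
  by rewrite ?ltrBlDr ?ltrBrDr.
- by move=> k; exact: lebesgue_obox_lty.
Qed.

(** Translations, sums and products stay in this class and its members are integrable, so the
    discrete calculus can use real-valued integrals. Continuous functions cut off by an indicator
    belong to it as well. *)
Definition bdd_supp N (f : 'rV[R]_N -> R) :=
  measurable_fun setT (f : borel R N -> measurableTypeR R) /\
  exists M r : R, forall x, `|f x| <= M /\ (r < `|x| -> f x = 0).

Lemma bdd_supp_integrable N (f : 'rV[R]_N -> R) : bdd_supp f ->
  (mu N).-integrable setT (EFin \o f).
Proof.
move=> [mf [M [r h]]].
pose B : set (borel R N) := obox (fun=> - (`|r| + 1)) (fun=> `|r| + 1).
have mB : measurable B by exact: measurable_obox.
have fB : f \_ B = f.
  apply/funext => x; rewrite patchE; case: ifPn => // /negP xB.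
  apply/esym; apply: (proj2 (h x)); rewrite ltNge; apply/negP => xr; apply: xB.
  rewrite inE /B /obox /= => i; rewrite in_itv /= -ltr_norml.
  rewrite (le_lt_trans (coord_le_norm _ _)) // (le_lt_trans xr) //.
  by rewrite (le_lt_trans (ler_norm r)) // ltrDl.
rewrite -fB -restrict_EFin; apply/(integrable_mkcond _ mB).
apply: measurable_bounded_integrable => //.
- exact: lebesgue_obox_lty.
- exact: measurable_funTS.
- exists M; split; first exact: num_real.
  by move=> y My x _; apply: le_trans (ltW My); exact: (proj1 (h x)).
Qed.

Lemma bdd_supp_shift N (f : 'rV[R]_N -> R) v : bdd_supp f -> bdd_supp (fun x => f (x + v)).
Proof.
move=> [mf [M [r h]]]; split; first exact: (measurableT_comp mf (measurable_shift v)).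
exists M, (r + `|v|) => x; split; first exact: (proj1 (h _)).
move=> rx; apply: (proj2 (h _)).
rewrite -(ltrD2r `|v|) (lt_le_trans rx) // -[in leLHS](addrK v x).
by rewrite (le_trans (ler_normB _ _)).
Qed.

Lemma bdd_suppD N (f g : 'rV[R]_N -> R) : bdd_supp f -> bdd_supp g ->
  bdd_supp (fun x => f x + g x).
Proof.
move=> [mf [M [r h]]] [mg [M' [r' h']]]; split; first exact: measurable_funD.
exists (M + M'), (Num.max r r') => x; split.
  by rewrite (le_trans (ler_normD _ _)) // lerD ?(proj1 (h _)) ?(proj1 (h' _)).
by rewrite gt_max => /andP[h1 h2]; rewrite (proj2 (h _)) // (proj2 (h' _)) // addr0.
Qed.

Lemma bdd_suppM N (f g : 'rV[R]_N -> R) : bdd_supp f ->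
  measurable_fun setT (g : borel R N -> measurableTypeR R) ->
  (exists M, forall x, f x != 0 -> `|g x| <= M) -> bdd_supp (fun x => f x * g x).
Proof.
move=> [mf [M [r h]]] mg [M' h']; split; first exact: measurable_funM.
exists (M * `|M'|), r => x; split; last by move=> rx; rewrite (proj2 (h x)) ?mul0r.
have [hM hr] := h x; have M0 : 0 <= M by exact: le_trans hM.
have [->|f0] := eqVneq (f x) 0; first by rewrite mul0r normr0 mulr_ge0.
by rewrite normrM ler_pM // (le_trans (h' _ f0)) // ler_norm.
Qed.

Lemma bdd_suppZ N (f : 'rV[R]_N -> R) c : bdd_supp f -> bdd_supp (fun x => c * f x).
Proof.
move=> hf; rewrite (_ : (fun x => _) = (fun x => f x * c)); last first.
  by apply/funext => x; rewrite mulrC.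
by apply: bdd_suppM hf _ _; [exact: measurable_cst|exists `|c|].
Qed.

Lemma Rintegral_shift N (f : 'rV[R]_N -> R) v : bdd_supp f ->
  \int[mu N]_x f (x + v) = \int[mu N]_x f x.
Proof.
move=> hf; rewrite /Rintegral; congr fine.
have [mf _] := hf.
rewrite -[RHS](@eq_measure_integral _ _ _ setT _
   (measure_function_pushforward__canonical__measure_function_Measure
  (mu N) (measurable_shift v))); last first.
  by move=> A mA _; exact: lebesgue_shift.
rewrite integral_pushforward //.
- exact: measurable_shift.
- exact/measurable_EFinP.
- exact: (bdd_supp_integrable (bdd_supp_shift v hf)).
Qed.

Lemma lebesgue_bounded_fin N (A : set (borel R N)) r : measurable A ->
  (forall x : 'rV[R]_N, A x -> `|x| <= r) -> (mu N A < +oo)%E.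
Proof.
move=> mA Ar; pose B : set (borel R N) := obox (fun=> - (`|r| + 1)) (fun=> `|r| + 1).
apply: (@le_lt_trans _ _ (mu N B)); last by rewrite lebesgue_oboxE ltry.
apply: le_measure; rewrite ?inE //; first exact: measurable_obox.
move=> x /Ar xr i; rewrite in_itv /= -ltr_norml.
rewrite (le_lt_trans (coord_le_norm _ _)) // (le_lt_trans xr) //.
by rewrite (le_lt_trans (ler_norm r)) // ltrDl.
Qed.

Lemma lebesgue_ball_gt0 N (A : set (borel R N)) (x : 'rV[R]_N) e : measurable A -> 0 < e ->
  (forall y, `|y - x| < e -> A y) -> (0 < mu N A)%E.
Proof.
move=> mA e0 h; pose B : set (borel R N) := obox (fun i => x ord0 i - e) (fun i => x ord0 i + e).
apply: (@lt_le_trans _ _ (mu N B)).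
  rewrite lebesgue_oboxE lte_fin prodr_gt0 // => i _.
  by rewrite lt_max; apply/orP; right; lra.
apply: le_measure; rewrite ?inE //; first exact: measurable_obox.
move=> y hy; apply: h; apply/normrV_ltP => // i; have := hy i.
by rewrite in_itv /= !mxE ltr_distl.
Qed.

Lemma compact_rV_closed N (K : set 'rV[R]_N) : compact K -> closed K.
Proof. by move=> cK; apply: compact_closed => //; exact: norm_hausdorff. Qed.

Lemma closed_borel N (K : set 'rV[R]_N) : closed K -> measurable (K : set (borel R N)).
Proof. by move=> cK; rewrite -(setCK K); apply: measurableC; apply: open_borel; exact: closed_openC. Qed.

End lebesgue_rV_facts.
(** * Directional derivatives and bump functions *)

Section directional.
Context {R : realType} {V : normedModType R}.
Implicit Types (f g : V -> R) (x v w : V).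

Lemma is_derive_line f x v (s : R) : derivable f (x + s *: v) v ->
  is_derive s (1 : R) (fun t : R => f (x + t *: v)) ('D_v f (x + s *: v)).
Proof.
move=> df; have E : (fun h : R => h^-1 *: (((fun t : R => f (x + t *: v)) \o shift s) (h *: (1 : R))
      - f (x + s *: v))) =
    (fun h : R => h^-1 *: ((f \o shift (x + s *: v)) (h *: v) - f (x + s *: v))).
  apply/funext => h /=; congr (_ *: (f _ - _)).
  by rewrite [h *: 1]mulr1 scalerDl addrCA addrA.
by split; rewrite /derivable /derive E.
Qed.

Lemma MVT_zero (g g' : R -> R) (t : R) : (forall s : R, is_derive s (1 : R) g (g' s)) ->
  exists2 c : R, `|c| <= `|t| & g t - g 0 = t * g' c.
Proof.
move=> dg; have cg : continuous g.
  by move=> s; apply: differentiable_continuous; apply/derivable1_diffP; case: (dg s).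
have [t0|t0] := leP 0 t.
  have [c ct] := MVT_segment t0 (fun s _ => dg s) (continuous_subspaceT cg).
  rewrite subr0 => E; exists c; last by rewrite E mulrC.
  by move: ct; rewrite in_itv /= => /andP[c0 ct]; rewrite !ger0_norm.
have [c ct] := MVT_segment (ltW t0) (fun s _ => dg s) (continuous_subspaceT cg).
rewrite sub0r mulrN => E; exists c; last by rewrite -opprB E opprK mulrC.
by move: ct; rewrite in_itv /= => /andP[ct c0]; rewrite ler0_norm // ltr0_norm // lerN2.
Qed.

Lemma MVT_line f v : (forall y, derivable f y v) -> forall x (t : R),
  exists2 c : R, `|c| <= `|t| & f (x + t *: v) - f x = t * 'D_v f (x + c *: v).
Proof.
move=> df x t.
have [c ct E] := @MVT_zero (fun s => f (x + s *: v)) (fun s => 'D_v f (x + s *: v)) t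
  (fun s => is_derive_line (df _)).
by exists c => //; rewrite -E scale0r addr0.
Qed.

(** The mean value theorem is applied to the error [h] as a function of the step, then to the first
    and to the second derivative along the line. Terms of odd order cancel by symmetry. *)
Lemma second_difference f v (C : R) : (forall y, derivable f y v) ->
  (forall y, derivable ('D_v f) y v) -> (forall y, derivable ('D_v ('D_v f)) y v) ->
  (forall y, `|'D_v ('D_v ('D_v f)) y| <= C) -> forall x (t : R),
  `|f (x + t *: v) + f (x - t *: v) - 2 * f x - t ^+ 2 * 'D_v ('D_v f) x| <=
    2 * C * `|t| ^+ 3.
Proof.
move=> d1 d2 d3 bC x t; set f1 := 'D_v f in d2 d3 bC *; set f2 := 'D_v f1 in d3 bC *.
have bf2 c : `|f2 (x + c *: v) - f2 x| <= C * `|c|.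
  have [d _ ->] := MVT_line d3 x c; rewrite normrM mulrC ler_wpM2r //.
pose h (s : R) := f (x + s *: v) + f (x - s *: v) - 2 * f x - s ^+ 2 * f2 x.
pose h' (s : R) := f1 (x + s *: v) - f1 (x - s *: v) - 2 * s * f2 x.
have dh s : is_derive s (1 : R) h (h' s).
  have e1 : is_derive s (1 : R) (fun t : R => f (x + t *: v)) (f1 (x + s *: v)).
    exact: is_derive_line.
  have e2 : is_derive s (1 : R) (fun t : R => f (x - t *: v)) (f1 (x - s *: v) * -1).
    have H : is_derive (- s) (1 : R) (fun t : R => f (x + t *: v)) (f1 (x - s *: v)).
      by rewrite -scaleNr; exact: is_derive_line.
    have dN : is_derive s (1 : R) (fun t : R => - t) (-1) by exact: is_deriveN.
    have := @is_derive1_comp R _ (fun t : R => - t) s _ _ H dN.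
    rewrite (_ : _ \o _ = fun t : R => f (x - t *: v)) //.
    by apply/funext => r /=; rewrite scaleNr.
  have e3 : is_derive s (1 : R) (f2 x \*: (id ^+ 2 : R -> R)) (f2 x *: ((2%:R * s ^+ 1) *: 1)).
    exact: is_deriveZ.
  rewrite (_ : h = (fun t : R => f (x + t *: v)) + (fun t : R => f (x - t *: v))
     - cst (2 * f x) - (f2 x \*: (id ^+ 2 : R -> R))); last first.
    by apply/funext => r; rewrite /h /= ; congr (_ - _); rewrite mulrC.
  apply: is_derive_eq; rewrite /h' subr0 mulrN1 expr1 /GRing.scale /= mulr1.
  by congr (_ - _); rewrite mulrC.
have [c ct] := MVT_zero t dh; rewrite {2}/h expr0n /= mul0r subr0 scale0r subr0 addr0.
rewrite (_ : f x + f x - 2 * f x = 0); last by ring.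
rewrite subr0 -[_ - _ in leLHS]/(h t) => ->.
have mvt b : exists2 d : R, `|d| <= `|b| & f1 (x + b *: v) - f1 x = b * f2 (x + d *: v).
  exact: MVT_line.
have [c1 c1c E1] := mvt c; have [c2 c2c E2] := mvt (- c).
have -> : h' c = c * (f2 (x + c1 *: v) - f2 x + (f2 (x + c2 *: v) - f2 x)).
  rewrite /h' -scaleNr.
  rewrite (_ : f1 (x + c *: v) - f1 (x + - c *: v) =
     (f1 (x + c *: v) - f1 x) - (f1 (x + - c *: v) - f1 x)); last by ring.
  rewrite E1 E2; move: (f2 (x + c1 *: v)) (f2 (x + c2 *: v)) (f2 x) => y1 y2 y3.
  by ring.
rewrite !normrM; set t' := `|t|; have t'0 : 0 <= t' by exact: normr_ge0.
have C0 : 0 <= C by exact: le_trans (bC x).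
have h1 : `|f2 (x + c1 *: v) - f2 x + (f2 (x + c2 *: v) - f2 x)| <= 2 * C * t'.
  rewrite (le_trans (ler_normD _ _)) // (_ : 2 * C * t' = C * t' + C * t'); last by ring.
  rewrite lerD // (le_trans (bf2 _)) // ler_wpM2l // ?(le_trans c1c) //.
  by rewrite (le_trans c2c) // normrN.
have h2 : `|c| * `|f2 (x + c1 *: v) - f2 x + (f2 (x + c2 *: v) - f2 x)| <= t' * (2 * C * t').
  exact: ler_pM.
rewrite (le_trans (ler_wpM2l t'0 h2)) //.
by rewrite (_ : t' * (t' * (2 * C * t')) = 2 * C * t' ^+ 3) //; ring.
Qed.

(** Directional derivatives alone need not be linear in the direction. The increment is split at
    [x + h *: w]; the part along [v] starts at this moving point, and continuity of ['D_v f] brings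
    it back to [x]. *)
Lemma derive_combination f (a : R) v w x : (forall y, derivable f y v) ->
  {for x, continuous ('D_v f)} -> derivable f x w ->
  is_derive x (a *: v + w) f (a * 'D_v f x + 'D_w f x).
Proof.
move=> dv cv dw.
pose q (h : R) := h^-1 *: ((f \o shift x) (h *: (a *: v + w)) - f x).
pose q1 (h : R) := h^-1 *: ((f \o shift x) (h *: w) - f x).
pose q2 (h : R) := h^-1 *: (f (x + h *: w + (h * a) *: v) - f (x + h *: w)).
have qE : q = q2 + q1.
  apply/funext => h; rewrite /q /q1 /q2 /= -[RHS]scalerDr; congr (_ *: _).
  rewrite [h *: w + x]addrC addrA subrK; congr (f _ - _).
  by rewrite scalerDr scalerA addrC addrAC addrA.
have c1 : q1 h @[h --> 0^'] --> 'D_w f x by exact: dw.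
have c2 : q2 h @[h --> 0^'] --> a * 'D_v f x.
  apply/cvgrPdist_le => e e0.
  have a0 : 0 < `|a| + 1 by rewrite ltr_wpDl.
  have /cvgrPdist_le/(_ (e / (`|a| + 1)) (divr_gt0 e0 a0)) := cv.
  move=> /nbhs_ballP[d /= d0 hd]; pose M := `|w| + `|a| * `|v| + 1.
  have M0 : 0 < M by rewrite ltr_wpDl // addr_ge0 // mulr_ge0.
  near=> h; have h0 : h != 0 by near: h; exact: nbhs_dnbhs_neq.
  have hM : `|h| < d / M by near: h; apply: dnbhs0_lt; rewrite divr_gt0.
  rewrite /q2; have [c ch ->] := MVT_line dv (x + h *: w) (h * a).
  rewrite [X in _ - X]mulrA mulKf // -mulrBr normrM.
  rewrite (@le_trans _ _ (`|a| * (e / (`|a| + 1)))) //; last first.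
    by rewrite mulrCA ler_piMr ?(ltW e0) // ler_pdivrMr // mul1r lerDl.
  rewrite ler_wpM2l //; apply: hd; rewrite -ball_normE /= opprD addrA opprD addrA subrr.
  rewrite sub0r -opprD normrN (le_lt_trans (ler_normD _ _)) // !normrZ.
  rewrite ltr_pdivlMr // in hM; apply: le_lt_trans hM.
  rewrite normrM in ch; rewrite /M mulrDr mulr1 mulrDr ler_wpDr // lerD2l mulrA.
  by rewrite ler_wpM2r.
have cq : q h @[h --> 0^'] --> a * 'D_v f x + 'D_w f x by rewrite qE; exact: cvgD.
split; first by apply/cvg_ex; exists (a * 'D_v f x + 'D_w f x).
exact: cvg_lim cq.
Unshelve. all: by end_near. Qed.

Lemma derive_out f (K : set V) v : closed K -> (forall x, ~ K x -> f x = 0) ->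
  forall x, ~ K x -> 'D_v f x = 0.
Proof.
move=> cK f0 x Kx; rewrite -(derive_cst (0 : R) x v); apply: near_eq_derive.
have : nbhs x (~` K) by apply: open_nbhs_nbhs; split => //; exact: closed_openC.
by apply: filterS => y /f0.
Qed.

End directional.

Section bumpf.
Context {R : realType}.
Implicit Types (t s : R).

(** The family is closed under differentiation up to linear combinations: the derivative of [flat k]
    is [flat k.+2 - k flat k.+1], also at 0. *)
Definition flat (k : nat) t : R := if 0 < t then t ^- k * expR (- t^-1) else 0.

(** For positive [t], [expR t^-1] is at least the term of order [k.+1] of its series. The bound
    controls the behaviour of [flat] at 0. *)
Lemma flat_le k t : `|flat k t| <= k.+1`!%:R * `|t|.
Proof.
rewrite /flat; case: ifPn => [t0|_]; last by rewrite normr0 mulr_ge0.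
rewrite gtr0_norm ?mulr_gt0 ?invr_gt0 ?exprn_gt0 ?expR_gt0 // gtr0_norm //.
have f0 : 0 < (k.+1`!%:R : R) by rewrite ltr0n fact_gt0.
rewrite expRN -invfM -[leRHS]invrK lef_pV2 ?posrE ?mulr_gt0 ?invr_gt0 ?exprn_gt0 ?expR_gt0 //.
rewrite ?mulr_gt0 // invfM.
have h : t^-1 ^+ k.+1 / k.+1`!%:R <= expR t^-1.
  by apply: le_trans (expR_ge1Dxn k (_ : 0 <= t^-1)); rewrite ?lerDr ?ler01 // invr_ge0 ltW.
have -> : k.+1`!%:R^-1 / t = t ^+ k * (t^-1 ^+ k.+1 / k.+1`!%:R).
  by rewrite exprSr !mulrA -exprMn mulfV ?gt_eqF // expr1n mul1r mulrC.
  by rewrite ler_wpM2l // exprn_ge0 // ltW.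
exact: mulr_gt0.
Qed.

Lemma is_derive_flat k t : is_derive t (1 : R) (flat k) (flat k.+2 t - k%:R * flat k.+1 t).
Proof.
have [t0|t0|->] := ltgtP t 0.
- have E : \near t, cst 0 t = flat k t.
    near=> s; have s0 : s < 0 by near: s; exact: lt_nbhsl.
    by rewrite /flat ltNge (ltW s0).
  apply: (near_eq_is_derive E); apply: is_derive_eq.
  by rewrite /flat ltNge (ltW t0) /= mulr0 subr0.
- have E : \near t, ((fun s : R => s^-1) ^+ k * (expR \o (fun s : R => - s^-1))) t = flat k t.
    near=> s; have s0 : 0 < s by near: s; exact: lt_nbhsr.
    by rewrite /flat s0 mulrfctE exprfctE /= exprVn.
  apply: (near_eq_is_derive E).
  have tn0 : t != 0 by rewrite gt_eqF.
  have d1 : is_derive t (1 : R) (fun s : R => s^-1) (- t ^- 2 *: 1).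
    by apply: is_deriveV => //; exact: is_derive_id.
  have d2 : is_derive t (1 : R) (fun s : R => - s^-1) (- (- t ^- 2 *: 1)).
    exact: is_deriveN.
  have d3 := @is_derive1_comp R expR (fun s : R => - s^-1) t _ _ (is_derive_expR _) d2.
  have d4 := @is_deriveX R _ _ k t 1 _ d1.
  apply: is_derive_eq; rewrite /flat t0 /GRing.scale /= !mulr1 opprK.
  rewrite fctE /=; case: k {E d4} => [|k].
    by rewrite expr0 !mul0r mulr0 addr0 subr0 mul1r mulrC.
  rewrite /= -!exprVn !exprS; ring.
- rewrite /flat ltxx mulr0 subr0.
  (* At 0 the difference quotient of [flat k] is [flat k.+1], which tends to 0 by [flat_le]. *)
  pose q (h : R) := h^-1 *: ((flat k \o shift 0) (h *: (1 : R)) - flat k 0).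
  have qE h : h != 0 -> q h = flat k.+1 h.
    move=> h0; rewrite /q /= addr0 [h *: 1]mulr1 /flat ltxx subr0 /GRing.scale /=.
    by case: ifPn => // _; rewrite ?mulr0 // exprSr invfM mulrA [h^-1 * _]mulrC.
  have cq : q h @[h --> 0^'] --> 0.
    apply/cvgr0Pnorm_le => e e0.
    have f0 : 0 < (k.+2`!%:R : R) by rewrite ltr0n fact_gt0.
    near=> h; rewrite qE; last by near: h; exact: nbhs_dnbhs_neq.
    rewrite (le_trans (flat_le _ _)) // -ler_pdivlMl // mulrC.
    by near: h; apply: dnbhs0_le; rewrite divr_gt0.
  split; first by apply/cvg_ex; exists 0.
  exact: cvg_lim cq.
Unshelve. all: by end_near. Qed.

Lemma flat_gt0 k t : (0 < flat k t) = (0 < t).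
Proof.
rewrite /flat; case: ifPn => h; last by rewrite ltxx.
by rewrite mulr_gt0 ?invr_gt0 ?exprn_gt0 ?expR_gt0.
Qed.

Lemma flat_ge0 k t : 0 <= flat k t.
Proof.
rewrite /flat; case: ifPn => // h.
by rewrite mulr_ge0 ?invr_ge0 ?exprn_ge0 ?expR_ge0 // ltW.
Qed.

Lemma flat0_le t s : 0 < t -> t <= s -> flat 0 t <= flat 0 s.
Proof.
move=> t0 ts; have s0 := lt_le_trans t0 ts.
by rewrite /flat t0 s0 !expr0 invr1 !mul1r ler_expR lerN2 lef_pV2.
Qed.

Variable N : nat.
Local Notation V := 'rV[R]_N.

(* An algebra of functions stable under directional derivatives. *)
Inductive flat_alg : (V -> R) -> Prop :=
| flat_cst c : flat_alg (cst c)
| flat_gen k (c a : R) i : flat_alg (fun x => flat k (c + a * x ord0 i))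
| flat_add f g : flat_alg f -> flat_alg g -> flat_alg (f + g)
| flat_mul f g : flat_alg f -> flat_alg g -> flat_alg (f * g).

Lemma is_derive_flat_gen k (c a : R) i (x v : V) :
  is_derive x v (fun x : V => flat k (c + a * x ord0 i))
    (a * v ord0 i * (flat k.+2 (c + a * x ord0 i) - k%:R * flat k.+1 (c + a * x ord0 i))).
Proof.
set y := c + a * x ord0 i.
have d1 : is_derive (0 : R) (1 : R) (fun h : R => y + h * (a * v ord0 i)) (a * v ord0 i).
  rewrite (_ : (fun h => _) = cst y + (a * v ord0 i) \*: (id : R -> R)); last first.
    by apply/funext => h; rewrite !fctE /= mulrC.
  by apply: is_derive_eq; rewrite add0r /GRing.scale /= mulr1.
have d2 := is_derive_flat k y.
have d3 : is_derive (0 : R) (1 : R) (flat k \o (fun h : R => y + h * (a * v ord0 i)))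
    ((flat k.+2 y - k%:R * flat k.+1 y) * (a * v ord0 i)).
  by apply: is_derive1_comp; rewrite mul0r addr0.
have E : (fun h : R => h^-1 *: (((fun x : V => flat k (c + a * x ord0 i)) \o shift x) (h *: v)
      - flat k (c + a * x ord0 i))) =
    (fun h : R => h^-1 *: (((flat k \o (fun h : R => y + h * (a * v ord0 i))) \o shift 0) (h *: (1 : R))
      - (flat k \o (fun h : R => y + h * (a * v ord0 i))) 0)).
  apply/funext => h /=; congr (_ *: (flat _ _ - flat _ _)); last by rewrite mul0r addr0.
  by rewrite !mxE addr0 [h *: 1]mulr1 /y; ring.
case: d3 => d3 d3'; rewrite [a * _ * _]mulrC -d3'.
by split; rewrite /derivable /derive E.
Qed.

Lemma flat_alg_derive f : flat_alg f -> continuous f /\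
  (forall x v, derivable f x v) /\ forall v, flat_alg ('D_v f).
Proof.
elim=> [c|k c a i|{}f g hf [cf [df Df]] hg [cg [dg Dg]]|{}f g hf [cf [df Df]] hg [cg [dg Dg]]].
- split; first exact: cst_continuous.
  split=> [x v|v]; first exact: derivable_cst.
  rewrite (_ : 'D_v _ = cst 0); first exact: flat_cst.
  by apply/funext => x; rewrite derive_cst.
- split.
    have cc : continuous (fun t : R => c + a * t).
      by move=> t; apply: cvgD; [exact: cvg_cst|apply: cvgMr; exact: cvg_id].
    move=> x; apply: (@continuous_comp _ _ _ (fun x : V => x ord0 i) (fun t => flat k (c + a * t))).
      exact: coord_continuous.
    apply: (@continuous_comp _ _ _ (fun t => c + a * t) (flat k)); first exact: cc.
    apply: differentiable_continuous; apply/derivable1_diffP.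
    by case: (is_derive_flat k (c + a * x ord0 i)).
  split=> [x v|v]; first by case: (is_derive_flat_gen k c a i x v).
  rewrite (_ : 'D_v _ = cst (a * v ord0 i) * ((fun x : V => flat k.+2 (c + a * x ord0 i)) +
    cst (- k%:R) * (fun x : V => flat k.+1 (c + a * x ord0 i)))).
    apply: flat_mul; first exact: flat_cst.
    apply: flat_add; first exact: flat_gen.
    by apply: flat_mul; [exact: flat_cst|exact: flat_gen].
  apply/funext => x; have d := is_derive_flat_gen k c a i x v.
  by rewrite derive_val !fctE mulNr.
- split; first by move=> x; exact: (cvgD (cf x) (cg x)).
  split=> [x v|v]; first exact: derivableD.
  rewrite (_ : 'D_v _ = 'D_v f + 'D_v g); first by apply: flat_add.
  by apply/funext => x; rewrite deriveD.
- split; first by move=> x; exact: (cvgM (cf x) (cg x)).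
  split=> [x v|v]; first exact: derivableM.
  rewrite (_ : 'D_v _ = f * 'D_v g + g * 'D_v f).
    by apply: flat_add; apply: flat_mul.
  by apply/funext => x; rewrite deriveM.
Qed.

(** The norm of row vectors is the maximum norm, so a product of one-variable bumps is supported in
    a ball. *)
Definition bumpf (e : R) : V -> R :=
  \prod_(i < N) ((fun x : V => flat 0 (e + 1 * x ord0 i)) * (fun x : V => flat 0 (e + -1 * x ord0 i))).

Lemma bumpf_alg e : flat_alg (bumpf e).
Proof.
rewrite /bumpf; apply: big_ind => [|f g|i _].
- exact: flat_cst.
- exact: flat_mul.
- by apply: flat_mul; exact: flat_gen.
Qed.

Lemma bumpfE e x : bumpf e x = \prod_(i < N) (flat 0 (e + x ord0 i) * flat 0 (e - x ord0 i)).
Proof.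
rewrite /bumpf (@big_morph _ _ (fun f : V -> R => f x) 1 *%R) //.
by apply: eq_bigr => i _; rewrite fctE mul1r mulN1r.
Qed.

Lemma bumpf_ge0 e x : 0 <= bumpf e x.
Proof. by rewrite bumpfE prodr_ge0 // => i _; rewrite mulr_ge0 ?flat_ge0. Qed.

Lemma bumpf_out e x : 0 < e -> e <= `|x| -> bumpf e x = 0.
Proof.
move=> e0 ex; have [i xi] : exists i, e <= `|x ord0 i|.
  apply: contrapT => h; move: ex; rewrite leNgt => /negP; apply.
  apply/(normrV_ltP x e0) => i; rewrite ltNge; apply/negP => hi; apply: h.
  by exists i.
rewrite bumpfE (bigD1 i) //=; suff -> : flat 0 (e + x ord0 i) * flat 0 (e - x ord0 i) = 0.
  by rewrite mul0r.
have out t : t <= 0 -> flat 0 t = 0 by move=> t0; rewrite /flat ltNge t0.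
move: xi; rewrite ler_normr => /orP[h|h]; last by rewrite out ?mul0r //; lra.
by rewrite [X in _ * X]out ?mulr0 //; lra.
Qed.

End bumpf.

(** * Uniformity on compact sets and cut-offs *)

Section compact_support.
Context {R : realType} {N : nat}.
Local Notation V := 'rV[R]_N.
Local Notation mu := (@lebesgue_rV R N).
Implicit Types (f g u w : V -> R) (K U : set V).

(** For [Q] the property of lying in some member of an open cover this is Lebesgue's number
    lemma. *)
Lemma lebesgue_number K (Q : set V -> Prop) : compact K ->
  (forall A B, A `<=` B -> Q B -> Q A) ->
  (forall x, K x -> exists2 d : R, 0 < d & Q (ball x d)) ->
  exists2 d : R, 0 < d & forall x, K x -> Q (ball x d).
Proof.
move=> /compact_near_coveringP cK mQ hQ.
have : \forall d \near (0 : R)^'+, K `<=` [set x | Q (ball x d)].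
  apply: cK => x Kx; have [d d0 Qd] := hQ x Kx.
  have d20 : 0 < d / 2 by rewrite divr_gt0.
  exists (ball x (d / 2), [set e : R | e < d / 2]) => /=.
    by split; [exact: nbhsx_ballx|exact: nbhs_right_lt].
  move=> [y e] [/= xy ed]; apply: mQ Qd => z yz.
  have := ball_triangle xy (le_ball (ltW ed) yz).
  by rewrite -splitr.
move=> h; have : \forall d \near (0 : R)^'+, 0 < d /\ (K `<=` [set x | Q (ball x d)]).
  by apply: filterS2 (nbhs_right_gt 0) h => d d0 hd.
by move=> /filter_ex[d [d0 hd]]; exists d.
Qed.

Lemma continuous_compact_bounded K f : compact K -> {in K, forall x, {for x, continuous f}} ->
  exists M, forall x, K x -> `|f x| <= M.
Proof.
move=> cK cf; have cf' : {within K, continuous f}.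
  by apply: continuous_in_subspaceT => x; exact: cf.
have /compact_bounded[M [_ hM]] := continuous_compact cf' cK.
exists (M + 1) => x Kx; apply: (hM (M + 1)); first by rewrite ltrDl.
by exists x.
Qed.

Lemma compact_support_bdd K f : compact K -> continuous f ->
  (forall x, ~ K x -> f x = 0) -> bdd_supp f.
Proof.
move=> cK cf f0; split; first exact: measurable_continuous.
have [M hM] := @continuous_compact_bounded K f cK (fun x _ => cf x).
have /compact_bounded[r [_ hr]] := cK.
exists `|M|, (r + 1) => x; split.
  have [Kx|Kx] := pselect (K x); first by rewrite (le_trans (hM x Kx)) // ler_norm.
  by rewrite f0 // normr0.
move=> rx; apply: f0 => Kx; move: rx; rewrite ltNge; apply/negP; rewrite negbK.
by apply: (hr (r + 1)) => //; rewrite ltrDl.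
Qed.

Lemma cutoff K U u : compact K -> open U -> K `<=` U ->
  (forall x, U x -> {for x, continuous u}) ->
  exists (v : V -> R) (r : R), [/\ bdd_supp v, 0 < r,
    forall x, K x -> ball x r `<=` U, forall x y, K x -> ball x r y -> v y = u y &
    forall e : R, 0 < e -> exists2 d : R, 0 < d & forall x y, K x -> ball x d y -> `|v y - v x| <= e].
Proof.
move=> cK oU KU cu.
have osc (e : R) : 0 < e -> exists2 d : R, 0 < d & forall x, K x ->
    ball x d `<=` U /\ forall y z, ball x d y -> ball x d z -> `|u y - u z| <= e.
  move=> e0; apply: (@lebesgue_number K (fun B => B `<=` U /\ forall y z, B y -> B z -> `|u y - u z| <= e)) => //.
    move=> A B AB [BU hB]; split; first exact: subset_trans BU.
    by move=> y z /AB By /AB Bz; exact: hB.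
  move=> x Kx; have e20 : 0 < e / 2 by rewrite divr_gt0.
  have /cvgrPdist_le/(_ _ e20) h1 := cu x (KU x Kx).
  have h2 : nbhs x U by apply: open_nbhs_nbhs; split => //; exact: KU.
  have /nbhs_ballP[d /= d0 hd] : nbhs x [set y | U y /\ `|u x - u y| <= e / 2].
    by apply: filterS2 h2 h1 => y.
  exists d => //; split=> [y /hd[]//|y z /hd[_ hy] /hd[_ hz]].
  rewrite (splitr e) (_ : u y - u z = (u x - u z) - (u x - u y)); last by ring.
  by rewrite (le_trans (ler_normB _ _)) // lerD.
(* Oscillation at most 1 on each [ball x r] turns the bound of [u] on [K] into a bound on the union
   [B] of these balls. *)
have [r r0 hr] := osc 1 ltr01.
pose B := \bigcup_(x in K) ball x r.
have oB : open B by apply: bigcup_open => x _; exact: ball_open.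
have BU : B `<=` U by move=> y [x Kx xy]; exact: (proj1 (hr x Kx)).
have mB : measurable (B : set (borel R N)) by exact: open_borel.
have [M hM] := @continuous_compact_bounded K u cK (fun x Kx => cu x (KU x (set_mem Kx))).
have /compact_bounded[s [_ hs]] := cK.
have vE x y : K x -> ball x r y -> (u \_ B) y = u y.
  by move=> Kx xy; rewrite patchE mem_set //; exists x.
exists (u \_ B), r; split => //.
- split.
    apply/(measurable_restrictT _ mB).
    apply: (measurability _ (RGenOpens.measurableE R)) => _ [_ [a [b ->]] <-].
    apply: open_borel; rewrite openE => y [By yab].
    have h1 : nbhs y B by apply: open_nbhs_nbhs.
    have h2 : nbhs y (u @^-1` `]a, b[).
      by apply: (cu y (BU y By)); apply: open_nbhs_nbhs; split => //; exact: interval_open.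
    by apply: filterS2 h1 h2 => z.
  exists (`|M| + 1), (s + 1 + r) => y; rewrite patchE; case: ifPn => [|_]; last first.
    by split=> //; rewrite normr0 addr_ge0.
  rewrite inE => -[x Kx xy]; split.
    have [_ h] := hr x Kx; have := h y x xy (ballxx x r0).
    have := hM x Kx => h1 h2; rewrite -[u y](subrK (u x)) addrC (le_trans (ler_normD _ _)) //.
    by rewrite lerD // (le_trans h1) // ler_norm.
  move=> sy; exfalso; move: sy; rewrite ltNge; apply/negP; rewrite negbK.
  have : `|x| <= s + 1 by apply: hs => //; rewrite ltrDl.
  move: xy; rewrite -ball_normE /= => xy xs.
  rewrite -[y](subrK x) addrC (le_trans (ler_normD _ _)) // lerD //.
  by rewrite distrC ltW.
- by move=> x Kx; case: (hr x Kx).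
- move=> e e0; have [d d0 hd] := osc e e0; exists (Num.min d r); first by rewrite lt_min d0.
  move=> x y Kx xy; have b1 : ball x r y by apply: le_ball xy; rewrite ge_min lexx orbT.
  have b2 : ball x r x by exact: ballxx.
  rewrite (vE x y) // (vE x x) //; apply: (proj2 (hd x Kx)); last exact: ballxx.
  by apply: le_ball xy; rewrite ge_min lexx.
Qed.

End compact_support.

(** * Sums of second directional derivatives and their discretization *)

Section second_order_operator.
Context {R : realType} {N : nat}.
Local Notation V := 'rV[R]_N.
Local Notation mu := (@lebesgue_rV R N).
Implicit Types (f g u w phi rho : V -> R) (K U : set V) (vs : seq V).

Definition sop vs f (x : V) : R := \sum_(v <- vs) 'D_v ('D_v f) x.
Definition sdiff vs (t : R) f (x : V) : R :=
  \sum_(v <- vs) (f (x + t *: v) + f (x - t *: v) - 2 * f x).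

(* Smoothness as in [smooth], but for an arbitrary dimension. *)
Definition Csmooth f := forall vs : seq V,
  let psi := foldr (fun v f => 'D_v f) f vs in
  continuous psi /\ forall z v, derivable psi z v.

Lemma Csmooth_D f v : Csmooth f -> Csmooth ('D_v f).
Proof. by move=> sf vs; have := sf (rcons vs v); rewrite foldr_rcons. Qed.

Lemma Csmooth_continuous f : Csmooth f -> continuous f.
Proof. by move=> sf; case: (sf [::]). Qed.

Lemma Csmooth_derivable f z v : Csmooth f -> derivable f z v.
Proof. by move=> sf; case: (sf [::]) => _; apply. Qed.

Lemma flat_alg_Csmooth f : flat_alg f -> Csmooth f.
Proof.
move=> hf vs; have : flat_alg (foldr (fun v f => 'D_v f) f vs).
  by elim: vs => //= v vs IH; have [_ [_ ]] := flat_alg_derive IH; apply.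
by move/flat_alg_derive => [cf [df _]].
Qed.

Lemma derive_shift f a v : 'D_v (fun x => f (x + a)) = fun x => 'D_v f (x + a).
Proof.
apply/funext => x; rewrite /derive.
suff -> : (fun h : R => h^-1 *: (((fun x => f (x + a)) \o shift x) (h *: v) - f (x + a))) =
   (fun h : R => h^-1 *: ((f \o shift (x + a)) (h *: v) - f (x + a))) by [].
by apply/funext => h /=; rewrite addrA.
Qed.

Lemma Csmooth_shift f a : Csmooth f -> Csmooth (fun x => f (x + a)).
Proof.
move=> sf vs.
have E : foldr (fun v f => 'D_v f) (fun x => f (x + a)) vs =
    fun x => (foldr (fun v f => 'D_v f) f vs) (x + a).
  by elim: vs => //= v vs ->; exact: derive_shift.
rewrite E; have [cg dg] := sf vs; split.
  have cs : continuous (fun x : V => x + a).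
    by move=> y; exact: (cvgD cvg_id (cvg_cst a)).
  by move=> x; exact: (continuous_comp (cs x) (cg (x + a))).
move=> z v; have := dg (z + a) v; rewrite /derivable; set g := foldr _ _ _.
suff -> : (fun h : R => h^-1 *: (((fun x => g (x + a)) \o shift z) (h *: v) - g (z + a))) =
   (fun h : R => h^-1 *: ((g \o shift (z + a)) (h *: v) - g (z + a))) by [].
by apply/funext => h /=; rewrite addrA.
Qed.

Lemma sop_shift vs f a x : sop vs (fun x => f (x + a)) x = sop vs f (x + a).
Proof.
rewrite /sop; apply: eq_bigr => v _; rewrite (derive_shift f a v).
exact: (congr1 (fun g : V -> R => g x) (derive_shift ('D_v f) a v)).
Qed.

Lemma sop_continuous vs f : Csmooth f -> continuous (sop vs f).
Proof.
move=> sf; elim: vs => [|v vs IH].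
  rewrite (_ : sop _ _ = cst 0); first exact: cst_continuous.
  by apply/funext => x; rewrite /sop big_nil.
rewrite (_ : sop _ _ = 'D_v ('D_v f) \+ sop vs f); last first.
  by apply/funext => x; rewrite /sop big_cons.
have c1 := Csmooth_continuous (Csmooth_D v (Csmooth_D v sf)).
by move=> x; exact: (cvgD (c1 x) (IH x)).
Qed.

Lemma derive_coords f v x : Csmooth f ->
  'D_v f x = \sum_k v ord0 k * 'D_(delta_mx ord0 k) f x.
Proof.
move=> sf.
have H (r : seq 'I_N) : is_derive x (\sum_(k <- r) v ord0 k *: delta_mx ord0 k : V) f
    (\sum_(k <- r) v ord0 k * 'D_(delta_mx ord0 k) f x).
  elim: r => [|k r IH]; first by rewrite !big_nil; exact: is_derive0.
  rewrite !big_cons; have [d <-] := IH.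
  exact: (derive_combination (v ord0 k) (fun y => @Csmooth_derivable f y (delta_mx ord0 k) sf)
    (@Csmooth_continuous _ (Csmooth_D (delta_mx ord0 k) sf) x) d).
by have [_ <-] := H (index_enum _); rewrite -row_sum_delta.
Qed.

Lemma Csmooth_lipschitz f K : Csmooth f -> compact K -> (forall x, ~ K x -> f x = 0) ->
  exists2 L, 0 <= L & forall x v, `|f (x + v) - f x| <= L * `|v|.
Proof.
move=> sf cK f0; have clK := compact_rV_closed cK.
have M k : exists M : R, forall y, `|'D_(delta_mx ord0 k : V) f y| <= M.
  have [_ [M [r hM]]] := compact_support_bdd cK (Csmooth_continuous (Csmooth_D (delta_mx ord0 k) sf))
     (fun x => @derive_out _ _ f K (delta_mx ord0 k) clK f0 x).
  by exists M => y; case: (hM y).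
pose m k := projT1 (cid (M k)); have hm k y : `|'D_(delta_mx ord0 k : V) f y| <= m k := projT2 (cid (M k)) y.
have m0 k : 0 <= m k by exact: le_trans (hm k 0).
exists (\sum_k m k) => [|x v]; first exact: sumr_ge0.
have [c _] := MVT_line (fun y => @Csmooth_derivable f y v sf) x 1; rewrite scale1r mul1r => ->.
rewrite derive_coords // (le_trans (ler_norm_sum _ _ _)) // mulr_suml.
by apply: ler_sum => k _; rewrite normrM mulrC ler_pM // coord_le_norm.
Qed.

Lemma sop_out vs f K : closed K -> (forall x, ~ K x -> f x = 0) ->
  forall x, ~ K x -> sop vs f x = 0.
Proof.
move=> cK f0 x Kx; rewrite /sop big1 // => v _.
by apply: (@derive_out _ _ ('D_v f) K v cK) => // y; exact: derive_out.
Qed.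

Lemma sop_sdiff vs f K : Csmooth f -> compact K -> (forall x, ~ K x -> f x = 0) ->
  exists2 C, 0 <= C & forall x (t : R), `|sdiff vs t f x - t ^+ 2 * sop vs f x| <= C * `|t| ^+ 3.
Proof.
move=> sf cK f0; have clK := compact_rV_closed cK.
elim: vs => [|v vs [C C0 IH]].
  by exists 0 => // x t; rewrite /sdiff /sop !big_nil mulr0 subr0 normr0 mul0r.
have s1 := Csmooth_D v sf; have s2 := Csmooth_D v s1; have s3 := Csmooth_D v s2.
have z3 x : ~ K x -> 'D_v ('D_v ('D_v f)) x = 0.
  apply: (@derive_out _ _ ('D_v ('D_v f)) K v clK) => y.
  by apply: (@derive_out _ _ ('D_v f) K v clK) => z; exact: derive_out.
have [_ [M [r hM]]] := compact_support_bdd cK (Csmooth_continuous s3) z3.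
have bM y : `|'D_v ('D_v ('D_v f)) y| <= M by case: (hM y).
have M0 : 0 <= M by exact: le_trans (bM 0).
exists (2 * M + C) => [|x t]; first by rewrite addr_ge0 // mulr_ge0.
rewrite /sdiff /sop !big_cons mulrDr opprD addrACA (le_trans (ler_normD _ _)) //.
rewrite [leRHS]mulrDl lerD //; last exact: IH.
exact: (second_difference (fun y => @Csmooth_derivable _ y v sf)
  (fun y => @Csmooth_derivable _ y v s1) (fun y => @Csmooth_derivable _ y v s2) bM x t).
Qed.

End second_order_operator.
(** * Maxima of distributional subsolutions *)

Lemma lipschitz_cts {R : realType} {W : normedModType R} (f : W -> R) (L : R) :
  (forall x y, `|f x - f y| <= L * `|x - y|) -> continuous f.
Proof.
move=> lip x; apply/cvgrPdist_le => d d0.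
have LA : 0 < `|L| + 1 by rewrite ltr_wpDl.
apply/nbhs_ballP; exists (d / (`|L| + 1)) => /=; first by rewrite divr_gt0.
move=> y; rewrite -ball_normE /= => xy; apply: (le_trans (lip x y)).
rewrite ltr_pdivlMr // in xy; rewrite (le_trans _ (ltW xy)) // mulrC ler_wpM2l //.
by rewrite (le_trans (ler_norm _)) // lerDl.
Qed.

Section max_principle.
Context {R : realType} {N : nat}.
Local Notation V := 'rV[R]_N.
Local Notation mu := (@lebesgue_rV R N).
Implicit Types (f g u w phi rho : V -> R) (K U : set V) (vs : seq V).

Lemma le_Rint f g : bdd_supp f -> bdd_supp g -> (forall x, f x <= g x) ->
  \int[mu]_x f x <= \int[mu]_x g x.
Proof. by move=> bf bg fg; apply: le_Rintegral => //; exact: bdd_supp_integrable. Qed.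

Lemma RintD f g : bdd_supp f -> bdd_supp g ->
  \int[mu]_x (f x + g x) = \int[mu]_x f x + \int[mu]_x g x.
Proof. by move=> bf bg; apply: RintegralD => //; exact: bdd_supp_integrable. Qed.

Lemma RintZ f c : bdd_supp f -> \int[mu]_x (c * f x) = c * \int[mu]_x f x.
Proof. by move=> bf; apply: RintegralZl => //; exact: bdd_supp_integrable. Qed.

Lemma RintB f g : bdd_supp f -> bdd_supp g ->
  \int[mu]_x (f x - g x) = \int[mu]_x f x - \int[mu]_x g x.
Proof. by move=> bf bg; apply: RintegralB => //; exact: bdd_supp_integrable. Qed.

Lemma bdd_supp_norm f : bdd_supp f -> bdd_supp (fun x => `|f x|).
Proof.
move=> [mf [M [r h]]]; split; first exact: measurableT_comp.
by exists M, r => x; rewrite normr_id; have [h1 h2] := h x; split=> // /h2 ->; rewrite normr0.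
Qed.

Lemma bdd_supp0 : bdd_supp (cst 0 : V -> R).
Proof. by split; [exact: measurable_cst|exists 0, 0 => x; rewrite normr0]. Qed.

Lemma bdd_suppB f g : bdd_supp f -> bdd_supp g -> bdd_supp (fun x => f x - g x).
Proof.
move=> bf bg; have := bdd_suppD bf (bdd_suppZ (-1) bg).
by under eq_fun do rewrite mulN1r.
Qed.

Lemma bdd_supp_max f g : bdd_supp f -> bdd_supp g -> bdd_supp (fun x => Num.max (f x) (g x)).
Proof.
move=> [mf [M [r h]]] [mg [M' [r' h']]]; split; first exact: measurable_maxr.
exists (Num.max M M'), (Num.max r r') => x; have [h1 h2] := h x; have [h1' h2'] := h' x.
split; last by rewrite gt_max => /andP[/h2 -> /h2' ->]; rewrite maxxx.
by have [fg|fg] := leP (f x) (g x); rewrite le_max ?h1 ?h1' ?orbT.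
Qed.

Lemma bdd_suppMl f g : bdd_supp f -> bdd_supp g -> bdd_supp (fun x => f x * g x).
Proof.
move=> bf [mg [M [r h]]]; apply: bdd_suppM => //.
by exists M => x _; case: (h x).
Qed.

Lemma bdd_supp_sdiff vs t f : bdd_supp f -> bdd_supp (sdiff vs t f).
Proof.
move=> bf; elim: vs => [|v vs IH].
  rewrite (_ : sdiff _ _ _ = cst 0); first exact: bdd_supp0.
  by apply/funext => x; rewrite /sdiff big_nil.
rewrite (_ : sdiff _ _ _ = fun x => (f (x + t *: v) + f (x + - (t *: v)) - 2 * f x) + sdiff vs t f x).
  apply: bdd_suppD => //; apply: bdd_suppB; last exact: bdd_suppZ.
  by apply: bdd_suppD; exact: bdd_supp_shift.
by apply/funext => x; rewrite /sdiff big_cons.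
Qed.

(** The discrete operator is self-adjoint because the measure is translation invariant. This takes
    the place of integration by parts, for functions that need not be differentiable. *)
Lemma Rint_sdiff vs t f w : bdd_supp f -> bdd_supp w ->
  \int[mu]_x (w x * sdiff vs t f x) = \int[mu]_x (f x * sdiff vs t w x).
Proof.
move=> bf bw; elim: vs => [|v vs IH].
  by congr (Rintegral _ _ _); apply/funext => x; rewrite /sdiff !big_nil !mulr0.
have E (g h : V -> R) : (fun x => g x * sdiff (v :: vs) t h x) =
    fun x => ((g x * h (x + t *: v) + g x * h (x - t *: v)) - 2 * (g x * h x)) + g x * sdiff vs t h x.
  by apply/funext => x; rewrite /sdiff big_cons; ring.
have b2 (g h : V -> R) a : bdd_supp g -> bdd_supp h -> bdd_supp (fun x => g x * h (x + a)).
  by move=> bg bh; apply: bdd_suppMl => //; exact: bdd_supp_shift.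
have I3 (g h : V -> R) : bdd_supp g -> bdd_supp h ->
    \int[mu]_x (g x * sdiff (v :: vs) t h x) =
    \int[mu]_x (g x * h (x + t *: v)) + \int[mu]_x (g x * h (x - t *: v)) -
    2 * \int[mu]_x (g x * h x) + \int[mu]_x (g x * sdiff vs t h x).
  move=> bg bh; rewrite E RintD.
  - rewrite RintB ?RintD ?RintZ //; try exact: b2; try exact: bdd_suppMl.
      by apply: bdd_suppD; exact: b2.
    by apply: bdd_suppZ; exact: bdd_suppMl.
  - apply: bdd_suppB; first by apply: bdd_suppD; exact: b2.
    by apply: bdd_suppZ; exact: bdd_suppMl.
  - by apply: bdd_suppMl => //; exact: bdd_supp_sdiff.
have sh (g h : V -> R) a : bdd_supp g -> bdd_supp h ->
    \int[mu]_x (g x * h (x + a)) = \int[mu]_x (h x * g (x - a)).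
  move=> bg bh; rewrite -(Rintegral_shift (- a) (b2 g h a bg bh)).
  by congr (Rintegral _ _ _); apply/funext => x; rewrite subrK mulrC.
rewrite !I3 // IH (sh w f) // (sh w f) // opprK.
rewrite [X in _ = X - _ + _]addrC; congr (_ - 2 * _ + _).
by congr (Rintegral _ _ _); apply/funext => x; rewrite mulrC.
Qed.

Lemma lin_ge0 (a b t0 : R) : 0 < t0 -> (forall t, 0 < t -> t <= t0 -> - (b * t) <= a) -> 0 <= a.
Proof.
move=> t00 h; rewrite leNgt; apply/negP => a0.
apply: (@le_small_false R (- a) (b * t0)); first by rewrite oppr_gt0.
move=> e e0 e1; rewrite lerNl -mulrA; apply: h; first by rewrite mulr_gt0.
by rewrite ler_piMr // ltW.
Qed.

Lemma bdd_supp_sop vs psi K : compact K -> Csmooth psi -> (forall x, ~ K x -> psi x = 0) ->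
  bdd_supp (sop vs psi).
Proof.
move=> cK sf psi0; apply: (compact_support_bdd cK) => [|x]; first exact: sop_continuous.
by apply: sop_out => //; exact: compact_rV_closed.
Qed.

(** The second differences are moved from [phi] to [w], where the hypothesis bounds them; after
    division by [t ^+ 2] the errors are of order [t]. *)
Lemma sop_ge0 vs K phi w (C t0 : R) : compact K -> Csmooth phi ->
  (forall x, ~ K x -> phi x = 0) -> (forall x, 0 <= phi x) -> bdd_supp w -> 0 < t0 ->
  (forall x t, K x -> 0 < t -> t <= t0 -> - (C * t ^+ 3) <= sdiff vs t w x) ->
  0 <= \int[mu]_x (w x * sop vs phi x).
Proof.
move=> cK sphi phi0 phige bw t00 hw.
have bphi : bdd_supp phi by apply: compact_support_bdd cK _ phi0; exact: Csmooth_continuous.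
have bsop : bdd_supp (sop vs phi) by exact: bdd_supp_sop cK _ _.
have [D D0 hD] := sop_sdiff vs sphi cK phi0.
pose A := \int[mu]_x `|w x|; pose P := \int[mu]_x phi x.
apply: (@lin_ge0 _ (C * P + D * A) t0) => // t tgt0 tt0.
have t2 : 0 < t ^+ 2 by rewrite exprn_gt0.
rewrite -(ler_pM2l t2) -[leRHS]RintZ; last exact: bdd_suppMl.
have bd : bdd_supp (sdiff vs t phi) by exact: bdd_supp_sdiff.
have h1 : \int[mu]_x (w x * sdiff vs t phi x) - D * t ^+ 3 * A <=
    \int[mu]_x (t ^+ 2 * (w x * sop vs phi x)).
  have bA : bdd_supp (fun x => D * t ^+ 3 * `|w x|) by apply: bdd_suppZ; exact: bdd_supp_norm.
  rewrite -RintZ; last exact: bdd_supp_norm.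
  rewrite -RintB //; last exact: bdd_suppMl.
  apply: le_Rint => [||x].
  - by apply: bdd_suppB => //; exact: bdd_suppMl.
  - by apply: bdd_suppZ; exact: bdd_suppMl.
  rewrite lerBlDr -lerBlDl (le_trans (ler_norm _)) //.
  rewrite (_ : _ - _ = w x * (sdiff vs t phi x - t ^+ 2 * sop vs phi x)); last by ring.
  by rewrite normrM mulrC ler_wpM2r // (le_trans (hD _ _)) // gtr0_norm.
apply: le_trans h1; rewrite Rint_sdiff //.
have h2 : - (C * t ^+ 3) * P <= \int[mu]_x (phi x * sdiff vs t w x).
  rewrite -RintZ //; apply: le_Rint => [||x].
  - exact: bdd_suppZ.
  - by apply: bdd_suppMl => //; exact: bdd_supp_sdiff.
  have [Kx|Kx] := pselect (K x); last by rewrite phi0 // mulr0 mul0r.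
  by rewrite mulrC ler_wpM2l // hw.
have -> : t ^+ 2 * - ((C * P + D * A) * t) = - (C * t ^+ 3) * P - D * t ^+ 3 * A by ring.
by rewrite lerD2r.
Qed.

(** At [x] the maximum equals the larger function, and at [x + t *: v] and [x - t *: v] it is at
    least that function. *)
Lemma sdiff_max vs t f g x (m : R) : m <= sdiff vs t f x -> m <= sdiff vs t g x ->
  m <= sdiff vs t (fun x => Num.max (f x) (g x)) x.
Proof.
have H (a b : V -> R) : b x <= a x -> sdiff vs t a x <= sdiff vs t (fun x => Num.max (a x) (b x)) x.
  move=> ba; rewrite /sdiff; apply: ler_sum => v _; rewrite (max_l ba) lerD2r.
  by apply: lerD; rewrite le_max lexx.
move=> hf hg; have [gf|/ltW fg] := leP (g x) (f x); first exact: le_trans (H f g gf).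
apply: le_trans hg _; rewrite (_ : (fun x => Num.max (f x) (g x)) = fun x => Num.max (g x) (f x)).
  exact: H.
by apply/funext => y; rewrite maxC.
Qed.

Lemma compact_norm_ball (a : V) (e : R) : compact [set x | `|x - a| <= e].
Proof.
apply: bounded_closed_compact.
  exists (`|a| + e); split; first exact: num_real.
  move=> M hM x /= xe; apply: le_trans (ltW hM).
  by rewrite -[x](subrK a) addrC (le_trans (ler_normD _ _)) // lerD2l.
rewrite (_ : [set x | _] = (fun x => `|x - a|) @^-1` [set y | y <= e]) //.
apply: closed_comp; last exact: closed_le.
move=> x _; apply: (@continuous_comp _ _ _ (fun x : V => x - a) (fun y => `|y|)).
  exact: (cvgD cvg_id (cvg_cst (- a))).
exact: norm_continuous.
Qed.

Lemma norm_ball_supp (x : V) (e : R) (psi : V -> R) : (forall y, e <= `|y - x| -> psi y = 0) ->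
  [/\ compact [set y | `|y - x| <= e], closed [set y | `|y - x| <= e] &
      forall y, ~ [set y | `|y - x| <= e] y -> psi y = 0].
Proof.
move=> pe; have cK := @compact_norm_ball x e; split => // [|y]; first exact: compact_rV_closed.
by move=> /negP; rewrite -ltNge => /ltW; exact: pe.
Qed.

Definition mollifier (e : R) rho := [/\ Csmooth rho, forall x, 0 <= rho x,
  forall x, e <= `|x| -> rho x = 0 & \int[mu]_x rho x = 1].

Lemma mollifier_ball e rho : mollifier e rho ->
  compact [set y : V | `|y - 0| <= e] /\ forall y, ~ [set y | `|y - 0| <= e] y -> rho y = 0.
Proof.
move=> [_ _ re _]; have [|cK _ r0] := @norm_ball_supp 0 e rho; last by [].
by move=> y; rewrite subr0; exact: re.
Qed.

Lemma mollifier_supp e rho : mollifier e rho -> bdd_supp rho.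
Proof.
move=> mr; have [cK r0] := mollifier_ball mr; have [sr _ _ _] := mr.
exact: compact_support_bdd cK (Csmooth_continuous sr) r0.
Qed.

Lemma mollifier_exists (e : R) : 0 < e -> exists rho, mollifier e rho.
Proof.
move=> e0; pose b := @bumpf R N e.
have bb : bdd_supp b.
  have [|cK _ b0] := @norm_ball_supp 0 e b; first by move=> y; rewrite subr0; exact: bumpf_out.
  exact: compact_support_bdd cK (Csmooth_continuous (flat_alg_Csmooth (bumpf_alg N e))) b0.
pose c := \int[mu]_x b x.
have c0 : 0 < c.
  (* On the cube of half the size the bump is bounded below by a positive constant, which makes its
     integral positive. *)
  pose A : set (borel R N) := obox (fun=> - (e / 2)) (fun=> e / 2).
  have mA : measurable A by exact: measurable_obox.
  have e2 : 0 < e / 2 by rewrite divr_gt0.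
  have [m m0 hm] : exists2 m : R, 0 < m & forall x, A x -> m <= b x.
    exists ((flat 0 (e / 2) * flat 0 (e / 2)) ^+ N) => [|x Ax].
      by rewrite exprn_gt0 // mulr_gt0 // flat_gt0.
    rewrite /b bumpfE -[N in X in X <= _]card_ord -prodr_const; apply: ler_prod => i _.
    have := Ax i; rewrite in_itv /= => /andP[h1 h2].
    rewrite mulr_ge0 ?flat_ge0 //= ler_pM ?flat_ge0 //; apply: flat0_le => //; lra.
  have bA : bdd_supp (\1_A : V -> R).
    split; first exact: measurable_indic.
    exists 1, e => x; rewrite indicE; case: (boolP (x \in A)) => xA; last by rewrite normr0.
    rewrite normr1; split => // ex; exfalso; move: ex; apply/negP; rewrite -leNgt.
    apply/(normrV_leP _ (ltW e0)) => i; have Ax := set_mem xA.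
    by have := Ax i; rewrite in_itv /= -ltr_norml => h; rewrite (le_trans (ltW h)) // ler_pdivrMr // ler_peMr ?(ltW e0) // ler1n.
  apply: (@lt_le_trans _ _ (m * fine (mu A))).
    rewrite mulr_gt0 // lebesgue_oboxE /= prodr_gt0 // => i _.
    by rewrite lt_max; apply/orP; right; lra.
  have <- : \int[mu]_x \1_A x = fine (mu A) by rewrite /Rintegral integral_indic // setIT.
  rewrite -RintZ //; apply: le_Rint => [||x] //; first exact: bdd_suppZ.
  rewrite indicE; case: (boolP (x \in A)) => xA; last by rewrite mulr0 bumpf_ge0.
  by rewrite mulr1 hm //; move: xA; rewrite inE.
exists (cst c^-1 * b); split.
- by apply: flat_alg_Csmooth; apply: flat_mul; [exact: flat_cst|exact: bumpf_alg].
- by move=> x; rewrite mulrfctE mulr_ge0 ?invr_ge0 ?(ltW c0) // bumpf_ge0.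
- by move=> x ex; rewrite mulrfctE /b bumpf_out // mulr0.
- rewrite (_ : Rintegral _ _ _ = \int[mu]_x (c^-1 * b x)) // RintZ // mulVf // gt_eqF //.
Qed.

(** With this sign of the argument, the kernel at [x] is itself a translate of [rho] and can serve
    as a test function. *)
Definition conv rho u (x : V) : R := \int[mu]_y (u y * rho (y - x)).

Lemma conv_int rho u x : bdd_supp rho -> bdd_supp u -> bdd_supp (fun y => u y * rho (y - x)).
Proof. by move=> br bu; apply: bdd_suppMl => //; exact: bdd_supp_shift. Qed.

Lemma conv_supp e rho u : mollifier e rho -> bdd_supp u -> bdd_supp (conv rho u).
Proof.
move=> mr bu; have br := mollifier_supp mr; have [sr r0 re r1] := mr.
have [cK ro] := mollifier_ball mr.
have [L L0 hL] := Csmooth_lipschitz sr cK ro.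
pose A := \int[mu]_x `|u x|; have A0 : 0 <= A by apply: Rintegral_ge0.
have lip x y : `|conv rho u x - conv rho u y| <= L * A * `|x - y|.
  rewrite /conv -RintB; try exact: conv_int.
  rewrite (le_trans (le_normr_Rintegral _ _)) //.
    by apply: bdd_supp_integrable; apply: bdd_suppB; exact: conv_int.
  rewrite mulrAC /A -RintZ; last exact: bdd_supp_norm.
  apply: le_Rint => [||z].
  - by apply: bdd_supp_norm; apply: bdd_suppB; exact: conv_int.
  - by apply: bdd_suppZ; exact: bdd_supp_norm.
  rewrite -mulrBr normrM mulrC ler_wpM2r // -normrN opprB.
  by have := hL (z - y) (y - x); rewrite addrA subrK.
have cc : continuous (conv rho u) by exact: lipschitz_cts lip.
have [mu' [M [r hM]]] := bu; have [mr' [M' [r' hM']]] := br.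
split; first exact: measurable_continuous.
exists (M' * A), (r + e) => x; split.
  rewrite /conv (le_trans (le_normr_Rintegral _ _)) //.
    by apply: bdd_supp_integrable; exact: conv_int.
  rewrite /A -RintZ; last exact: bdd_supp_norm.
  apply: le_Rint => [||z].
  - by apply: bdd_supp_norm; exact: conv_int.
  - by apply: bdd_suppZ; exact: bdd_supp_norm.
  by rewrite normrM mulrC ler_wpM2r //; case: (hM' (z - x)).
move=> rx; rewrite /conv (_ : (fun y => _) = cst 0); first by rewrite Rintegral_cst // mul0r.
apply/funext => y /=; have [yr|ry] := leP `|y| r; last by rewrite (proj2 (hM y)) ?mul0r.
rewrite re ?mulr0 // leNgt; apply/negP => h; move: rx; rewrite ltNge => /negP; apply.
rewrite -[x](subrK y) addrC (le_trans (ler_normD _ _)) // lerD //.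
by rewrite -normrN opprB ltW.
Qed.

Lemma sdiff_conv vs t rho u x : bdd_supp rho -> bdd_supp u ->
  sdiff vs t (conv rho u) x = \int[mu]_y (u y * sdiff vs t (fun y => rho (y - x)) y).
Proof.
move=> br bu; have bs vs' : bdd_supp (sdiff vs' t (fun y => rho (y - x))).
  by apply: bdd_supp_sdiff; exact: bdd_supp_shift.
elim: vs => [|v vs IH].
  rewrite /sdiff big_nil (_ : (fun y => _) = cst 0) ?Rintegral_cst ?mul0r //.
  by apply/funext => y; rewrite big_nil mulr0.
rewrite {1}/sdiff big_cons -/(sdiff vs t (conv rho u) x) IH.
have E : (fun y => u y * sdiff (v :: vs) t (fun y => rho (y - x)) y) =
   (fun y => ((u y * rho (y - (x + t *: v)) + u y * rho (y - (x - t *: v))) - 2 * (u y * rho (y - x)))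
      + u y * sdiff vs t (fun y => rho (y - x)) y).
  apply/funext => y; rewrite /sdiff big_cons.
  have -> : y + t *: v - x = y - (x - t *: v) by rewrite opprB addrA addrAC.
  have -> : y - t *: v - x = y - (x + t *: v) by rewrite opprD addrA addrAC.
  by ring.
rewrite E RintD; last 2 first.
- apply: bdd_suppB; last by apply: bdd_suppZ; exact: conv_int.
  by apply: bdd_suppD; exact: conv_int.
- by apply: bdd_suppMl.
rewrite RintB; last 2 first.
- by apply: bdd_suppD; exact: conv_int.
- by apply: bdd_suppZ; exact: conv_int.
by rewrite RintD ?RintZ //; exact: conv_int.
Qed.

Lemma conv_close e rho u x (d : R) : mollifier e rho -> bdd_supp u ->
  (forall y, `|y - x| < e -> `|u y - u x| <= d) -> `|conv rho u x - u x| <= d.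
Proof.
move=> mr bu hd; have br := mollifier_supp mr; have [sr r0 re r1] := mr.
have bs : bdd_supp (fun y => rho (y - x)) by exact: bdd_supp_shift.
have E c : c = \int[mu]_y (c * rho (y - x)).
  by rewrite RintZ // (Rintegral_shift (- x) br) r1 mulr1.
rewrite [u x]E -RintB; [|exact: conv_int|exact: bdd_suppZ].
rewrite (le_trans (le_normr_Rintegral _ _)) //.
  by apply: bdd_supp_integrable; apply: bdd_suppB; [exact: conv_int|exact: bdd_suppZ].
rewrite [leRHS]E; apply: le_Rint => [||y].
- by apply: bdd_supp_norm; apply: bdd_suppB; [exact: conv_int|exact: bdd_suppZ].
- exact: bdd_suppZ.
rewrite -mulrBl normrM [`|rho _|]ger0_norm //.
have [h|h] := leP e `|y - x|; first by rewrite re // !mulr0.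
by rewrite ler_wpM2r // hd.
Qed.

(** The differences fall on the kernel, where they are [t ^+ 2] times [sop vs rho] up to order
    [t ^+ 3]; the main term is nonnegative by testing with translates of [rho]. [C] depends on
    [rho], hence on [e], which is harmless since [t] tends to 0 for a fixed mollifier. *)
Lemma conv_sdiff_ge vs K e rho u : mollifier e rho -> bdd_supp u ->
  (forall x psi, K x -> Csmooth psi -> (forall y, 0 <= psi y) ->
     (forall y, e <= `|y - x| -> psi y = 0) -> 0 <= \int[mu]_y (u y * sop vs psi y)) ->
  exists C, forall x t, K x -> 0 < t -> - (C * t ^+ 3) <= sdiff vs t (conv rho u) x.
Proof.
move=> mr bu hu; have br := mollifier_supp mr; have [sr r0 re r1] := mr.
have [cK ro] := mollifier_ball mr.
have [D D0 hD] := sop_sdiff vs sr cK ro.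
exists (D * \int[mu]_x `|u x|) => x t Kx t0.
rewrite sdiff_conv //.
have bsop : bdd_supp (fun y => sop vs rho (y - x)) by apply: bdd_supp_shift; exact: bdd_supp_sop cK _ _.
have h := hu x (fun y => rho (y - x)) Kx (Csmooth_shift (- x) sr) (fun y => r0 _)
  (fun y => re (y - x)).
have {}h : 0 <= \int[mu]_y (u y * sop vs rho (y - x)).
  have E2 : (fun y => u y * sop vs (fun y => rho (y - x)) y) = (fun y => u y * sop vs rho (y - x)).
    by apply/funext => y; rewrite (sop_shift vs rho (- x) y).
  exact: (eq_ind _ (fun g : V -> R => 0 <= Rintegral mu setT g) h _ E2).
have -> : - (D * \int[mu]_x `|u x| * t ^+ 3) = - \int[mu]_y (D * t ^+ 3 * `|u y|).
  by rewrite RintZ; [ring|exact: bdd_supp_norm].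
apply: (@le_trans _ _ (\int[mu]_y (t ^+ 2 * (u y * sop vs rho (y - x))) - \int[mu]_y (D * t ^+ 3 * `|u y|))).
  rewrite lerDr RintZ; last exact: bdd_suppMl.
  by rewrite mulr_ge0 // exprn_ge0 // ltW.
have b1 : bdd_supp (fun y => t ^+ 2 * (u y * sop vs rho (y - x))).
  by apply: bdd_suppZ; exact: bdd_suppMl.
have b2 : bdd_supp (fun y => D * t ^+ 3 * `|u y|) by apply: bdd_suppZ; exact: bdd_supp_norm.
rewrite -RintB //; apply: le_Rint => [||y].
- exact: bdd_suppB.
- by apply: bdd_suppMl => //; apply: bdd_supp_sdiff; exact: bdd_supp_shift.
rewrite lerBlDr -lerBlDl (le_trans (ler_norm _)) //.
rewrite (_ : t ^+ 2 * _ - _ = - (u y * (sdiff vs t rho (y - x) - t ^+ 2 * sop vs rho (y - x)))).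
  rewrite normrN normrM mulrC ler_wpM2r // (le_trans (hD _ _)) // gtr0_norm //.
rewrite (_ : sdiff vs t (fun y => rho (y - x)) y = sdiff vs t rho (y - x)); first by ring.
by rewrite /sdiff; apply: eq_bigr => v _; rewrite ![y + _ - x]addrAC.
Qed.

(* Near [K] the discrete operator of the maximum of two mollified functions is
   bounded below by the smaller of the two discrete operators, hence by
   [- C t^3]; no differentiation of the maximum is involved. *)
Lemma sop_max_ge0 vs K phi u1 u2 (e0 : R) : compact K -> Csmooth phi ->
  (forall x, ~ K x -> phi x = 0) -> (forall x, 0 <= phi x) -> 0 < e0 ->
  (forall u, u = u1 \/ u = u2 -> [/\ bdd_supp u,
     forall x psi, K x -> Csmooth psi -> (forall y, 0 <= psi y) ->
     (forall y, e0 <= `|y - x| -> psi y = 0) -> 0 <= \int[mu]_y (u y * sop vs psi y) &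
     forall e : R, 0 < e -> exists2 d : R, 0 < d & forall x y, K x -> ball x d y -> `|u y - u x| <= e]) ->
  0 <= \int[mu]_x (Num.max (u1 x) (u2 x) * sop vs phi x).
Proof.
move=> cK sphi phi0 phige e00 hu.
have [bu1 pu1 cu1] := hu u1 (or_introl erefl); have [bu2 pu2 cu2] := hu u2 (or_intror erefl).
have bsop : bdd_supp (sop vs phi) by exact: bdd_supp_sop cK _ _.
pose B := \int[mu]_x `|sop vs phi x|.
apply: (@lin_ge0 _ B 1) => // h h0 _.
have [d1 d10 hd1] := cu1 h h0; have [d2 d20 hd2] := cu2 h h0.
(* A radius at most [e0] admits translates of the mollifier as test functions; at most [d1] and
   [d2], it makes both mollifications [h]-close to the functions on [K]. *)
pose e := Num.min e0 (Num.min d1 d2).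
have e_gt0 : 0 < e by rewrite !lt_min e00 d10.
have [rho mr] := mollifier_exists e_gt0.
have ee0 : e <= e0 by rewrite ge_min lexx.
have ed1 : e <= d1 by rewrite !ge_min lexx orbT.
have ed2 : e <= d2 by rewrite !ge_min lexx !orbT.
have [C1 hC1] := @conv_sdiff_ge vs K e rho u1 mr bu1 (fun x psi Kx sp p0 pe =>
   pu1 x psi Kx sp p0 (fun y ye => pe y (le_trans ee0 ye))).
have [C2 hC2] := @conv_sdiff_ge vs K e rho u2 mr bu2 (fun x psi Kx sp p0 pe =>
   pu2 x psi Kx sp p0 (fun y ye => pe y (le_trans ee0 ye))).
have bw1 := conv_supp mr bu1; have bw2 := conv_supp mr bu2.
pose w x := Num.max (conv rho u1 x) (conv rho u2 x).
have bw : bdd_supp w by exact: bdd_supp_max.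
have bm : bdd_supp (fun x => Num.max (u1 x) (u2 x)) by exact: bdd_supp_max.
have wge0 : 0 <= \int[mu]_x (w x * sop vs phi x).
  apply: (@sop_ge0 vs K phi w (Num.max C1 C2) 1) => // x t Kx t0 _.
  apply: sdiff_max.
    by apply: le_trans (hC1 x t Kx t0); rewrite lerN2 ler_wpM2r ?exprn_ge0 ?(ltW t0) // le_max lexx.
  by apply: le_trans (hC2 x t Kx t0); rewrite lerN2 ler_wpM2r ?exprn_ge0 ?(ltW t0) // le_max lexx orbT.
have close x : K x -> `|w x - Num.max (u1 x) (u2 x)| <= h.
  move=> Kx; have c1 : `|conv rho u1 x - u1 x| <= h.
    apply: (conv_close mr bu1) => y xy; apply: hd1 => //.
    by rewrite -ball_normE /= distrC (lt_le_trans xy).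
  have c2 : `|conv rho u2 x - u2 x| <= h.
    apply: (conv_close mr bu2) => y xy; apply: hd2 => //.
    by rewrite -ball_normE /= distrC (lt_le_trans xy).
  move: c1 c2; rewrite /w !ler_distl => /andP[c1 c1'] /andP[c2 c2']; apply/andP; split.
    by rewrite lerBlDr ge_max; apply/andP; split; rewrite -lerBlDr le_max ?c1 ?c2 ?orbT.
  by rewrite ge_max -!lerBlDr !le_max !lerBlDr c1' c2' orbT.
rewrite -subr_ge0 opprK /B mulrC -RintZ; last exact: bdd_supp_norm.
rewrite -RintD; [|exact: bdd_suppMl|by apply: bdd_suppZ; exact: bdd_supp_norm].
apply: le_trans wge0 _; apply: le_Rint => [||x].
- exact: bdd_suppMl.
- by apply: bdd_suppD; [exact: bdd_suppMl|by apply: bdd_suppZ; exact: bdd_supp_norm].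
have [Kx|Kx] := pselect (K x); last by rewrite (sop_out vs (compact_rV_closed cK) phi0 Kx) normr0 !mulr0 addr0.
rewrite -lerBlDl -mulrBl (le_trans (ler_norm _)) // normrM ler_wpM2r // close //.
Qed.

End max_principle.

(** * The wedge operator in real coordinates *)

Section hessian.
Context {R : realType} {n : nat}.
Local Notation V := (Cn R n).
Local Notation C := R[i].
Local Notation Re := (@complex.Re R).
Local Notation Im := (@complex.Im R).
Implicit Types (phi : V -> R) (z : V).

Lemma derive2_coords phi (p : V) z : Csmooth phi ->
  'D_p ('D_p phi) z = \sum_l \sum_k p ord0 l * p ord0 k *
     'D_(delta_mx ord0 l) ('D_(delta_mx ord0 k) phi) z.
Proof.
move=> sf; rewrite (derive_coords p z (Csmooth_D p sf)); apply: eq_bigr => l _.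
have E : 'D_p phi = \sum_k (p ord0 k \*: 'D_(delta_mx ord0 k) phi).
  by apply/funext => x; rewrite derive_coords // fct_sumE.
rewrite {1}E derive_sum; last first.
  by move=> k; apply: derivableZ; apply: Csmooth_derivable; exact: Csmooth_D.
rewrite mulr_sumr; apply: eq_bigr => k _; rewrite deriveZ; last first.
  by apply: Csmooth_derivable; exact: Csmooth_D.
by rewrite [_ *: _]/(_ * _) mulrA.
Qed.

Definition vec (a b : 'I_n -> R) : V := row_mx (\row_j a j) (\row_j b j).

Lemma derive2_vec phi (a b : 'I_n -> R) z : Csmooth phi ->
  'D_(vec a b) ('D_(vec a b) phi) z = \sum_j \sum_k (
     a j * a k * 'D_(ex j) ('D_(ex k) phi) z + a j * b k * 'D_(ex j) ('D_(ey k) phi) z +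
     (b j * a k * 'D_(ey j) ('D_(ex k) phi) z + b j * b k * 'D_(ey j) ('D_(ey k) phi) z)).
Proof.
move=> sf; rewrite derive2_coords //.
have E (F : 'I_(n + n) -> R) : \sum_k F k = \sum_(k < n) (F (lshift n k) + F (rshift n k)).
  by rewrite big_split_ord [RHS]big_split.
etransitivity; first exact: E.
apply: eq_bigr => j _; etransitivity; first exact: (congr2 +%R (E _) (E _)).
rewrite -[LHS]big_split; apply: eq_bigr => k _.
by rewrite /vec /ex /ey !row_mxEl !row_mxEr !mxE.
Qed.

Lemma Re_sum (J : Type) (r : seq J) (F : J -> C) : Re (\sum_(i <- r) F i) = \sum_(i <- r) Re (F i).
Proof.
apply: (big_morph Re) => //; by move=> [? ?] [? ?].
Qed.

(** The two real vectors represent [xi] and [- i xi], which span the complex line of [xi]: up to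
    scaling, the Hermitian form of [ddc phi] at [xi] is the Laplacian of [phi] along that line. *)
Lemma ddc_rank_one phi (xi : 'I_n -> C) z : Csmooth phi ->
  Re (\sum_j \sum_k ddc phi z j k * (xi j * Num.conj (xi k))) =
  2^-1 * ('D_(vec (Re \o xi) (Im \o xi)) ('D_(vec (Re \o xi) (Im \o xi)) phi) z +
          'D_(vec (Im \o xi) (fun j => - Re (xi j))) ('D_(vec (Im \o xi) (fun j => - Re (xi j))) phi) z).
Proof.
move=> sf; have E (F G : 'I_n -> 'I_n -> R) : 2^-1 * (\sum_j \sum_k F j k + \sum_j \sum_k G j k) =
    \sum_j \sum_k 2^-1 * (F j k + G j k).
  rewrite -big_split mulr_sumr; apply: eq_bigr => j _.
  by rewrite -big_split mulr_sumr.
rewrite (derive2_vec _ _ _ sf) (derive2_vec (Im \o xi) _ _ sf) E Re_sum; apply: eq_bigr => j _.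
rewrite Re_sum; apply: eq_bigr => k _.
rewrite mxE /=; move: ('D_(ex j) _ z) ('D_(ey j) _ z) ('D_(ex j) _ z) ('D_(ey j) _ z).
move=> XX YY XY YX.
have -> : (2^-1 : C) = (2^-1)%:C by rewrite fmorphV rmorph_nat.
by case: (xi j) (xi k) => [a b] [c d] /=; ring.
Qed.

Lemma garding_sop m (l : (m.-1).-tuple 'M[C]_n) : (1 <= m <= n)%N ->
  (forall i, Gamma m (tnth l i)) -> exists vs : seq V, forall phi z, smooth phi ->
  Re (wedge (ddc phi z :: l ++ nseq (n - m) beta)) = 2^-1 * sop vs phi z.
Proof.
move=> mn hl; have [xi hxi] := garding_sos mn hl.
pose p i := vec (Re \o xi i) (Im \o xi i); pose q i := vec (Im \o xi i) (fun j => - Re (xi i j)).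
exists ([seq p i | i <- index_enum 'I_n] ++ [seq q i | i <- index_enum 'I_n]) => phi z sf.
rewrite hxi Re_sum /sop big_cat /= !big_map -big_split mulr_sumr.
by apply: eq_bigr => i _; rewrite ddc_rank_one.
Qed.

End hessian.

(** * The cone of continuous m-subharmonic functions *)

Section good.
Context {R : realType} {n : nat}.
Local Notation V := (Cn R n).
Local Notation mu := (@lebesgue_rV R (n + n)).
Variables (m : nat) (hm : (1 <= m <= n)%N).
Implicit Types (u v w phi : V -> R) (U D K X : set V).

(** Balls have to be connected in order to lie in a single component of the neighbourhood, since
    m-subharmonicity is defined component by component. *)
Lemma star_connected (A : set V) (x : V) : A x ->
  (forall y (t : R), A y -> 0 <= t -> t <= 1 -> A (x + t *: (y - x))) -> connected A.
Proof.
move=> Ax hA; have -> : A = \bigcup_(y in A) ((fun t : R => x + t *: (y - x)) @` `[0, 1]).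
  apply/seteqP; split=> [y Ay|y [z Az] [t]].
    exists y => //; exists 1; first by rewrite /= in_itv /= ler01 lexx.
    by rewrite scale1r addrC subrK.
  by rewrite /= in_itv /= => /andP[t0 t1] <-; exact: hA.
apply: bigcup_connected.
  exists x => y _; exists 0; first by rewrite /= in_itv /= lexx ler01.
  by rewrite scale0r addr0.
move=> y _; apply: connected_continuous_connected; first exact: segment_connected.
apply: continuous_subspaceT => t; apply: (@cvgD _ _ _ _ _ (fun=> x)); first exact: cvg_cst.
by apply: cvgZr_tmp; exact: cvg_id.
Qed.

Lemma connected_norm_ball (x : V) (e : R) : 0 <= e -> connected [set y | `|y - x| <= e].
Proof.
move=> e0; apply: (@star_connected _ x) => [|y t /= ye t0 t1]; first by rewrite /= subrr normr0.
rewrite addrAC subrr add0r normrZ ger0_norm //.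
by apply: le_trans ye; rewrite ler_piMl.
Qed.

Lemma connected_eball (a : V) (r : R) : 0 < r -> connected (eball a r).
Proof.
move=> r0; apply: (@star_connected _ a) => [|y t].
  by rewrite /eball /= subrr /sqnorm big1 ?sqr_ge0 // => k _; rewrite mxE expr0n.
rewrite /eball /= /sqnorm => ye t0 t1; apply: le_trans ye; apply: ler_sum => k _.
by rewrite addrAC subrr add0r mxE exprMn ler_piMl ?sqr_ge0 // exprn_ile1.
Qed.

Lemma sqnorm_continuous : continuous (@sqnorm R n).
Proof.
have H (r : seq 'I_(n + n)) : continuous (fun z : V => \sum_(k <- r) z ord0 k ^+ 2).
  elim: r => [|k r IH].
    rewrite (_ : (fun _ => _) = cst 0); first exact: cst_continuous.
    by apply/funext => x; rewrite big_nil.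
  rewrite (_ : (fun _ => _) = (fun z : V => z ord0 k * z ord0 k) \+
     (fun z : V => \sum_(k <- r) z ord0 k ^+ 2)); last first.
    by apply/funext => x; rewrite big_cons.
  move=> x; have cx := @coord_continuous R 1 (n + n) ord0 k x.
  exact: (cvgD (cvgM cx cx) (IH x)).
exact: H.
Qed.

Lemma eball_closed (a : V) (r : R) : closed (eball a r).
Proof.
rewrite (_ : eball a r = (fun z => sqnorm (z - a)) @^-1` [set y | y <= r ^+ 2]) //.
apply: closed_comp; last exact: closed_le.
move=> x _; apply: (@continuous_comp _ _ _ (fun x : V => x - a) (@sqnorm R n)).
  exact: (cvgD cvg_id (cvg_cst (- a))).
exact: sqnorm_continuous.
Qed.

Lemma eball_bounded (a x : V) (r : R) : 0 < r -> eball a r x -> `|x - a| <= r.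
Proof.
move=> r0 h; apply/(normrV_leP _ (ltW r0)) => k.
rewrite -(ler_pXn2r (n := 2)) ?nnegrE ?(ltW r0) // real_normK ?num_real //.
apply: le_trans h; rewrite /sqnorm (bigD1 k) //= lerDl.
by apply: sumr_ge0 => i _; rewrite sqr_ge0.
Qed.

Lemma eball_compact (a : V) (r : R) : 0 < r -> compact (eball a r).
Proof.
move=> r0; apply: (@subclosed_compact _ _ [set x | `|x - a| <= r]).
- exact: eball_closed.
- exact: compact_norm_ball.
- by move=> x; exact: eball_bounded.
Qed.

Lemma eball_center (a : V) (r : R) : eball a r a.
Proof. by rewrite /eball /= subrr /sqnorm big1 ?sqr_ge0 // => k _; rewrite mxE expr0n. Qed.

Lemma eball_measurable (a : V) (r : R) : measurable (eball a r : set (borel R (n + n))).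
Proof. by apply: closed_borel; exact: eball_closed. Qed.

Lemma eball_vol (a : V) (r : R) : 0 < r -> 0 < fine (mu (eball a r)) /\
  (mu (eball a r) < +oo)%E.
Proof.
move=> r0; have me := eball_measurable a r.
have fin : (mu (eball a r) < +oo)%E.
  apply: (@lebesgue_bounded_fin R _ _ (`|a| + r)) => // x /(eball_bounded r0) xr.
  by rewrite -[x](subrK a) addrC (le_trans (ler_normD _ _)) // lerD2l.
split => //; apply: fine_gt0; rewrite fin andbT.
have N0 : 0 < (n + n).+1%:R :> R by [].
(* The ball of this radius in the maximum norm lies inside: [n + n] squares of [r / (n + n).+1] add
   up to at most [r ^+ 2]. *)
apply: (@lebesgue_ball_gt0 R _ _ a (r / (n + n).+1%:R)) => //; first by rewrite divr_gt0.
move=> y /(normrV_ltP _ (divr_gt0 r0 N0)) hy; rewrite /eball /=.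
apply: (@le_trans _ _ (\sum_(k < n + n) (r / (n + n).+1%:R) ^+ 2)).
  apply: ler_sum => k _; rewrite -real_normK ?num_real //.
  by rewrite ler_pXn2r ?nnegrE ?divr_ge0 ?(ltW r0) // ltW // hy.
rewrite sumr_const card_ord -[X in X <= _]mulr_natr exprMn -mulrA ler_piMr ?sqr_ge0 //.
rewrite exprVn mulrC ler_pdivrMr ?exprn_gt0 // mul1r -natrX ler_nat; nia.
Qed.

Lemma within_open_continuous U u : open U ->
  {within U, continuous u} <-> forall x, U x -> {for x, continuous u}.
Proof.
move=> oU; split=> [cu x Ux|cu].
  by move: cu; rewrite (continuous_open_subspace u oU) => cu; apply: cu; rewrite inE.
by rewrite (continuous_open_subspace u oU) => x; rewrite inE; exact: cu.
Qed.

(* [msubharmonic] tests positivity with functions supported in a connected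
   component. Testing only in small balls gives the same condition for
   continuous functions (by [local_pos_max] with w1 = w2), and in this form it
   passes at once to smaller open sets. *)
Definition admissible (vs : seq V) := exists2 a : (m.-1).-tuple 'M[R[i]]_n,
  forall i, Gamma m (tnth a i) & forall phi z, smooth phi ->
  complex.Re (wedge (ddc phi z :: a ++ nseq (n - m) beta)) = 2^-1 * sop vs phi z.

Definition local_mean U w := forall a r, 0 < r -> eball a r `<=` U ->
  fine (mu (eball a r)) * w a <= \int[mu]_(x in eball a r) w x.

(** Nothing is known about [w] outside [U], so the integral is written with any [u] of class
    [bdd_supp] agreeing with [w] on the ball; its value does not depend on the choice. *)
Definition local_pos U w := forall vs x e psi u, admissible vs -> 0 < e ->
  [set y | `|y - x| <= e] `<=` U -> Csmooth psi -> (forall y, 0 <= psi y) ->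
  (forall y, e <= `|y - x| -> psi y = 0) -> bdd_supp u ->
  (forall y, `|y - x| <= e -> u y = w y) -> 0 <= \int[mu]_y (u y * sop vs psi y).

Definition lsh U w := [/\ forall x, U x -> {for x, continuous w}, local_mean U w & local_pos U w].

Lemma lsh_sub U U' w : U' `<=` U -> lsh U w -> lsh U' w.
Proof.
move=> sU [cw mw pw]; split=> [x /sU|a r r0 /subset_trans/(_ sU)|]; [exact: cw|exact: mw|].
move=> vs x e psi u av e0 /subset_trans/(_ sU) eU; exact: pw.
Qed.

Lemma Rint_sop_eq vs psi K u u' : closed K -> (forall x, ~ K x -> psi x = 0) ->
  (forall x, K x -> u x = u' x) ->
  \int[mu]_x (u x * sop vs psi x) = \int[mu]_x (u' x * sop vs psi x).
Proof.
move=> clK psi0 uu'; congr (Rintegral _ _ _); apply/funext => x.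
have [/uu'->//|Kx] := pselect (K x).
by rewrite (@sop_out _ _ vs psi K clK psi0 x Kx) !mulr0.
Qed.

(** Small balls lead to arbitrary compact supports in [U] without a partition of unity, because
    [sop_max_ge0] tests its hypothesis on functions concentrated near one point. *)
Lemma local_pos_max U w1 w2 K vs phi u : open U -> lsh U w1 -> lsh U w2 ->
  compact K -> K `<=` U -> admissible vs -> Csmooth phi -> (forall x, ~ K x -> phi x = 0) ->
  (forall x, 0 <= phi x) -> (forall x, K x -> u x = Num.max (w1 x) (w2 x)) ->
  0 <= \int[mu]_x (u x * sop vs phi x).
Proof.
move=> oU [cw1 _ pw1] [cw2 _ pw2] cK KU av sphi phi0 phige uK.
have [v1 [r1 [bv1 r10 rU1 vw1 uc1]]] := cutoff cK oU KU cw1.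
have [v2 [r2 [bv2 r20 rU2 vw2 uc2]]] := cutoff cK oU KU cw2.
have clK := compact_rV_closed cK.
rewrite (@Rint_sop_eq vs phi K u (fun x => Num.max (v1 x) (v2 x))) //; last first.
  by move=> x Kx; rewrite uK // (vw1 x x) ?(vw2 x x) //; exact: ballxx.
(* With half the smaller radius, the closed ball of radius [e] around a point of [K] lies in the
   open balls where the cut-offs agree with [w1] and [w2]. *)
pose e := Num.min r1 r2 / 2; have r0 : 0 < Num.min r1 r2 by rewrite lt_min r10.
have e0 : 0 < e by rewrite divr_gt0.
have er : e < Num.min r1 r2 by rewrite /e ltr_pdivrMr // ltr_pMr // ltr1n.
have sub i (x y : V) : i = r1 \/ i = r2 -> `|y - x| <= e -> ball x i y.
  move=> hi /le_lt_trans/(_ er); rewrite lt_min => /andP[h1 h2].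
  by rewrite -ball_normE /= distrC; case: hi => ->.
apply: (@sop_max_ge0 R (n + n) vs K phi v1 v2 e) => // v hv; split.
- by case: hv => ->.
- move=> x psi Kx sp p0 pe; case: hv => ->.
    apply: (pw1 vs x e) => // y; first by move=> h; apply: (rU1 x Kx); apply: sub h; left.
    by move=> h; apply: (vw1 x) => //; apply: sub h; left.
  apply: (pw2 vs x e) => // y; first by move=> h; apply: (rU2 x Kx); apply: sub h; right.
  by move=> h; apply: (vw2 x) => //; apply: sub h; right.
- by case: hv => ->.
Qed.

Lemma wedge_int D phi w vs (a : (m.-1).-tuple 'M[R[i]]_n) u : test_fun D phi ->
  (forall z, smooth phi -> complex.Re (wedge (ddc phi z :: a ++ nseq (n - m) beta)) = 2^-1 * sop vs phi z) ->
  bdd_supp u -> (forall x, closure [set z | phi z != 0] x -> u x = w x) ->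
  (\int[mu]_(z in D) ((EFin \o w) z *
     (complex.Re (wedge (ddc phi z :: a ++ nseq (n - m) beta)))%:E) =
   (2^-1 * \int[mu]_x (u x * sop vs phi x))%:E)%E.
Proof.
move=> [sf cK KD] hvs bu uw; set K := closure _ in cK KD uw.
have phi0 x : ~ K x -> phi x = 0.
  by apply: contra_notP => /eqP px; apply: subset_closure.
have bs : bdd_supp (fun x => u x * sop vs phi x).
  by apply: bdd_suppMl => //; exact: bdd_supp_sop cK _ _.
rewrite -RintZ // integral_mkcond.
rewrite (_ : _ \_ D = EFin \o (fun x => 2^-1 * (u x * sop vs phi x))); last first.
  apply/funext => x; rewrite patchE /=; have [Kx|Kx] := pselect (K x).
    rewrite ifT; last by rewrite inE; exact: KD.
    by rewrite hvs // -EFinM uw // mulrCA.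
  have s0 : sop vs phi x = 0 by apply: (@sop_out _ _ vs phi K); rewrite // /K; exact: closed_closure.
  by rewrite hvs // s0 !mulr0 mule0; case: ifP.
rewrite /Rintegral fineK //; apply: integrable_fin_num => //.
by apply: bdd_supp_integrable; exact: bdd_suppZ.
Qed.

Lemma eball_integrable U w a r : open U -> (forall x, U x -> {for x, continuous w}) ->
  0 < r -> eball a r `<=` U -> mu.-integrable (eball a r) (EFin \o w).
Proof.
move=> oU cw r0 eU; have me := eball_measurable a r.
have [v [rv [bv rv0 _ vw _]]] := cutoff (@eball_compact a r r0) oU eU cw.
apply: (@eq_integrable _ _ _ mu _ me (EFin \o v)).
  by move=> x; rewrite inE => ex /=; rewrite (vw x) //; exact: ballxx.
apply: integrableS (bdd_supp_integrable bv) => //.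
Qed.

Lemma mean_fine U w a r : open U -> (forall x, U x -> {for x, continuous w}) ->
  0 < r -> eball a r `<=` U ->
  ((w a)%:E <= ((fine (mu (eball a r)))^-1)%:E * \int[mu]_(z in eball a r) (EFin \o w) z)%E =
  (fine (mu (eball a r)) * w a <= \int[mu]_(x in eball a r) w x).
Proof.
move=> oU cw r0 eU; have [v0 _] := eball_vol a r0.
have iw := eball_integrable oU cw r0 eU.
rewrite -[X in (_ * X)%E]fineK ?integrable_fin_num //; last exact: eball_measurable.
by rewrite -EFinM lee_fin mulrC ler_pdivlMr // mulrC.
Qed.

Lemma continuous_usc_on U w : (forall x, U x -> {for x, continuous w}) -> usc_on U (EFin \o w).
Proof.
move=> cw z Uz a wa; have : nbhs z [set x | w x < a].
  have := cw z Uz => /(_ [set y | y < a]); apply.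
  by apply: open_nbhs_nbhs; split; [exact: open_lt|rewrite /= -lte_fin].
by rewrite near_withinE; apply: filterS => y ya _; rewrite /= lte_fin.
Qed.

(** Closed balls are connected, hence lie in one component of [U], and a real-valued function is not
    identically -oo there; this gives the local conditions. Conversely [local_pos_max] recovers
    positivity against every test function on a component. *)
Lemma SHoP X v : SHo m X v <-> exists U w, [/\ open U, X `<=` U, lsh U w & forall z, X z -> v z = w z].
Proof.
split=> -[U [w [oU XU]]].
  move=> /(within_open_continuous w oU) cw [_ _ mw] vw; exists U, w; split => //.
  have {}mw z : U z -> subharmonic (connected_component U z) (EFin \o w) /\
      forall a : (m.-1).-tuple 'M[R[i]]_n, (forall i, Gamma m (tnth a i)) ->
         ddc_wedge_ge0 (connected_component U z) (EFin \o w) (a ++ nseq (n - m) beta).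
    move=> Uz; have [h|h//] := mw z Uz.
    by have := h z (connected_component_refl Uz).
  split => // [a r r0 eU|vs x e psi u [a ga hvs] e0 eU sp p0 pe bu uw].
    have ea : eball a r a by exact: eball_center.
    have [[_ _ sub] _] := mw a (eU _ ea).
    rewrite -(mean_fine oU cw r0 eU); apply: sub => //.
    by apply: connected_component_max => //; exact: connected_eball.
  set K := [set y | _] in eU.
  have [cK clK _] := norm_ball_supp pe.
  have Kx : K x by rewrite /K /= subrr normr0 ltW.
  have [_ /(_ a ga psi)] := mw x (eU _ Kx).
  have psiK : closure [set z | psi z != 0] `<=` K.
    rewrite closureE => y; apply; split => // z /= pz; rewrite /K /= leNgt; apply/negP => ez.
    by move: pz; rewrite pe ?eqxx // ltW.
  have tp : test_fun (connected_component U x) psi.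
    split => //; first exact: subclosed_compact (@closed_closure _ _) cK psiK.
    apply: subset_trans psiK _; apply: connected_component_max => //.
    by apply: connected_norm_ball; exact: ltW.
  rewrite (@wedge_int _ _ _ vs a u tp) //.
  - by move/(_ tp p0); rewrite lee_fin pmulr_rge0.
  - by move=> z; exact: hvs.
  - by move=> y /psiK; exact: uw.
move=> lw vw; have [cw mw pw] := lw; exists U, w; split => //; first exact/within_open_continuous.
split=> [|z _|z Uz D]; [exact: continuous_usc_on|exact: ltry|].
have DU : D `<=` U by exact: connected_component_sub.
right; split.
  split=> [|x _|a r r0 eD]; [|exact: ltry|].
    by apply: continuous_usc_on => x /DU; exact: cw.
  have eU : eball a r `<=` U by exact: subset_trans DU.
  by have := mw a r r0 eU; rewrite -(mean_fine oU cw r0 eU).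
move=> a ga phi tphi phige; have [vs hvs] := garding_sop hm ga.
have [sf cK KD] := tphi; set K := closure _ in cK KD.
have KU : K `<=` U by exact: subset_trans DU.
have [u [ru [bu ru0 _ uw _]]] := cutoff cK oU KU cw.
have uwK x : K x -> u x = w x by move=> Kx; apply: (uw x) => //; exact: ballxx.
rewrite (@wedge_int _ _ _ vs a u tphi) //; last by move=> y; exact: hvs.
rewrite lee_fin pmulr_rge0 //.
have phi0 x : ~ K x -> phi x = 0.
  by apply: contra_notP => /eqP px; apply: subset_closure.
apply: (@local_pos_max U w w K vs phi u) => //; first by exists a.
by move=> x /uwK ->; rewrite maxxx.
Qed.

Lemma lsh_max U w1 w2 : open U -> lsh U w1 -> lsh U w2 -> lsh U (fun x => Num.max (w1 x) (w2 x)).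
Proof.
move=> oU l1 l2; have [cw1 mw1 _] := l1; have [cw2 mw2 _] := l2.
have cw x : U x -> {for x, continuous (fun x => Num.max (w1 x) (w2 x))}.
  by move=> Ux; apply: continuous_max; [exact: cw1|exact: cw2].
split => // [a r r0 eU|vs x e psi u av e0 eU sp p0 pe bu uw].
  have me := eball_measurable a r; have [v0 _] := eball_vol a r0.
  rewrite maxr_pMr ?(ltW v0) // ge_max; apply/andP; split.
    apply: (le_trans (mw1 a r r0 eU)); apply: le_Rintegral => //.
    - exact: eball_integrable oU cw1 r0 eU.
    - exact: eball_integrable oU cw r0 eU.
    - by move=> x _; rewrite le_max lexx.
  apply: (le_trans (mw2 a r r0 eU)); apply: le_Rintegral => //.
  - exact: eball_integrable oU cw2 r0 eU.
  - exact: eball_integrable oU cw r0 eU.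
  - by move=> x _; rewrite le_max lexx orbT.
have [cK _ psi0] := norm_ball_supp pe.
exact: (@local_pos_max U w1 w2 [set y | `|y - x| <= e]).
Qed.

Lemma lsh_add U w1 w2 : open U -> lsh U w1 -> lsh U w2 -> lsh U (fun x => w1 x + w2 x).
Proof.
move=> oU [cw1 mw1 pw1] [cw2 mw2 pw2]; split => [x Ux|a r r0 eU|vs x e psi u av e0 eU sp p0 pe bu uw].
- exact: (cvgD (cw1 x Ux) (cw2 x Ux)).
- rewrite RintegralD ?mulrDr; [|exact: eball_measurable|exact: eball_integrable oU cw1 r0 eU|
    exact: eball_integrable oU cw2 r0 eU].
  by rewrite lerD ?mw1 ?mw2.
have [cK clK psi0] := norm_ball_supp pe; set K := [set y | _] in eU cK clK psi0.
have [v1 [r1 [bv1 r10 _ vw1 _]]] := cutoff cK oU eU cw1.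
have [v2 [r2 [bv2 r20 _ vw2 _]]] := cutoff cK oU eU cw2.
have bs : bdd_supp (sop vs psi) by exact: bdd_supp_sop cK sp psi0.
rewrite (@Rint_sop_eq vs psi K u (fun x => v1 x + v2 x)) //; last first.
  by move=> y Ky; rewrite uw // (vw1 y y) ?(vw2 y y) //; exact: ballxx.
rewrite (_ : (fun y => _) = (fun y => v1 y * sop vs psi y + v2 y * sop vs psi y)); last first.
  by apply/funext => y; rewrite mulrDl.
rewrite RintD; [|exact: bdd_suppMl|exact: bdd_suppMl]; apply: addr_ge0.
  by apply: (pw1 vs x e) => // y Ky; apply: (vw1 y) => //; exact: ballxx.
by apply: (pw2 vs x e) => // y Ky; apply: (vw2 y) => //; exact: ballxx.
Qed.

Lemma lsh_scale U w (c : R) : open U -> 0 <= c -> lsh U w -> lsh U (fun x => c * w x).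
Proof.
move=> oU c0 [cw mw pw]; split => [x Ux|a r r0 eU|vs x e psi u av e0 eU sp p0 pe bu uw].
- exact: (cvgM (cvg_cst c) (cw x Ux)).
- rewrite RintegralZl; [|exact: eball_measurable|exact: eball_integrable oU cw r0 eU].
  by rewrite mulrCA ler_wpM2l // mw.
have [cK clK psi0] := norm_ball_supp pe; set K := [set y | _] in eU cK clK psi0.
have [v [r [bv r0 _ vw _]]] := cutoff cK oU eU cw.
have bs : bdd_supp (sop vs psi) by exact: bdd_supp_sop cK sp psi0.
rewrite (@Rint_sop_eq vs psi K u (fun x => c * v x)) //; last first.
  by move=> y Ky; rewrite uw // (vw y y) //; exact: ballxx.
rewrite (_ : (fun y => _) = (fun y => c * (v y * sop vs psi y))); last first.
  by apply/funext => y; rewrite mulrA.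
rewrite RintZ; last exact: bdd_suppMl.
apply: mulr_ge0 => //.
by apply: (pw vs x e) => // y Ky; apply: (vw y) => //; exact: ballxx.
Qed.

Lemma lsh_cst (c : R) : lsh setT (fun=> c).
Proof.
have cc : forall x : V, setT x -> {for x, continuous (fun _ : V => c)} by move=> x _; exact: cst_continuous.
split => // [a r r0 _|vs x e psi u av e0 _ sp p0 pe bu uw].
  have [v0 vfin] := eball_vol a r0; rewrite Rintegral_cst; last exact: eball_measurable.
  by rewrite mulrC.
have [cK clK psi0] := norm_ball_supp pe; set K := [set y | _] in cK clK psi0.
have [v [r [bv r0 _ vw _]]] := cutoff cK (@openT V) (@subsetT _ K) cc.
rewrite (@Rint_sop_eq vs psi K u v) //; last first.
  by move=> y Ky; rewrite uw // (vw y y) //; exact: ballxx.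
(* [S] exceeds the norm of every vector of [vs], so for [t <= r / S / 2] the points [y + t *: w] and
   [y - t *: w] stay where [v] equals [c], and the second differences vanish. *)
pose S := \sum_(w <- vs) `|w| + 1.
have S1 : 0 < S by rewrite ltr_wpDl // sumr_ge0.
apply: (@sop_ge0 R (n + n) vs K psi v 0 (r / S / 2)) => //; first by rewrite !divr_gt0.
move=> y t Ky t0 tr; rewrite mul0r oppr0 /sdiff big_seq big1 // => w wvs.
have tw : `|t *: w| < r.
  rewrite normrZ gtr0_norm //; apply: (@le_lt_trans _ _ (r / S / 2 * S)).
    apply: ler_pM => //; first exact: ltW.
    rewrite /S (perm_big _ (perm_to_rem wvs)) big_cons -addrA lerDl addr_ge0 //.
    by apply: sumr_ge0.
  by rewrite mulrAC divfK ?gt_eqF // ltr_pdivrMr // ltr_pMr // ltr1n.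
rewrite !(vw y) //.
- by ring.
- exact: ballxx.
- by rewrite -ball_normE /= opprB addrC subrK.
- by rewrite -ball_normE /= opprD addNKr normrN.
Qed.

Lemma SHo_max X v1 v2 : SHo m X v1 -> SHo m X v2 -> SHo m X (fun x => Num.max (v1 x) (v2 x)).
Proof.
move=> /SHoP[U1 [w1 [oU1 XU1 l1 vw1]]] /SHoP[U2 [w2 [oU2 XU2 l2 vw2]]].
apply/SHoP; exists (U1 `&` U2), (fun x => Num.max (w1 x) (w2 x)); split => //.
- exact: openI.
- by move=> x Xx; split; [exact: XU1|exact: XU2].
- by apply: lsh_max; [exact: openI|apply: lsh_sub l1 => ? []|apply: lsh_sub l2 => ? []].
- by move=> z Xz; rewrite vw1 ?vw2.
Qed.

Lemma SHo_add X v1 v2 : SHo m X v1 -> SHo m X v2 -> SHo m X (fun x => v1 x + v2 x).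
Proof.
move=> /SHoP[U1 [w1 [oU1 XU1 l1 vw1]]] /SHoP[U2 [w2 [oU2 XU2 l2 vw2]]].
apply/SHoP; exists (U1 `&` U2), (fun x => w1 x + w2 x); split => //.
- exact: openI.
- by move=> x Xx; split; [exact: XU1|exact: XU2].
- by apply: lsh_add; [exact: openI|apply: lsh_sub l1 => ? []|apply: lsh_sub l2 => ? []].
- by move=> z Xz; rewrite vw1 ?vw2.
Qed.

Lemma SHo_scale X v (c : R) : 0 <= c -> SHo m X v -> SHo m X (fun x => c * v x).
Proof.
move=> c0 /SHoP[U [w [oU XU l vw]]]; apply/SHoP; exists U, (fun x => c * w x); split => //.
  exact: lsh_scale.
by move=> z Xz; rewrite vw.
Qed.

Lemma SHo_cst X (c : R) : SHo m X (fun=> c).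
Proof. by apply/SHoP; exists setT, (fun=> c); split => //; [exact: openT|exact: lsh_cst]. Qed.

Lemma SHo_continuous X v : SHo m X v -> {within X, continuous v}.
Proof.
move=> [U [w [_ XU cw _ vw]]]; apply: (@subspace_eq_continuous _ _ _ w).
  by move=> x; rewrite inE => Xx /=; apply/esym; exact: vw.
exact: continuous_subspaceW cw.
Qed.

End good.
(** * Riesz representation *)

Lemma homo_leq_le {d} {T : porderType d} (f : nat -> T) : (forall n, (f n <= f n.+1)%O) ->
  {homo f : i j / (i <= j)%N >-> (i <= j)%O}.
Proof. by apply: homo_leq => [?|? ? ?]; [exact: lexx|exact: le_trans]. Qed.

Section compact_set.
Context {R : realType} {T : topologicalType}.
Variable X : set T.
Implicit Types (f g : T -> R).

Definition ctsX f := {within X, continuous f}.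

Lemma ctsX_cst (c : R) : ctsX (fun=> c).
Proof. by move=> x; exact: cst_continuous. Qed.

Lemma ctsXD f g : ctsX f -> ctsX g -> ctsX (fun x => f x + g x).
Proof. by move=> cf cg x; exact: (cvgD (cf x) (cg x)). Qed.

Lemma ctsXM f g : ctsX f -> ctsX g -> ctsX (fun x => f x * g x).
Proof. by move=> cf cg x; exact: (cvgM (cf x) (cg x)). Qed.

Lemma ctsXZ (c : R) f : ctsX f -> ctsX (fun x => c * f x).
Proof. by move=> cf; apply: ctsXM => //; exact: ctsX_cst. Qed.

Lemma ctsXN f : ctsX f -> ctsX (fun x => - f x).
Proof. by move=> cf x; exact: (cvgN (cf x)). Qed.

Lemma ctsXB f g : ctsX f -> ctsX g -> ctsX (fun x => f x - g x).
Proof. by move=> cf cg; apply: ctsXD => //; exact: ctsXN. Qed.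

Lemma ctsX_max f g : ctsX f -> ctsX g -> ctsX (fun x => Num.max (f x) (g x)).
Proof. by move=> cf cg x; exact: (continuous_max (cf x) (cg x)). Qed.

Lemma ctsX_min f g : ctsX f -> ctsX g -> ctsX (fun x => Num.min (f x) (g x)).
Proof. by move=> cf cg x; exact: (continuous_min (cf x) (cg x)). Qed.

Lemma ctsX_sum n (F : nat -> T -> R) : (forall k, ctsX (F k)) -> ctsX (fun x => \sum_(k < n) F k x).
Proof.
move=> cF; elim: n => [|n IH].
  by under eq_fun do rewrite big_ord0; exact: ctsX_cst.
by under eq_fun do rewrite big_ord_recr; exact: ctsXD.
Qed.

Lemma ctsX_near_gt f x (a : R) : ctsX f -> X x -> a < f x -> \forall y \near x, X y -> a < f y.
Proof.
move=> /subspace_continuousP cf Xx ax.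
have /(_ [set y | a < y]) := cf x Xx; apply.
by apply: open_nbhs_nbhs; split => //; exact: open_gt.
Qed.

Lemma ctsX_near_lt f x (a : R) : ctsX f -> X x -> f x < a -> \forall y \near x, X y -> f y < a.
Proof.
move=> /subspace_continuousP cf Xx ax.
have /(_ [set y | y < a]) := cf x Xx; apply.
by apply: open_nbhs_nbhs; split => //; exact: open_lt.
Qed.

(** If [Q X] failed, the sets whose complement in [X] satisfies [Q] would form a proper filter
    containing [X], and locality of [Q] at a cluster point is a contradiction. It stands for the
    choice of a finite subcover. *)
Lemma compact_ind (Q : set T -> Prop) : compact X -> Q set0 ->
  (forall A B, A `<=` B -> Q B -> Q A) -> (forall A B, Q A -> Q B -> Q (A `|` B)) ->
  (forall x, X x -> exists2 B, nbhs x B & Q (B `&` X)) -> Q X.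
Proof.
move=> cX Q0 Qm QU Ql; apply: contrapT => nQ.
pose F : set (set T) := [set B | Q (X `\` B)].
have FF : ProperFilter F.
  split; first by rewrite /F /= setD0.
  split; first by rewrite /F /= setDT.
    by move=> A B; rewrite /F /= setDIr; exact: QU.
  by move=> A B AB; apply: Qm; exact: setDS.
have FX : F X by rewrite /F /= setDv.
have [x [Xx clx]] := cX F FF FX.
have [B xB QB] := Ql x Xx.
have FB : F (~` B) by rewrite /F /= setDE setCK setIC.
by have [y [ny By]] := clx _ _ FB xB.
Qed.

Lemma dini (F : nat -> T -> R) f : compact X -> (forall n, ctsX (F n)) -> ctsX f ->
  (forall n x, X x -> F n x <= F n.+1 x) -> (forall x, X x -> exists n, f x < F n x) ->
  exists n, forall x, X x -> f x < F n x.
Proof.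
move=> cX cF cf mF hF.
have mono n k x : X x -> (n <= k)%N -> F n x <= F k x.
  by move=> Xx; apply: (homo_leq_le (f := F^~ x)) => i; exact: mF.
suff [n hn] : exists n, forall x, X x -> X x -> f x < F n x by exists n => x Xx; exact: hn.
apply: (@compact_ind (fun B => exists n, forall x, B x -> X x -> f x < F n x)) => //.
- by exists 0%N.
- by move=> A B AB [n hn]; exists n => x /AB; exact: hn.
- move=> A B [n hn] [k hk]; exists (maxn n k) => x [Ax|Bx] Xx.
    by apply: lt_le_trans (hn x Ax Xx) _; apply: mono => //; exact: leq_maxl.
  by apply: lt_le_trans (hk x Bx Xx) _; apply: mono => //; exact: leq_maxr.
- move=> x Xx; have [n hn] := hF x Xx.
  exists [set y | X y -> 0 < F n y - f y].
    by apply: (@ctsX_near_gt (fun y => F n y - f y)) => //; [exact: ctsXB|rewrite subr_gt0].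
  by exists n => y [h _] Xy; rewrite -subr_gt0; exact: h.
Qed.

End compact_set.

(** * The outer measure of a positive normalized functional *)

Section riesz.
Context {R : realType} {N : nat}.
Local Notation V := 'rV[R]_N.
Variables (X : set V) (l : (V -> R) -> R).
Hypothesis cptX : compact X.
Hypothesis lD : forall f g, ctsX X f -> ctsX X g -> l (fun x => f x + g x) = l f + l g.
Hypothesis lZ : forall c f, ctsX X f -> l (fun x => c * f x) = c * l f.
Hypothesis le_l : forall f g, ctsX X f -> ctsX X g -> (forall x, X x -> f x <= g x) -> l f <= l g.
Hypothesis l1 : l (fun=> 1) = 1.

Lemma l_cst c : l (fun=> c) = c.
Proof.
have := @lZ c _ (@ctsX_cst R V X 1); rewrite l1 mulr1 => h.
by rewrite -[RHS]h; congr l; apply/funext => x; rewrite mulr1.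
Qed.

Lemma lB f g : ctsX X f -> ctsX X g -> l (fun x => f x - g x) = l f - l g.
Proof.
move=> cf cg; rewrite -[l g]mul1r -mulNr -lZ // -lD //; last exact: ctsXZ.
by under [in RHS]eq_fun do rewrite mulN1r.
Qed.

Lemma l_sum n (F : nat -> V -> R) : (forall k, ctsX X (F k)) ->
  l (fun x => \sum_(k < n) F k x) = \sum_(k < n) l (F k).
Proof.
move=> cF; elim: n => [|n IH].
  by under eq_fun do rewrite big_ord0; rewrite big_ord0 l_cst.
under eq_fun do rewrite big_ord_recr.
by rewrite lD ?big_ord_recr ?IH //; exact: ctsX_sum.
Qed.

(* Using increasing sequences rather than series of positive functions, countable
   subadditivity needs no reindexing of double series. *)
Definition covered (A : set V) (c : R) := exists f : nat -> V -> R,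
  [/\ forall n, ctsX X (f n), forall n x, X x -> 0 <= f n x <= f n.+1 x,
      forall x (e : R), A x -> X x -> 0 < e -> exists n, 1 - e < f n x & forall n, l (f n) <= c].

Definition riesz_outer (A : set V) : \bar R := ereal_inf [set c%:E | c in covered A].
Local Notation om := riesz_outer.

Lemma covered_ge0 A c : covered A c -> 0 <= c.
Proof.
move=> [f [cf f0 _ fc]]; apply: le_trans (fc 0%N); rewrite -(l_cst 0).
by apply: le_l => // [|x Xx]; [exact: ctsX_cst|have /andP[] := f0 0%N x Xx].
Qed.

Lemma coveredS A B c : A `<=` B -> covered B c -> covered A c.
Proof. by move=> AB [f [cf f0 f1 fc]]; exists f; split => // x e /AB; exact: f1. Qed.

Lemma covered_le A c c' : c <= c' -> covered A c -> covered A c'.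
Proof. by move=> cc' [f [cf f0 f1 fc]]; exists f; split => // n; exact: le_trans cc'. Qed.

Lemma covered1 A : covered A 1.
Proof.
exists (fun _ _ => 1); split => [n|n x _|x e _ _ e0|n].
- exact: ctsX_cst.
- by rewrite ler01 lexx.
- by exists 0%N; rewrite ltrBlDr ltrDl.
- by rewrite l_cst.
Qed.

Lemma riesz_outer_le A c : covered A c -> (om A <= c%:E)%E.
Proof. by move=> h; apply: ereal_inf_lbound; exists c. Qed.

Lemma riesz_outer_lt A c : (om A < c%:E)%E -> covered A c.
Proof. by move=> /ereal_inf_lt[_ [d hd <-]]; rewrite lte_fin => /ltW dc; exact: covered_le hd. Qed.

Lemma riesz_outer_ge0 A : (0 <= om A)%E.
Proof. by apply/ereal_infP => _ [c hc <-]; rewrite lee_fin; exact: covered_ge0 hc. Qed.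

Lemma riesz_outer_le1 A : (om A <= 1)%E.
Proof. exact/riesz_outer_le/covered1. Qed.

Lemma riesz_outer_fin A : om A \is a fin_num.
Proof. by rewrite ge0_fin_numE ?riesz_outer_ge0 // (le_lt_trans (riesz_outer_le1 A)) // ltry. Qed.

Lemma le_riesz_outer : {homo om : A B / A `<=` B >-> (A <= B)%E}.
Proof.
move=> A B AB; apply/ereal_infP => _ [c hc <-].
by apply: riesz_outer_le; exact: coveredS hc.
Qed.

Lemma riesz_outer0 : om set0 = 0%E.
Proof.
apply/eqP; rewrite eq_le riesz_outer_ge0 andbT; apply: riesz_outer_le.
exists (fun _ _ => 0); split => // [n|n x _|n]; [exact: ctsX_cst|by rewrite lexx|by rewrite l_cst].
Qed.

Lemma sum_geom_half (e : R) n : \sum_(k < n) e / 2 ^+ k.+1 = e - e / 2 ^+ n.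
Proof.
elim: n => [|n IH]; first by rewrite big_ord0 expr0 divr1 subrr.
rewrite big_ord_recr IH /= exprS; field; by rewrite expf_eq0 pnatr_eq0 andbF.
Qed.

Lemma riesz_outer_sigma_subadditive : sigma_subadditive om.
Proof.
move=> F; set S := (\sum_(n <oo) om (F n))%E.
have part n : (\sum_(k < n) om (F k) <= S)%E.
  rewrite -(big_mkord xpredT (fun k => om (F k))).
  by apply: nneseries_lim_ge => k _ _; exact: riesz_outer_ge0.
have S0 : (0 <= S)%E by have := part 0%N; rewrite big_ord0.
have [Sfin|] := boolP (S \is a fin_num); last first.
  by rewrite ge0_fin_numE // -leNgt leye_eq => /eqP ->; rewrite leey.
apply/lee_addgt0Pr => e e0; rewrite -(fineK Sfin) -EFinD; apply: riesz_outer_le.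
pose r k := fine (om (F k)).
have omr k : om (F k) = (r k)%:E by rewrite /r fineK // riesz_outer_fin.
have H k : covered (F k) (r k + e / 2 ^+ k.+1).
  by apply: riesz_outer_lt; rewrite omr lte_fin ltrDl divr_gt0 // exprn_gt0.
have /choice[f hf] : forall k, exists f : nat -> V -> R,
  [/\ forall n, ctsX X (f n), forall n x, X x -> 0 <= f n x <= f n.+1 x,
      forall x (e : R), F k x -> X x -> 0 < e -> exists n, 1 - e < f n x &
      forall n, l (f n) <= r k + e / 2 ^+ k.+1] by move=> k; exact: H.
have cf k n : ctsX X (f k n) by have [h _ _ _] := hf k; exact: h.
have f0 k n x : X x -> 0 <= f k n x by have [_ h _ _] := hf k => /(h n) /andP[].
have fS k n x : X x -> f k n x <= f k n.+1 x by have [_ h _ _] := hf k => /(h n) /andP[].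
have mono k n n' x : X x -> (n <= n')%N -> f k n x <= f k n' x.
  by move=> Xx; apply: (homo_leq_le (f := (f k)^~ x)) => i; exact: fS.
(* Both the number of terms and each term increase with [n], so this diagonal sequence is increasing
   and covers the whole union. *)
exists (fun n x => \sum_(k < n.+1) f k n x); split => [n|n x Xx|x d [k _ Fkx] Xx d0|n].
- by apply: (@ctsX_sum R V X n.+1 (fun k => f k n)).
- rewrite sumr_ge0 /=; last by move=> k _; exact: f0.
  rewrite [leRHS]big_ord_recr /= ler_wpDr ?f0 //.
  by apply: ler_sum => k _; exact: fS.
- have [_ _ /(_ x d Fkx Xx d0)[n hn] _] := hf k.
  exists (maxn n k); apply: lt_le_trans hn _.
  have kn : (k < (maxn n k).+1)%N by rewrite ltnS leq_maxr.
  rewrite (bigD1 (Ordinal kn)) //= ler_wpDr ?sumr_ge0 //; first by move=> i _; exact: f0.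
  by apply: mono => //; exact: leq_maxl.
- rewrite (@l_sum n.+1 (fun k => f k n)) //.
  apply: (@le_trans _ _ (\sum_(k < n.+1) (r k + e / 2 ^+ k.+1))).
    by apply: ler_sum => k _; have [_ _ _ h] := hf k; exact: h.
  rewrite big_split /= sum_geom_half; apply: lerD.
    rewrite -lee_fin fineK // (le_trans _ (part n.+1)) // -sumEFin.
    by apply: lee_sum => k _; rewrite -omr.
  by rewrite gerBl divr_ge0 ?exprn_ge0 // ltW.
Qed.

HB.instance Definition _ := isOuterMeasure.Build R V om
  riesz_outer0 riesz_outer_ge0 le_riesz_outer riesz_outer_sigma_subadditive.

(** By Dini's argument a sequence covering [A] eventually exceeds [f - e] on all of [X], so its
    bound is at least [l f - e]. All lower bounds for the outer measure come from here. *)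
Lemma le_l_riesz_outer A f : ctsX X f -> (forall x, X x -> f x <= 1) ->
  (forall x, X x -> ~ A x -> f x <= 0) -> ((l f)%:E <= om A)%E.
Proof.
move=> cf f1 f0; apply/ereal_infP => _ [c [F [cF F0 F1 Fc]] <-]; rewrite lee_fin.
apply/ler_addgt0Pr => e e0.
have [n hn] : exists n, forall x, X x -> f x - e < F n x.
  apply: dini => //; first by apply: ctsXB => //; exact: ctsX_cst.
    by move=> n x /(F0 n)/andP[].
  move=> x Xx; have [Ax|nAx] := pselect (A x).
    have [n hn] := F1 x e Ax Xx e0; exists n; apply: le_lt_trans hn.
    by rewrite lerD2r f1.
  exists 0%N; have /andP[h _] := F0 0%N x Xx; apply: lt_le_trans h.
  by rewrite subr_lt0 (le_lt_trans (f0 x Xx nAx)).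
have : l (fun x => f x - e) <= l (F n).
  by apply: le_l => [||x /hn/ltW] //; apply: ctsXB => //; exact: ctsX_cst.
rewrite lB ?l_cst //; last exact: ctsX_cst.
by rewrite lerBlDr => /le_trans; apply; rewrite lerD2r.
Qed.

(** The functions [h k] increase to the indicator of [U] and split a cover [f n] of [A] into
    [f n * h n], which covers the part in [U], and [f n * (1 - h k)] with [k] fixed, which covers
    the rest. *)
Lemma covered_caratheodory (g : V -> R) : continuous g -> om.-caratheodory [set x | 0 < g x].
Proof.
move=> cg; apply: le_caratheodory_measurable => A; set U := [set x | _].
apply/ereal_infP => _ [c [f [cf f0 f1 fc]] <-].
pose h k (x : V) := Num.min 1 (k%:R * Num.max (g x) 0).
have ch k : ctsX X (h k).
  apply: ctsX_min; first exact: ctsX_cst.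
  apply: ctsXZ; apply: ctsX_max; last exact: ctsX_cst.
  exact: continuous_subspaceT.
have gp x : 0 <= Num.max (g x) 0 by rewrite le_max lexx orbT.
have h0 k x : 0 <= h k x by rewrite /h le_min ler01 mulr_ge0.
have h1 k x : h k x <= 1 by rewrite /h ge_min lexx.
have hm k n x : (k <= n)%N -> h k x <= h n x.
  by move=> kn; rewrite /h le_min !ge_min lexx /= ler_wpM2r ?orbT // ler_nat.
have hU x : U x -> exists k, h k x = 1.
  move=> gx; have gx' : 0 < g x by [].
  exists (Num.truncn (g x)^-1).+1; rewrite /h (max_l (ltW gx')); apply/min_idPl.
  by rewrite -ler_pdivrMr // mul1r ltW // truncnS_gt.
have hnU x k : ~ U x -> h k x = 0.
  move=> /negP; rewrite -leNgt => gx; rewrite /h (max_r gx) mulr0.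
  by apply/min_idPr.
have fge0 n x : X x -> 0 <= f n x by move=> /(f0 n)/andP[].
have fS n x : X x -> f n x <= f n.+1 x by move=> /(f0 n)/andP[].
have fm k n x : X x -> (k <= n)%N -> f k x <= f n x.
  by move=> Xx; apply: (homo_leq_le (f := f^~ x)) => i; exact: fS.
have cfh n k : ctsX X (fun x => f n x * h k x) by exact: ctsXM.
pose S := [set l (fun x => f n x * h n x) | n in setT].
have ubS : ubound S c.
  move=> _ [n _ <-]; apply: le_trans (fc n); apply: le_l => // x Xx.
  by rewrite ler_piMr // fge0.
have hS' : has_sup S.
  by split; [exists (l (fun x => f 0%N x * h 0%N x)); exists 0%N|exists c].
have c1 : covered (A `&` U) (sup S).
  exists (fun n x => f n x * h n x); split => // [n x Xx|x e [Ax Ux] Xx e0|n].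
  - by rewrite mulr_ge0 ?fge0 //= ler_pM ?fge0 ?fS ?hm.
  - have [n hn] := f1 x e Ax Xx e0; have [k hk] := hU x Ux.
    exists (maxn n k); apply: lt_le_trans hn _.
    have -> : h (maxn n k) x = 1.
      by apply/eqP; rewrite eq_le h1 -hk hm // leq_maxr.
    by rewrite mulr1 fm // leq_maxl.
  - by apply: sup_upper_bound => //; exists n.
apply: (@le_trans _ _ ((sup S)%:E + om (A `&` ~` U))%E).
  by apply: leeD => //; exact: riesz_outer_le.
apply/lee_addgt0Pr => e e0; rewrite -(fineK (riesz_outer_fin (A `&` ~` U))) -!EFinD lee_fin.
rewrite addrC -lerBrDr -lee_fin fineK ?riesz_outer_fin //; apply: riesz_outer_le.
(* For [k] nearly attaining the supremum, the second part is bounded by [c - sup S + e]. *)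
have [_ [k _ <-] hk] := sup_adherent e0 hS'.
have cf1 n : ctsX X (fun x => f n x * (1 - h k x)).
  by apply: ctsXM => //; apply: ctsXB => //; exact: ctsX_cst.
exists (fun n x => f n x * (1 - h k x)); split => // [n x Xx|x d [Ax Ux] Xx d0|n].
- by rewrite mulr_ge0 ?fge0 ?subr_ge0 //= ler_wpM2r ?subr_ge0 // fS.
- by have [n hn] := f1 x d Ax Xx d0; exists n; rewrite hnU // subr0 mulr1.
- apply: (@le_trans _ _ (l (fun x => f (maxn n k) x * (1 - h k x)))).
    by apply: le_l => // x Xx; rewrite ler_wpM2r ?subr_ge0 // fm // leq_maxl.
  have -> : (fun x => f (maxn n k) x * (1 - h k x)) =
      (fun x => f (maxn n k) x - f (maxn n k) x * h k x).
    by apply/funext => x; rewrite mulrBr mulr1.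
  rewrite lB //.
  have : l (fun x => f k x * h k x) <= l (fun x => f (maxn n k) x * h k x).
    by apply: le_l => // x Xx; rewrite ler_wpM2r // fm // leq_maxr.
  move: (fc (maxn n k)) hk; lra.
Qed.

Lemma riesz_measurable (A : set V) : measurable (A : set (borel R N)) -> om.-caratheodory A.
Proof.
rewrite borel_oboxes; move: A; apply: smallest_sub.
  split; first exact: caratheodory_measurable_set0.
    by move=> A mA; rewrite setTD; exact: caratheodory_measurable_setC.
  by move=> F mF; exact: caratheodory_measurable_bigcup.
move=> _ [a [b ->]].
rewrite (_ : obox a b = \big[setI/setT]_(i < N)
   ([set x : V | 0 < x ord0 i - a i] `&` [set x : V | 0 < b i - x ord0 i])); last first.
  apply/seteqP; split=> v; rewrite -bigcap_seq => h i /=.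
    by move=> _; have := h i; rewrite in_itv /= => /andP[? ?]; split; rewrite subr_gt0.
  have [] := h i (mem_index_enum _); rewrite in_itv /= !subr_gt0 => -> ->.
  by [].
apply: big_ind => [|A B|i _].
- rewrite -setC0; apply: caratheodory_measurable_setC; exact: caratheodory_measurable_set0.
- exact: caratheodory_measurable_setI.
- have ci := @coord_continuous R 1 N ord0 i.
  apply: caratheodory_measurable_setI; apply: covered_caratheodory => x.
    exact: (cvgD (ci x) (cvg_cst (- a i))).
  exact: (cvgB (cvg_cst (b i)) (ci x)).
Qed.

(** The outer measure retyped on the Borel sigma-algebra, where it is additive by [riesz_measurable]
    and can carry a measure structure. *)
Definition riesz_measure : set (borel R N) -> \bar R := om.
Local Notation nu := riesz_measure.

Let riesz_measure_sigma_additive : semi_sigma_additive nu.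
Proof.
move=> F mF tF mUF.
exact: (@caratheodory_measure_sigma_additive R V om F
  (fun i => riesz_measurable (mF i)) tF (riesz_measurable mUF)).
Qed.

HB.instance Definition _ := isMeasure.Build _ _ _ nu
  riesz_outer0 riesz_outer_ge0 riesz_measure_sigma_additive.

Lemma riesz_measure_full A : X `<=` A -> nu A = 1%E.
Proof.
move=> XA; apply/eqP; rewrite eq_le [X in X && _]riesz_outer_le1 /= -[X in (X <= _)%E](congr1 EFin l1).
by apply: le_l_riesz_outer => // [|x /XA//]; exact: ctsX_cst.
Qed.

HB.instance Definition _ := Measure_isProbability.Build _ _ _ nu (@riesz_measure_full setT (@subsetT _ X)).

Let clX : closed X.
Proof. exact: compact_rV_closed. Qed.

Let mX : measurable (X : set (borel R N)).
Proof. exact: closed_borel. Qed.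

Lemma open_rel (P : V -> Prop) : (forall x, X x -> P x -> \forall y \near x, X y -> P y) ->
  open [set x | X x -> P x].
Proof.
move=> h; rewrite openE => x /= Px; have [Xx|nXx] := pselect (X x).
  exact: h (Px Xx).
have : nbhs x (~` X) by apply: open_nbhs_nbhs; split => //; exact: closed_openC.
by apply: filterS => y nXy /nXy.
Qed.

Lemma riesz_outer_open A (e : R) : 0 < e ->
  exists2 W : set V, open W /\ A `<=` W & (om W <= om A + e%:E)%E.
Proof.
move=> e0; pose r := fine (om A); have omr : om A = r%:E by rewrite fineK // riesz_outer_fin.
have r0 : 0 <= r by rewrite -lee_fin -omr riesz_outer_ge0.
pose c := r + e / 2; have c0 : 0 < c by rewrite ltr_wpDl // divr_gt0.
have [f [cf f0 f1 fc]] : covered A c by apply: riesz_outer_lt; rewrite omr lte_fin ltrDl divr_gt0.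
have c1 : 0 < c + e / 2 by rewrite addr_gt0 // divr_gt0.
(* Dividing the cover by this [s] raises its bound from [c] to [c + e / 2], which is [r + e]. *)
pose s := c / (c + e / 2); have s0 : 0 < s by rewrite divr_gt0.
have s1 : s < 1 by rewrite ltr_pdivrMr // mul1r ltrDl divr_gt0.
(* Points outside [X] are included to make the set open in the whole space; covers are tested on [X]
   only. *)
exists [set x | X x -> exists n, s < f n x].
  split.
    apply: open_rel => x Xx [n hn].
    by apply: filterS (ctsX_near_gt (cf n) Xx hn) => y h Xy; exists n; exact: h.
  move=> x Ax Xx; have [n hn] := f1 x (1 - s) Ax Xx ltac:(by rewrite subr_gt0).
  by exists n; move: hn; rewrite opprB addrC subrK.
rewrite omr -EFinD; apply: riesz_outer_le.
exists (fun n x => s^-1 * f n x); split => [n|n x Xx|x d hx Xx d0|n].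
- exact: ctsXZ.
- have /andP[h1 h2] := f0 n x Xx; have si : 0 <= s^-1 by rewrite invr_ge0 ltW.
  by rewrite mulr_ge0 //= ler_wpM2l.
- have [n hn] := hx Xx; exists n; apply: (@lt_trans _ _ 1); first by rewrite ltrBlDr ltrDl.
  by rewrite mulrC ltr_pdivlMr // mul1r.
- rewrite lZ // mulrC ler_pdivrMr // (le_trans (fc n)) //.
  rewrite /s mulrCA (_ : r + e = c + e / 2); last by rewrite /c -addrA -splitr.
  by rewrite divff ?gt_eqF // mulr1.
Qed.

Lemma riesz_measure_outer_regular (A : set V) :
  nu A = ereal_inf [set nu W | W in [set W : set V | open W /\ A `<=` W]].
Proof.
apply/eqP; rewrite eq_le; apply/andP; split.
  by apply/ereal_infP => _ [W [_ AW] <-]; exact: le_riesz_outer.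
apply/lee_addgt0Pr => e e0; have [W hW hAW] := riesz_outer_open A e0.
by apply: le_trans hAW; apply: ereal_inf_lbound; exists W.
Qed.

(** By outer regularity of the complement: if [W] is a nearly optimal open set around it, the
    compact set of points of [X] outside [W] fills [A] up to [e], since [X] has full mass. *)
Lemma riesz_measure_inner_regular (A : set (borel R N)) : measurable A ->
  nu A = ereal_sup [set nu K | K in [set K : set V | compact K /\ K `<=` A]].
Proof.
move=> mA; apply/eqP; rewrite eq_le; apply/andP; split; last first.
  by apply/ereal_supP => _ [K [_ KA] <-]; exact: le_riesz_outer.
apply/lee_addgt0Pr => e e0; have [W [oW AW] hAW] := riesz_outer_open (~` A) e0.
have mW : measurable (W : set (borel R N)) by exact: open_borel.
pose K := X `\` W.
have mK : measurable (K : set (borel R N)) by exact: measurableD.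
have KA : K `<=` A by move=> x [_ nWx]; apply: contrapT => nAx; apply: nWx; exact: AW.
have cK : compact K.
  apply: subclosed_compact cptX _; last by move=> x [].
  by rewrite /K setDE; apply: closedI => //; exact: open_closedC.
apply: (@le_trans _ _ (nu K + e%:E)%E); last first.
  by rewrite leeD2r //; apply: ereal_sup_ubound; exists K.
have h1 : (1 <= nu K + nu W)%E.
  rewrite -(@riesz_measure_full (K `|` W)); last first.
    by move=> x Xx; have [|] := pselect (W x); [right|left].
  exact: (@measureU2 _ _ _ nu _ _ mK mW).
have h2 : nu (~` A) = (1 - nu A)%E by exact: (@probability_setC _ _ _ nu).
have fin B : nu B \is a fin_num by exact: riesz_outer_fin.
move: h1 hAW; rewrite [om (~` A)]h2 -[om W]/(nu W).
rewrite -(fineK (fin K)) -(fineK (fin W)) -(fineK (fin A)) -!EFinB -!EFinD !lee_fin.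
by lra.
Qed.

Lemma ctsX_measurable (f : V -> R) : ctsX X f ->
  measurable_fun (X : set (borel R N)) (f : borel R N -> measurableTypeR R).
Proof.
move=> cf; apply: (measurability _ (RGenOpens.measurableE R)) => _ [_ [a [b ->]] <-].
rewrite (_ : _ `&` _ = X `&` [set x | X x -> a < f x < b]); last first.
  apply/seteqP; split=> x [Xx] /=; rewrite in_itv /=; first by split.
  by move=> /(_ Xx).
apply: measurableI => //; apply: open_borel; apply: open_rel => x Xx /andP[h1 h2].
apply: filterS2 (ctsX_near_gt cf Xx h1) (ctsX_near_lt cf Xx h2) => y k1 k2 Xy.
by rewrite k1 ?k2.
Qed.

Lemma ctsX_bounded (f : V -> R) : ctsX X f -> exists2 M : R, 0 < M & forall x, X x -> `|f x| <= M.
Proof.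
move=> cf; have /compact_bounded[M [_ hM]] := continuous_compact cf cptX.
exists (`|M| + 1) => [|x Xx]; first by rewrite ltr_wpDl.
by apply: (hM (`|M| + 1)); [rewrite (le_lt_trans (ler_norm M)) // ltrDl|exists x].
Qed.

Lemma ctsX_integrable (mu : {finite_measure set (borel R N) -> \bar R}) f :
  ctsX X f -> mu.-integrable X (EFin \o f).
Proof.
move=> cf; have [M M0 hM] := ctsX_bounded cf.
apply: measurable_bounded_integrable => //.
- by rewrite -ge0_fin_numE // fin_num_measure.
- exact: ctsX_measurable.
- by exists M; split; [exact: num_real|move=> y My x Xx; apply: le_trans (ltW My); exact: hM].
Qed.

Local Notation I f := (\int[nu]_(x in X) f x).

Let ID f g : ctsX X f -> ctsX X g -> I (fun x => f x + g x) = I f + I g.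
Proof. by move=> cf cg; apply: RintegralD => //; exact: ctsX_integrable. Qed.

Let IZ c f : ctsX X f -> I (fun x => c * f x) = c * I f.
Proof. by move=> cf; apply: RintegralZl => //; exact: ctsX_integrable. Qed.

Let I_cst c : I (fun=> c) = c.
Proof. by rewrite Rintegral_cst // [_ X]riesz_measure_full //= mulr1. Qed.

Let I_sum n (F : nat -> V -> R) : (forall k, ctsX X (F k)) ->
  I (fun x => \sum_(k < n) F k x) = \sum_(k < n) I (F k).
Proof.
move=> cF; elim: n => [|n IH].
  by under eq_fun do rewrite big_ord0; rewrite big_ord0 I_cst.
under eq_fun do rewrite big_ord_recr.
by rewrite ID ?big_ord_recr ?IH //; exact: ctsX_sum.
Qed.

(* [f] is cut into the layers [min f (t + h) - min f t], each of which is squeezed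
   between the indicators of [t + h < f] and [t < f] times [h]. *)
Lemma riesz_layer f (t h : R) : ctsX X f -> 0 < h ->
  l (fun x => Num.min (f x) (t + h) - Num.min (f x) t) <= h * fine (nu [set x | X x /\ t < f x]) /\
  h * fine (nu [set x | X x /\ t + h < f x]) <=
    I (fun x => Num.min (f x) (t + h) - Num.min (f x) t).
Proof.
move=> cf h0; set g := fun x => _; have fin B : nu B \is a fin_num by exact: riesz_outer_fin.
have cg : ctsX X g by apply: ctsXB; apply: ctsX_min => //; exact: ctsX_cst.
have gh x : g x <= h by rewrite /g /Num.min; case: ltP => ?; case: ltP => ?; lra.
have g0 x : 0 <= g x by rewrite /g /Num.min; case: ltP => ?; case: ltP => ?; lra.
split.
  rewrite mulrC -ler_pdivrMr // mulrC -lZ // -lee_fin fineK //.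
  apply: le_l_riesz_outer => [|x _|x Xx nt]; first exact: ctsXZ.
    by rewrite mulrC ler_pdivrMr // mul1r.
  have : f x <= t by rewrite leNgt; apply/negP => tx; apply: nt.
  by move=> ft; rewrite /g !min_l ?subrr ?mulr0 // (le_trans ft) // lerDl ltW.
set A := [set x | _].
have mA : measurable (A : set (borel R N)).
  rewrite (_ : A = X `&` [set x | X x -> t + h < f x]); last first.
    by apply/seteqP; split=> x [Xx] /=; [split|move=> /(_ Xx)].
  apply: measurableI => //; apply: open_borel; apply: open_rel => x Xx h1.
  by apply: filterS (ctsX_near_gt cf Xx h1) => y k Xy; exact: k.
have AX : A `<=` X by move=> x [].
have mg := ctsX_measurable cg.
rewrite -lee_fin /Rintegral fineK; last by apply: integrable_fin_num => //; exact: ctsX_integrable.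
rewrite EFinM fineK // -(@integral_cst _ _ _ nu A mA h%:E).
apply: (@le_trans _ _ (\int[nu]_(x in A) (g x)%:E)%E).
  apply: ge0_le_integral => //.
  - by move=> x _; rewrite lee_fin ltW.
  - by apply/measurable_EFinP; exact: measurable_funS mg.
  - move=> x [_ hx]; rewrite lee_fin /g min_r ?(ltW hx) // min_r; first by rewrite addrC addKr.
    by rewrite ltW // (le_lt_trans _ hx) // lerDl ltW.
apply: ge0_subset_integral => //; first exact/measurable_EFinP.
by move=> x _; rewrite lee_fin.
Qed.

Lemma le_riesz_unit f : ctsX X f -> (forall x, X x -> 0 <= f x <= 1) -> l f <= I f.
Proof.
move=> cf f01; apply/ler_addgt0Pr => e e0.
pose k := Num.truncn e^-1; pose h := k.+1%:R^-1 : R.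
have h0 : 0 < h by rewrite invr_gt0 ltr0n.
have he : h <= e.
  by rewrite -[e]invrK lef_pV2 ?posrE ?invr_gt0 ?ltr0n // ltW // truncnS_gt.
pose g i x := Num.min (f x) (i%:R * h + h) - Num.min (f x) (i%:R * h).
have cg i : ctsX X (g i) by apply: ctsXB; apply: ctsX_min => //; exact: ctsX_cst.
have fg x : X x -> f x = \sum_(i < k.+1) g i x.
  move=> Xx; have /andP[fx0 fx1] := f01 x Xx.
  rewrite -(big_mkord xpredT (fun i => g i x)).
  rewrite (eq_big_nat _ _ (F2 := fun i => Num.min (f x) (i.+1%:R * h) - Num.min (f x) (i%:R * h))).
    rewrite telescope_sumr // mul0r mulfV ?pnatr_eq0 //.
    by rewrite (min_l fx1) (min_r fx0) subr0.
  by move=> i _; rewrite /g -[in RHS]natr1 mulrDl mul1r.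
have csum : ctsX X (fun x => \sum_(i < k.+1) g i x) by exact: ctsX_sum.
have lE : l f <= \sum_(i < k.+1) l (g i).
  by rewrite -l_sum //; apply: le_l => // x Xx; rewrite -fg.
have IE : I f = \sum_(i < k.+1) I (g i).
  by rewrite -I_sum //; apply: eq_Rintegral => x; rewrite inE => Xx; rewrite fg.
pose a (i : nat) := fine (nu [set x | X x /\ i%:R * h < f x]).
have H i := riesz_layer (i%:R * h) cf h0.
apply: (le_trans lE); apply: (@le_trans _ _ (\sum_(i < k.+1) h * a i)).
  by apply: ler_sum => i _; have [] := H i.
(* The upper bounds use the levels 0 to [k], the lower bounds the levels 1 to [k.+1]. The unmatched
   level 0 costs at most [h <= e]; the last layer is dropped as nonnegative. *)
rewrite IE big_ord_recl big_ord_recr /= [leRHS]addrC.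
apply: lerD.
  apply: (le_trans _ he); apply: (@le_trans _ _ (h * 1)); last by rewrite mulr1.
  rewrite ler_pM2l // -lee_fin fineK ?riesz_outer_fin //; exact: riesz_outer_le1.
apply: ler_wpDr.
  rewrite /Rintegral; apply: fine_ge0; apply: integral_ge0 => x _.
  by rewrite lee_fin /g /Num.min; case: ltP => ?; case: ltP => ?; lra.
apply: ler_sum => i _; have [_] := H i.
by rewrite /a /bump /= add1n -[i.+1%:R]natr1 mulrDl mul1r.
Qed.

(** An affine change of [f] brings its values into the unit interval. One inequality for all [f] is
    enough, as [- f] gives the other. *)
Lemma le_riesz f : ctsX X f -> l f <= I f.
Proof.
move=> cf; have [M M0 hM] := ctsX_bounded cf.
have M2 : 0 < 2 * M by rewrite mulr_gt0.
pose c := (2 * M)^-1; have c0 : 0 < c by rewrite invr_gt0.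
have cc := @ctsX_cst R V X.
have cf' : ctsX X (fun x => f x + M) by exact: ctsXD.
have : l (fun x => c * (f x + M)) <= I (fun x => c * (f x + M)).
  apply: le_riesz_unit => [|x Xx]; first exact: ctsXZ.
  have := hM x Xx; rewrite ler_norml => /andP[h1 h2].
  rewrite mulr_ge0 ?(ltW c0) //=; last by rewrite -lerBlDr sub0r.
  by rewrite mulrC ler_pdivrMr // mul1r; lra.
by rewrite lZ // IZ // lD // ID // l_cst I_cst ler_pM2l // lerD2r.
Qed.

Lemma riesz_integral f : ctsX X f -> (\int[nu]_(x in X) (f x)%:E = (l f)%:E)%E.
Proof.
move=> cf; have -> : l f = I f.
  apply/eqP; rewrite eq_le le_riesz //= -lerN2.
  have := le_riesz (ctsXN cf).
  rewrite (_ : (fun x => - f x) = fun x => -1 * f x); last by apply/funext => x; rewrite mulN1r.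
  by rewrite lZ // IZ // !mulN1r.
by rewrite /Rintegral fineK //; apply: integrable_fin_num => //; exact: ctsX_integrable.
Qed.

Theorem riesz_representation : exists mu : probability (borel R N) R,
  [/\ forall A : set (borel R N), measurable A ->
     mu A = ereal_inf [set mu W | W in [set W : set V | open W /\ A `<=` W]] /\
     mu A = ereal_sup [set mu K | K in [set K : set V | compact K /\ K `<=` A]],
   mu X = 1%E &
   forall f, {within X, continuous f} -> (\int[mu]_(x in X) (f x)%:E = (l f)%:E)%E].
Proof.
exists nu; split => // [A mA||f]; last exact: riesz_integral.
  by split; [exact: riesz_measure_outer_regular|exact: riesz_measure_inner_regular].
exact: riesz_measure_full.
Qed.

End riesz.
(** * Jensen measures and approximation *)

Section hahn_banach.
Context {R : realType} {E : lmodType R}.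
Variables (C : set E) (q : E -> R).
Hypothesis CD : forall f g, C f -> C g -> C (f + g).
Hypothesis CZ : forall a f, C f -> C (a *: f).

(** Everything is relative to [C] because functions continuous on [X] are represented by functions
    on the whole space. The inequality for [a] together with the one for [a^-1] is positive
    homogeneity. *)
Definition sublinear_on (p : E -> R) :=
  (forall f g, C f -> C g -> p (f + g) <= p f + p g) /\
  (forall a f, C f -> 0 < a -> p (a *: f) <= a * p f).

Hypothesis qsub : sublinear_on q.

Let CN f : C f -> C (- f).
Proof. by rewrite -scaleN1r; exact: CZ. Qed.

Lemma sublinear_on0 p f : C f -> sublinear_on p -> p 0 = 0.
Proof.
move=> Cf [_ pZ]; have C0 : C 0 by rewrite -(scale0r f); exact: CZ.
have h1 := pZ 2 0 C0 ltac:(by []); have h2 := pZ 2^-1 0 C0 ltac:(by rewrite invr_gt0).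
by move: h1 h2; rewrite !scaler0; lra.
Qed.

Lemma sublinear_on_ge p f : C f -> sublinear_on p -> (forall f, C f -> p f <= q f) -> - q (- f) <= p f.
Proof.
move=> Cf sp pq; have := (proj1 sp) f (- f) Cf (CN Cf).
rewrite subrr (sublinear_on0 Cf sp) => h.
by have := pq _ (CN Cf); lra.
Qed.

Let T := {p : E -> R | sublinear_on p /\ forall f, C f -> p f <= q f}.
(** The pointwise order is reversed, so that a maximal element is a minimal functional. *)
Let ord (s t : T) : bool := `[< forall f, C f -> sval t f <= sval s f >].

(** The infimum over a chain is subadditive because the smaller of two members can be used for both
    arguments; the bound [- q (- f)] keeps it finite. *)
Lemma sublinear_chain (A : set T) : (exists p, A p) -> total_on A ord ->
  exists t : T, forall s, A s -> ord s t.
Proof.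
move=> [p0 Ap0] tot; pose S f := [set sval p f | p in A].
have lb f : C f -> has_lbound (S f).
  by move=> Cf; exists (- q (- f)) => _ [p _ <-]; have [sp pq] := svalP p; exact: sublinear_on_ge.
have ne f : S f !=set0 by exists (sval p0 f); exists p0.
have le p f : A p -> C f -> inf (S f) <= sval p f by move=> Ap Cf; apply: (ge_inf (lb f Cf)); exists p.
have hp : sublinear_on (fun f => inf (S f)) /\ forall f, C f -> inf (S f) <= q f.
  split; last by move=> f Cf; apply: (le_trans (le p0 f Ap0 Cf)); have [_] := svalP p0; exact.
  split=> [f g Cf Cg|a f Cf a0].
    rewrite -lerBlDr; apply: lb_le_inf => // _ [p1 A1 <-].
    rewrite lerBlDr [leRHS]addrC -lerBlDr; apply: lb_le_inf => // _ [p2 A2 <-]; rewrite lerBlDr.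
    have Cfg := CD Cf Cg; have [/asboolP h|/asboolP h] := tot p1 p2 A1 A2.
      apply: (le_trans (le p2 _ A2 Cfg)); have [[sp _] _] := svalP p2.
      by apply: (le_trans (sp f g Cf Cg)); rewrite addrC lerD2l h.
    apply: (le_trans (le p1 _ A1 Cfg)); have [[sp _] _] := svalP p1.
    by apply: (le_trans (sp f g Cf Cg)); rewrite addrC lerD2r h.
  rewrite mulrC -ler_pdivrMr //; apply: lb_le_inf => // _ [p Ap <-].
  rewrite ler_pdivrMr // mulrC; apply: (le_trans (le p _ Ap (CZ a Cf))).
  by have [[_ sp] _] := svalP p; exact: sp.
pose t : T := exist _ (fun f => inf (S f)) hp.
by exists t => s As; apply/asboolP => f Cf; exact: le.
Qed.

(* A minimal sublinear functional [p] is linear: for each [g] the functional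
   [f |-> inf_(t >= 0) p (f + t g) - t p g] is sublinear and below [p]. *)
Theorem hahn_banach : exists l : E -> R,
  [/\ forall f g, C f -> C g -> l (f + g) = l f + l g,
      forall a f, C f -> l (a *: f) = a * l f &
      forall f, C f -> l f <= q f].
Proof.
have tq : sublinear_on q /\ forall f, C f -> q f <= q f by [].
have [|||[p [sp pq]] max] := @ZL_preorder T (exist _ q tq) ord.
- by move=> t; exact/asboolP.
- by move=> r s t /asboolP h1 /asboolP h2; apply/asboolP => f Cf; exact: le_trans (h2 f Cf) (h1 f Cf).
- move=> A tot; have [/sublinear_chain|nA] := pselect (exists p, A p); first exact.
  by exists (exist _ q tq) => s As; case: nA; exists s.
have [pD pZ] := sp.
have add f g : C f -> C g -> p (f + g) = p f + p g.
  move=> Cf Cg; apply/eqP; rewrite eq_le pD //=.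
  pose S f := [set p (f + t *: g) - t * p g | t in [set t | 0 <= t]].
  have CS f1 t : C f1 -> C (f1 + t *: g) by move=> C1; apply: CD => //; exact: CZ.
  have tg t : 0 <= t -> t * p g <= p (t *: g).
    rewrite le_eqVlt => /predU1P[<-|t0].
      by rewrite scale0r mul0r (sublinear_on0 Cf sp).
    have := pZ t^-1 (t *: g) (CZ t Cg); rewrite invr_gt0 => /(_ t0).
    by rewrite scalerA mulVf ?gt_eqF // scale1r mulrC ler_pdivlMr // mulrC.
  have lb f1 : C f1 -> has_lbound (S f1).
    move=> C1; exists (- p (- f1)) => _ [t t0 <-].
    have := pD (f1 + t *: g) (- f1) (CS f1 t C1) (CN C1).
    rewrite addrAC subrr add0r => h; have := tg t t0; move: h; lra.
  have ne f1 : S f1 !=set0 by exists (p (f1 + 0 *: g) - 0 * p g); exists 0 => //=.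
  have le f1 t : C f1 -> 0 <= t -> inf (S f1) <= p (f1 + t *: g) - t * p g.
    by move=> C1 t0; apply: (ge_inf (lb f1 C1)); exists t.
  have le0 f1 : C f1 -> inf (S f1) <= p f1.
    by move=> C1; apply: (le_trans (le f1 0 C1 (lexx 0))); rewrite scale0r mul0r addr0 subr0.
  have hs : sublinear_on (fun f => inf (S f)) /\ forall f, C f -> inf (S f) <= q f.
    split; last by move=> f1 C1; exact: le_trans (le0 f1 C1) (pq f1 C1).
    split=> [f1 f2 C1 C2|a f1 C1 a0].
      rewrite -lerBlDr; apply: lb_le_inf => // _ [t t0 <-].
      rewrite lerBlDr [leRHS]addrC -lerBlDr; apply: lb_le_inf => // _ [s s0 <-]; rewrite lerBlDr.
      apply: (le_trans (le (f1 + f2) (t + s) (CD C1 C2) (addr_ge0 t0 s0))).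
      have := pD _ _ (CS f1 t C1) (CS f2 s C2).
      by rewrite scalerDl addrACA mulrDl; lra.
    rewrite mulrC -ler_pdivrMr //; apply: lb_le_inf => // _ [t t0 <-].
    rewrite ler_pdivrMr //; apply: (le_trans (le (a *: f1) (a * t) (CZ a C1) (mulr_ge0 (ltW a0) t0))).
    have := pZ a _ (CS f1 t C1) a0; rewrite scalerDr scalerA => h.
    by rewrite [leRHS](_ : _ = a * p (f1 + t *: g) - a * t * p g) ?lerD2r //; ring.
  pose s : T := exist _ (fun f => inf (S f)) hs.
  have /asboolP /= h : ord s (exist _ p (conj sp pq)).
    by apply: max; apply/asboolP => f1 C1 /=; exact: le0.
  (* Minimality gives [p f <= inf (S f)], and the member of [S f] with [t = 1] is
     [p (f + g) - p g]. *)
  have := le f 1 Cf ler01; rewrite scale1r mul1r; have := h f Cf; lra.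
have opp f : C f -> p (- f) = - p f.
  by move=> Cf; have := add f (- f) Cf (CN Cf); rewrite subrr (sublinear_on0 Cf sp); lra.
have hpos a f : C f -> 0 < a -> p (a *: f) = a * p f.
  move=> Cf a0; apply/eqP; rewrite eq_le pZ //= -lerN2 -opp; last exact: CZ.
  by rewrite -scalerN -mulrN -opp // pZ //; exact: CN.
exists p; split => // a f Cf; have [a0|a0|<-] := ltgtP 0 a; first exact: hpos.
  by rewrite -[a]opprK scaleNr opp ?hpos ?oppr_gt0 ?mulNr //; exact: CZ.
by rewrite scale0r mul0r (sublinear_on0 Cf sp).
Qed.

End hahn_banach.

(** * Edwards' duality and the two approximations *)

Section edwards.
Context {R : realType} {n m : nat}.
Local Notation V := (Cn R n).
Variable hm : (1 <= m <= n)%N.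
Variable X : set V.
Hypothesis cptX : compact X.

(* Hahn-Banach is applied to [q f = inf (t c - v z)] over [t >= 0] and [v] in
   [SHo m X] with [f <= t phi - v] on [X]: a linear [l <= q] is positive and
   satisfies [l phi <= c] and [v z <= l v]. *)
Lemma jensen_envelope (phi : V -> R) z (c : R) : X z -> ctsX X phi ->
  (forall v, SHo m X v -> (forall x, X x -> v x <= phi x) -> v z <= c) ->
  exists2 mu : probability (borel R (n + n)) R, Jensen m X z mu &
    forall d : R, (\int[mu]_(x in X) (phi x - d)%:E <= (c - d)%:E)%E.
Proof.
move=> Xz cphi hc.
pose adm (f : V -> R) (t : R) (v : V -> R) :=
  [/\ 0 <= t, SHo m X v & forall x, X x -> f x <= t * phi x - v x].
pose S (f : V -> R) := [set r : R | exists t v, adm f t v /\ r = t * c - v z].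
pose q (f : V -> R) := inf (S f).
(* Finiteness of [q] is where [hc] enters: for [t > 0] the function [(v - M) / t] is a competitor
   below [phi], and for [t = 0] one has [v <= M]. *)
have lbS f : ctsX X f -> has_lbound (S f).
  move=> /(ctsX_bounded cptX)[M M0 hM]; exists (- M) => _ [t [v [[t0 sv hv] ->]]].
  have h x : X x -> v x + - M <= t * phi x.
    by move=> Xx; have := hM x Xx; rewrite ler_norml => /andP[h1 _]; have := hv x Xx; lra.
  have [te|tn] := eqVneq t 0; first by have := h z Xz; rewrite te !mul0r; lra.
  have {tn}t0 : 0 < t by rewrite lt_def tn.
  have : t^-1 * (v z + - M) <= c.
    apply: (hc (fun x => t^-1 * (v x + - M))).
      apply: (SHo_scale hm); first by rewrite invr_ge0 ltW.
      by apply: (SHo_add hm sv); exact: SHo_cst.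
    by move=> x Xx; rewrite mulrC ler_pdivrMr // mulrC; exact: h.
  by rewrite mulrC ler_pdivrMr //; lra.
have le_q f t v : ctsX X f -> adm f t v -> q f <= t * c - v z.
  by move=> cf h; apply: (ge_inf (lbS f cf)); exists t, v.
have neS f : ctsX X f -> S f !=set0.
  move=> /(ctsX_bounded cptX)[M M0 hM]; exists (0 * c - - M), 0, (fun=> - M); split => //.
  split => // [|x Xx]; first exact: SHo_cst.
  by have := hM x Xx; rewrite ler_norml => /andP[_ h1]; rewrite mul0r; lra.
have CD (f g : V -> R^o) : ctsX X f -> ctsX X g -> ctsX X (f + g) by exact: ctsXD.
have CZ (a : R) (f : V -> R^o) : ctsX X f -> ctsX X (a *: f) by exact: ctsXZ.
have qsub : @sublinear_on R (V -> R^o) (ctsX X) q.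
  split=> [f g cf cg|a f cf a0].
    rewrite -lerBlDr; apply: lb_le_inf => [|_ [t [v [[t0 sv hv] ->]]]]; first exact: neS.
    rewrite lerBlDr [leRHS]addrC -lerBlDr; apply: lb_le_inf => [|_ [s [w [[s0 sw hw] ->]]]]; first exact: neS.
    rewrite lerBlDr [leRHS](_ : _ = (t + s) * c - (v z + w z)); last by ring.
    apply: (le_q _ (t + s) (fun x => v x + w x)); first exact: CD.
    split; [exact: addr_ge0|exact: SHo_add|move=> x Xx].
    have := lerD (hv x Xx) (hw x Xx).
    by rewrite [leRHS](_ : _ = (t + s) * phi x - (v x + w x)) //; ring.
  rewrite mulrC -ler_pdivrMr //; apply: lb_le_inf => [|_ [t [v [[t0 sv hv] ->]]]]; first exact: neS.
  rewrite ler_pdivrMr // (_ : _ * _ = (a * t) * c - a * v z); last by ring.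
  apply: (le_q _ (a * t) (fun x => a * v x)); first exact: CZ.
  split; [by rewrite mulr_ge0 // ltW|by apply: SHo_scale => //; exact: ltW|move=> x Xx].
  by rewrite -mulrA -mulrBr; apply: ler_wpM2l; [exact: ltW|exact: hv].
have [l [lD lZ lq]] := @hahn_banach R (V -> R^o) (ctsX X) q CD CZ qsub.
have lD' f g : ctsX X f -> ctsX X g -> l (fun x => f x + g x) = l f + l g by exact: lD.
have lZ' a f : ctsX X f -> l (fun x => a * f x) = a * l f by exact: lZ.
have cc := @ctsX_cst R V X.
have le_l f g : ctsX X f -> ctsX X g -> (forall x, X x -> f x <= g x) -> l f <= l g.
  move=> cf cg fg; have cfg : ctsX X (fun x => f x + -1 * g x) by apply: ctsXD => //; exact: ctsXZ.
  have : l (fun x => f x + -1 * g x) <= 0 * c - 0.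
    apply: (le_trans (lq _ cfg)); apply: (le_q _ 0 (fun=> 0) cfg); split => //; first exact: SHo_cst.
    by move=> x Xx; have := fg x Xx; lra.
  by rewrite lD' ?lZ' //; [lra|exact: ctsXZ].
have l1 : l (fun=> 1) = 1.
  have h1 : l (fun=> 1) <= 0 * c - -1.
    apply: (le_trans (lq _ (cc 1))); apply: (le_q _ 0 (fun=> -1) (cc 1)); split => //; first exact: SHo_cst.
    by move=> x Xx; lra.
  have h2 : l (fun=> -1 * 1) <= 0 * c - 1.
    apply: (le_trans (lq _ (cc _))); apply: (le_q _ 0 (fun=> 1) (cc _)); split => //; first exact: SHo_cst.
    by move=> x Xx; lra.
  by move: h1 h2; rewrite (lZ' (-1) (fun=> 1)) //; lra.
have [mu [reg muX hmu]] := riesz_representation cptX lD' lZ' le_l l1.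
(* The choice [t = 0] with [v] itself bounds [l] at [- v]; the choice [t = 1] with the zero function
   bounds it at [phi]. *)
exists mu; first split => // v sv.
  have cv : ctsX X v by exact: SHo_continuous sv.
  rewrite hmu // lee_fin -lerN2.
  have cv' : ctsX X (fun x => -1 * v x) by exact: ctsXZ.
  rewrite -[leLHS]mulN1r -lZ' //; apply: (le_trans (lq _ cv')).
  rewrite -[leRHS]add0r -(mul0r c); apply: (le_q _ 0 v cv'); split => // x Xx; lra.
move=> d; have cd : ctsX X (fun x => phi x + - d) by apply: ctsXD.
rewrite (hmu _ cd) lee_fin lD' // -[X in l (fun=> X)]mulr1 lZ' // l1 mulr1 lerD2r.
apply: (le_trans (lq _ cphi)); rewrite -[leRHS]subr0 -[c]mul1r.
by apply: (le_q _ 1 (fun=> 0) cphi); split => //; [exact: SHo_cst|move=> x Xx; lra].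
Qed.

Lemma measurableX : measurable (X : set (borel R (n + n))).
Proof. by apply: closed_borel; exact: compact_rV_closed. Qed.

Lemma usc_measurable u : usc_on X u -> measurable_fun (X : set (borel R (n + n))) u.
Proof.
move=> cu; apply: (measurability _ (ErealGenInftyO.measurableE R)) => _ [_ [a ->] <-].
rewrite (_ : _ `&` _ = X `&` [set x | X x -> (u x < a%:E)%E]); last first.
  apply/seteqP; split=> x [Xx] /=; rewrite in_itv /=; first by split.
  by move=> /(_ Xx).
apply: measurableI; first exact: measurableX.
apply: open_borel; apply: (open_rel cptX) => x Xx ux.
by have := cu x Xx a ux; rewrite near_withinE.
Qed.

(** Positive and negative parts are compared separately, so functions and integrals with value -oo
    are allowed. *)
Lemma le_integral_measurable (mu : {measure set (borel R (n + n)) -> \bar R})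
    (f g : V -> \bar R) :
  measurable_fun (X : set (borel R (n + n))) f -> measurable_fun (X : set (borel R (n + n))) g ->
  (forall x, X x -> (f x <= g x)%E) -> (\int[mu]_(x in X) f x <= \int[mu]_(x in X) g x)%E.
Proof.
move=> mf mg fg; have mX := measurableX; have fg' : {in X, forall x, (f x <= g x)%E}.
  by move=> x; rewrite inE; exact: fg.
rewrite integralE [leRHS]integralE leeB //.
  apply: ge0_le_integral => //; [exact: measurable_funepos|exact: measurable_funepos|].
  by move=> x /mem_set; exact: funepos_le.
apply: ge0_le_integral => //; [exact: measurable_funeneg|exact: measurable_funeneg|].
by move=> x /mem_set; exact: funeneg_le.
Qed.

Lemma ereal_between (x : \bar R) (r : R) : (x < r%:E)%E -> exists2 a : R, (x < a%:E)%E & a < r.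
Proof.
case: x => [x||].
- rewrite lte_fin => xr; exists ((x + r) / 2); rewrite ?lte_fin; lra.
- by rewrite ltNge leey.
- by move=> _; exists (r - 1); [exact: ltNyr|rewrite ltrBlDr ltrDl].
Qed.

(** [phi - u] is lower semicontinuous and positive on a compact set, hence bounded away from 0. *)
Lemma usc_gap u (phi : V -> R) : usc_on X u -> ctsX X phi ->
  (forall x, X x -> (u x < (phi x)%:E)%E) ->
  exists2 d : R, 0 < d & forall x, X x -> (u x <= (phi x - d)%:E)%E.
Proof.
move=> cu cphi up.
apply: (@compact_ind _ X (fun B => exists2 d : R, 0 < d & forall x, B x -> (u x <= (phi x - d)%:E)%E)) => //.
- by exists 1.
- by move=> A B AB [d d0 hd]; exists d => // x /AB; exact: hd.
- move=> A B [d1 d10 h1] [d2 d20 h2]; exists (Num.min d1 d2); first by rewrite lt_min d10.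
  move=> x [Ax|Bx].
    by apply: (le_trans (h1 x Ax)); rewrite lee_fin lerD2l lerN2 ge_min lexx.
  by apply: (le_trans (h2 x Bx)); rewrite lee_fin lerD2l lerN2 ge_min lexx orbT.
- move=> x Xx; have [a ua ap] := ereal_between (up x Xx).
  pose b := (a + phi x) / 2; have ab : a < b by rewrite /b; lra.
  have bp : b < phi x by rewrite /b; lra.
  exists [set y | (X y -> (u y < a%:E)%E) /\ (X y -> b < phi y)].
    have := cu x Xx a ua; rewrite near_withinE => h.
    by apply: filterS2 h (ctsX_near_gt cphi Xx bp).
  exists (b - a); first by rewrite subr_gt0.
  move=> y [[h1 h2] Xy]; apply: (le_trans (ltW (h1 Xy))); rewrite lee_fin.
  by have := h2 Xy; lra.
Qed.

Lemma SHo_between u (phi : V -> R) : SH m X u -> ctsX X phi ->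
  (forall x, X x -> (u x < (phi x)%:E)%E) ->
  exists2 v, SHo m X v & forall x, X x -> (u x < (v x)%:E)%E /\ v x <= phi x.
Proof.
move=> [[cu uoo] su] cphi up.
have [M M0 hM] := ctsX_bounded cptX cphi.
have MP x : X x -> - M <= phi x by move=> /hM; rewrite ler_norml => /andP[].
have pt z : X z -> exists v, [/\ SHo m X v, forall x, X x -> v x <= phi x & (u z < (v z)%:E)%E].
  move=> Xz; have := uoo z Xz; case uz : (u z) => [c||] // _; last first.
    by exists (fun=> - M); split => //; [exact: SHo_cst|exact: ltNyr].
  (* Otherwise some Jensen measure gives [phi - d] an integral of at most [c - d]. Since
     [u <= phi - d], the inequality defining [SH] at [z] would give [c <= c - d]. *)
  apply: contrapT => nv.
  have hc v : SHo m X v -> (forall x, X x -> v x <= phi x) -> v z <= c.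
    move=> sv vp; rewrite leNgt; apply/negP => cv; apply: nv; exists v; split => //.
  have [mu Jmu hmu] := jensen_envelope Xz cphi hc.
  have [d d0 hd] := usc_gap cu cphi up.
  have := su z Xz mu Jmu; rewrite uz leNgt => /negP; apply.
  apply: (@le_lt_trans _ _ (c - d)%:E); last by rewrite lte_fin ltrBlDr ltrDl.
  apply: le_trans (hmu d); apply: le_integral_measurable => //; first exact: usc_measurable.
  apply/measurable_EFinP; apply: (ctsX_measurable cptX); apply: ctsXB => //; exact: ctsX_cst.
suff [v sv hv] : exists2 v, SHo m X v & forall x, X x -> v x <= phi x /\ (X x -> (u x < (v x)%:E)%E).
  by exists v => // x Xx; have [h1 h2] := hv x Xx; split => //; exact: h2.
apply: (@compact_ind _ X (fun B => exists2 v, SHo m X v &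
    forall x, X x -> v x <= phi x /\ (B x -> (u x < (v x)%:E)%E))) => //.
- by exists (fun=> - M); [exact: SHo_cst|move=> x Xx; split => //; exact: MP].
- move=> A B AB [v sv hv]; exists v => // x Xx; have [h1 h2] := hv x Xx.
  by split => // /AB.
- move=> A B [v sv hv] [w sw hw]; exists (fun x => Num.max (v x) (w x)); first exact: SHo_max.
  move=> x Xx; have [h1 h2] := hv x Xx; have [k1 k2] := hw x Xx.
  rewrite ge_max h1 k1; split => // -[/h2|/k2] /lt_le_trans; apply; rewrite lee_fin le_max lexx //.
  by rewrite orbT.
- move=> x Xx; have [v [sv vp uv]] := pt x Xx; have [a ua av] := ereal_between uv.
  have cv : ctsX X v by exact: SHo_continuous sv.
  exists [set y | (X y -> (u y < a%:E)%E) /\ (X y -> a < v y)].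
    have := cu x Xx a ua; rewrite near_withinE => h.
    by apply: filterS2 h (ctsX_near_gt cv Xx av).
  exists v => // y Xy; split; first exact: vp.
  by move=> [[h1 h2] _]; apply: (lt_trans (h1 Xy)); rewrite lte_fin; exact: h2.
Qed.

(** An increasing limit of continuous functions is lower semicontinuous and nowhere -oo; together
    with the assumed upper semicontinuity this is continuity. *)
Lemma SH_monotone_limit u (u_ : nat -> V -> R) : usc_fun X u -> (forall j, SHo m X (u_ j)) ->
  (forall z, X z -> {homo (u_^~ z) : i j / (i <= j)%N >-> i <= j}) ->
  (forall z, X z -> (u_ j z)%:E @[j --> \oo] --> u z) -> SH m X u /\ real_continuous X u.
Proof.
move=> [cu uoo] su mono cv.
have uE z : X z -> u z = ereal_sup (range (fun j => (u_ j z)%:E)).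
  move=> Xz; apply: (cvg_unique _ (cv z Xz)); first exact: ereal_hausdorff.
  by apply: ereal_nondecreasing_cvgn => i j ij; rewrite lee_fin; exact: mono.
have le j z : X z -> ((u_ j z)%:E <= u z)%E.
  by move=> Xz; rewrite uE //; apply: ereal_sup_ubound; exists j.
have cj j : ctsX X (u_ j) by exact: SHo_continuous (su j).
split.
  split => // z Xz mu Jmu; have [_ _ hJ] := Jmu.
  rewrite [leLHS]uE //; apply/ereal_supP => _ [j _ <-].
  apply: (le_trans (hJ _ (su j))); apply: le_integral_measurable.
  - by apply/measurable_EFinP; exact: (ctsX_measurable cptX).
  - exact: usc_measurable.
  - by move=> x; exact: le.
have fin z : X z -> u z = (fine (u z))%:E.
  move=> Xz; rewrite fineK // fin_numE -ltey uoo // andbT -ltNye.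
  by apply: lt_le_trans (le 0%N z Xz); exact: ltNyr.
exists (fine \o u); last by move=> z Xz; exact: fin.
apply/subspace_continuousP => z Xz; apply/cvgrPdist_lt => e e0; rewrite near_withinE.
have h1 : (u z < (fine (u z) + e)%:E)%E by rewrite [ltLHS]fin // lte_fin ltrDl.
have [j hj] : exists j, fine (u z) - e < u_ j z.
  have : ((fine (u z) - e)%:E < u z)%E by rewrite [ltRHS]fin // lte_fin ltrBlDr ltrDl.
  rewrite [ltRHS]uE // => /ereal_sup_gt[_ [j _ <-]]; rewrite lte_fin => hj.
  by exists j.
have := cu z Xz _ h1; rewrite near_withinE => k1.
apply: filterS2 k1 (ctsX_near_gt (cj j) Xz hj) => y h2 h3 Xy /=.
have := h2 Xy; rewrite (fin y Xy) lte_fin /= => h4.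
have := lt_le_trans (_ : ((fine (u z) - e)%:E < (u_ j y)%:E)%E) (le j y Xy).
rewrite lte_fin => /(_ (h3 Xy)); rewrite [X in (_ < X)%E]fin // lte_fin => h5.
by rewrite distrC ltr_distl; apply/andP; split; [exact: h5|exact: h4].
Qed.

Lemma SH_increasing_approx u : SH m X u -> real_continuous X u ->
  exists u_ : nat -> V -> R, [/\ forall j, SHo m X (u_ j),
    forall z, X z -> {homo (u_^~ z) : i j / (i <= j)%N >-> i <= j} &
    forall z, X z -> (u_ j z)%:E @[j --> \oo] --> u z].
Proof.
move=> su [f cf uf]; pose a (j : nat) : R := j.+1%:R^-1.
have aS j : a j.+1 < a j by rewrite /a ltf_pV2 ?posrE // ltr_nat.
have H j : exists v, SHo m X v /\ forall x, X x -> f x - a j <= v x <= f x - a j.+1.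
  (* Subtracting [a j] from a function between [f] and [f + (a j - a j.+1)] puts it between
     [f - a j] and [f - a j.+1]. These bands are stacked, which forces monotonicity in [j]. *)
  have cphi : ctsX X (fun x => f x + (a j - a j.+1)) by apply: ctsXD => //; exact: ctsX_cst.
  have [v sv hv] := SHo_between su cphi (fun x Xx => ltac:(by rewrite uf // lte_fin ltrDl subr_gt0)).
  exists (fun x => v x + - a j); split; first by apply: (SHo_add hm sv); exact: SHo_cst.
  move=> x Xx; have [] := hv x Xx; rewrite uf // lte_fin; lra.
have [u_ hu] := choice H; exists u_; split => [j|z Xz|z Xz].
- by have [] := hu j.
- have st j : u_ j z <= u_ j.+1 z.
    have [_ /(_ z Xz)/andP[_ h1]] := hu j; have [_ /(_ z Xz)/andP[h2 _]] := hu j.+1.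
    exact: le_trans h1 h2.
  exact: homo_leq_le st.
rewrite uf //; apply: cvg_EFin; first by near=> j.
apply: (@squeeze_cvgr _ _ _ _ (fun j => f z - a j) (fun=> f z)).
- near=> j; have [_ /(_ z Xz)/andP[h1 h2]] := hu j; rewrite h1 (le_trans h2) //.
  by rewrite gerBl /a invr_ge0.
- rewrite -[X in _ --> X]subr0; apply: cvgB; first exact: cvg_cst.
  exact: cvg_harmonic.
- exact: cvg_cst.
Unshelve. all: by end_near. Qed.

Lemma SH_decreasing_limit u (u_ : nat -> V -> R) : (forall z, X z -> (u z < +oo)%E) ->
  (forall j, SHo m X (u_ j)) ->
  (forall z, X z -> {homo (u_^~ z) : i j / (i <= j)%N >-> j <= i}) ->
  (forall z, X z -> (u_ j z)%:E @[j --> \oo] --> u z) -> SH m X u.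
Proof.
move=> uoo su mono cv.
have uE z : X z -> u z = ereal_inf (range (fun j => (u_ j z)%:E)).
  move=> Xz; apply: (cvg_unique _ (cv z Xz)); first exact: ereal_hausdorff.
  by apply: ereal_nonincreasing_cvgn => i j ij; rewrite lee_fin; exact: mono.
have le j z : X z -> (u z <= (u_ j z)%:E)%E.
  by move=> Xz; rewrite uE //; apply: ereal_inf_lbound; exists j.
have cj j : ctsX X (u_ j) by exact: SHo_continuous (su j).
have cu : usc_on X u.
  move=> z Xz a; rewrite uE // => /ereal_inf_lt[_ [j _ <-]]; rewrite lte_fin => ja.
  rewrite near_withinE; apply: filterS (ctsX_near_lt (cj j) Xz ja) => y h Xy.
  by apply: (le_lt_trans (le j y Xy)); rewrite lte_fin; exact: h.
split => // z Xz mu Jmu; have [_ _ hJ] := Jmu; have mX := measurableX.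
case uz : (u z) (uoo z Xz) => [r||] // _; last exact: leNye.
have int j := ctsX_integrable cptX mu (cj j).
pose J j := \int[mu]_(x in X) u_ j x.
have JE j : (\int[mu]_(x in X) (u_ j x)%:E)%E = (J j)%:E.
  by rewrite /J /Rintegral fineK //; exact: integrable_fin_num (int j).
have rJ j : r <= J j.
  rewrite -lee_fin -JE -uz; apply: le_trans (hJ _ (su j)).
  exact: le.
(* Monotone convergence is applied to the nonnegative increasing functions [u_ 0 - u_ j]; the bound
   [r <= J j] makes the limit integrable. *)
pose h (j : nat) (x : borel R (n + n)) : \bar R := (u_ 0%N x - u_ j x)%:E.
pose H (x : borel R (n + n)) : \bar R := ((u_ 0%N x)%:E - u x)%E.
have mh j : measurable_fun (X : set (borel R (n + n))) (h j).
  by apply/measurable_EFinP; apply: (ctsX_measurable cptX); exact: ctsXB.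
have hH x : X x -> h j x @[j --> \oo] --> H x.
  move=> Xx; rewrite /h /H; under eq_fun do rewrite EFinB.
  by apply: cvgeB; [exact: fin_num_adde_defr|exact: cvg_cst|exact: cv].
have mH : measurable_fun (X : set (borel R (n + n))) H.
  exact: emeasurable_fun_cvg mh hH.
have h0 j x : X x -> (0 <= h j x)%E by move=> Xx; rewrite lee_fin subr_ge0; exact: mono.
have H0 x : X x -> (0 <= H x)%E by move=> Xx; rewrite /H sube_ge0 ?orbT //; exact: le.
have intH : (\int[mu]_(x in X) H x <= (J 0%N - r)%:E)%E.
  have c1 : (\int[mu]_(x in X) h j x)%E @[j --> \oo] --> (\int[mu]_(x in X) H x)%E.
    rewrite (eq_integral (fun x => limn (fun j => h j x))); last first.
      by move=> x; rewrite inE => /hH/cvg_lim ->.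
    apply: cvg_monotone_convergence => // x Xx i j ij.
    by rewrite lee_fin lerD2l lerN2; exact: mono.
  apply: (closed_cvg (fun x => (x <= (J 0%N - r)%:E)%E) _ _ _ c1); first exact: closed_ereal_ge_ereal.
  apply: nearW => j; rewrite /h (_ : (fun x : borel R (n + n) => _) = fun x => ((u_ 0%N x)%:E - (u_ j x)%:E)%E) //.
  rewrite integralB_EFin // !JE -EFinB lee_fin lerD2l lerN2 //.
have iH : mu.-integrable X H.
  apply/integrableP; split => //.
  rewrite (eq_integral H); last by move=> x; rewrite inE => Xx; rewrite gee0_abs // H0.
  by apply: le_lt_trans intH _; exact: ltry.
rewrite (eq_integral (fun x : borel R (n + n) => ((u_ 0%N x)%:E - H x)%E)); last first.
  move=> x; rewrite inE => Xx; rewrite /H; have := uoo x Xx.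
  by case: (u x) => [y||] //= _; rewrite -!EFinB opprB addrC subrK.
rewrite (@integralB _ _ _ mu X mX (fun x => (u_ 0%N x)%:E) H) //; last exact: int.
have Hf : (\int[mu]_(x in X) H x)%E \is a fin_num by exact: integrable_fin_num.
move: intH; rewrite JE -(fineK Hf) -EFinB !lee_fin; lra.
Qed.

Lemma SH_decreasing_approx u : SH m X u ->
  exists u_ : nat -> V -> R, [/\ forall j, SHo m X (u_ j),
    forall z, X z -> {homo (u_^~ z) : i j / (i <= j)%N >-> j <= i} &
    forall z, X z -> (u_ j z)%:E @[j --> \oo] --> u z].
Proof.
move=> su; have [[cu uoo] _] := su.
have [M M0 hM] : exists2 M : R, 0 < M & forall x, X x -> (u x <= M%:E)%E.
  apply: (@compact_ind _ X (fun B => exists2 M : R, 0 < M & forall x, B x -> (u x <= M%:E)%E)) => //.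
  - by exists 1.
  - by move=> A B AB [M M0 hM]; exists M => // x /AB; exact: hM.
  - move=> A B [M M0 hM] [K K0 hK]; exists (M + K); first exact: addr_gt0.
    move=> x [Ax|Bx].
      by apply: (le_trans (hM x Ax)); rewrite lee_fin lerDl ltW.
    by apply: (le_trans (hK x Bx)); rewrite lee_fin lerDr ltW.
  - move=> x Xx; pose a := Num.max 0 (fine (u x)) + 1.
    have ua : (u x < a%:E)%E.
      have := uoo x Xx; case: (u x) @a => [y||] //= _ => [|]; last exact: ltNyr.
      by rewrite lte_fin ltr_pwDr // le_max lexx orbT.
    exists [set y | X y -> (u y < a%:E)%E].
      by have := cu x Xx a ua; rewrite near_withinE.
    exists a; first by rewrite ltr_wpDl // le_max lexx.
    by move=> y [h Xy]; exact: ltW (h Xy).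
pose g (j : nat) (y : V) := fine (maxe (u y) (- j%:R)%:E).
have gE j y : X y -> (g j y)%:E = maxe (u y) (- j%:R)%:E.
  move=> Xy; rewrite /g fineK //; have := uoo y Xy; case: (u y) => [r||] //= _.
    by rewrite -EFin_max.
  by rewrite maxNye.
have gM j y : X y -> g j y <= M.
  by move=> Xy; rewrite -lee_fin gE // ge_max hM //= lee_fin lerNl (le_trans _ (ler0n _ j)) // oppr_le0 ltW.
(* Sup-convolution with slope [j] of [u] truncated at [- j]: its supremum [phi j] is a [j]-Lipschitz
   majorant of [u] on [X], which semicontinuity brings down to [u]. *)
pose S (j : nat) (x : V) := [set g j y - j%:R * `|x - y| | y in X].
pose phi j x := sup (S j x).
have hS j x z : X z -> has_sup (S j x).
  move=> Xz; split; first by exists (g j z - j%:R * `|x - z|); exists z.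
  exists M => _ [y Xy <-]; apply: le_trans (gM j y Xy).
  by rewrite gerBl mulr_ge0.
have phi_ge j x y : X y -> g j y - j%:R * `|x - y| <= phi j x.
  by move=> Xy; apply: sup_upper_bound; [exact: hS Xy|exists y].
have phi_le j x b z : X z -> (forall y, X y -> g j y - j%:R * `|x - y| <= b) -> phi j x <= b.
  move=> Xz h; apply: ge_sup; first by have [] := hS j x z Xz.
  by move=> _ [y Xy <-]; exact: h.
have cphi j : ctsX X (phi j).
  have [X0|/set0P[z Xz]] := eqVneq X set0; first by rewrite /ctsX X0; exact: continuous_subspace0.
  apply: continuous_subspaceT; apply: (@lipschitz_cts R V (phi j) j%:R).
  have lip x x' : phi j x <= phi j x' + j%:R * `|x - x'|.
    apply: (phi_le _ _ _ z Xz) => y Xy; apply: le_trans (lerD (phi_ge j x' y Xy) (lexx _)).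
    rewrite -addrA lerD2l lerNl opprD opprK lerBlDr -mulrDr ler_wpM2l //.
    by rewrite [leRHS]addrC [`|x - x'|]distrC ler_distD.
  move=> x x'; rewrite ler_norml; apply/andP; split; last by rewrite lerBlDl; exact: lip.
  by rewrite lerNl opprB lerBlDl distrC; exact: lip.
have up j x : X x -> (u x <= (phi j x)%:E)%E.
  move=> Xx; apply: (@le_trans _ _ (g j x)%:E); first by rewrite gE // le_max lexx.
  by have := phi_ge j x x Xx; rewrite subrr normr0 mulr0 subr0 lee_fin.
pose psi j x := phi j x + j.+1%:R^-1.
have cpsi j : ctsX X (psi j) by apply: ctsXD => //; exact: ctsX_cst.
have upsi j x : X x -> (u x < (psi j x)%:E)%E.
  by move=> Xx; apply: (le_lt_trans (up j x Xx)); rewrite lte_fin ltrDl invr_gt0.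
pose T := {v : V -> R | SHo m X v /\ forall x, X x -> (u x < (v x)%:E)%E}.
(* [SHo_between] is applied to the minimum of the previous function and [psi j], which builds in
   monotonicity; the strict inequality recorded in [T] permits the next application. *)
have step (j : nat) (v : T) : {w : T | forall x, X x -> sval w x <= sval v x /\ sval w x <= psi j x}.
  apply: cid; have [sv uv] := svalP v; have cv : ctsX X (sval v) by exact: SHo_continuous sv.
  have [|w sw hw] := SHo_between su (ctsX_min cv (cpsi j)).
    by move=> x Xx; rewrite EFin_min lt_min uv // upsi.
  have hw' : SHo m X w /\ forall x, X x -> (u x < (w x)%:E)%E.
    by split => // x Xx; have [] := hw x Xx.
  exists (exist _ w hw') => x Xx; have [_] := hw x Xx.
  by rewrite le_min => /andP.
have v0 : T.
  apply: (exist _ (fun=> M + 1)); split; first exact: SHo_cst.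
  by move=> x Xx; apply: (le_lt_trans (hM x Xx)); rewrite lte_fin ltrDl.
pose F := fix F (j : nat) : T := if j is i.+1 then sval (step i (F i)) else v0.
have F1 j x : X x -> sval (F j.+1) x <= sval (F j) x.
  by move=> Xx; have [] := svalP (step j (F j)) x Xx.
have F2 j x : X x -> sval (F j.+1) x <= psi j x.
  by move=> Xx; have [] := svalP (step j (F j)) x Xx.
have mono z : X z -> {homo (fun j => sval (F j) z) : i j / (i <= j)%N >-> j <= i}.
  move=> Xz; apply: (@homo_leq _ _ (fun a b : R => b <= a)) => [y|y x w yx wy|j]; last exact: F1.
    exact: lexx.
  exact: le_trans wy yx.
exists (fun j => sval (F j)); split => // [j|z Xz]; first by have [] := svalP (F j).
have uF j : (u z < (sval (F j) z)%:E)%E by have [_] := svalP (F j); exact.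
suff -> : u z = ereal_inf (range (fun j => (sval (F j) z)%:E)).
  by apply: ereal_nonincreasing_cvgn => i j ij; rewrite lee_fin; exact: mono.
set I := ereal_inf _; apply/eqP; rewrite eq_le; apply/andP; split.
  by apply/ereal_infP => _ [j _ <-]; exact: ltW.
rewrite leNgt; apply/negP => uI.
have Ile j : (I <= (sval (F j) z)%:E)%E by apply: ereal_inf_lbound; exists j.
have If : I \is a fin_num.
  rewrite fin_numE; apply/andP; split; last by rewrite -ltey (le_lt_trans (Ile 0%N)) // ltry.
  by rewrite -ltNye; apply: le_lt_trans uI; exact: leNye.
move: uI; rewrite -(fineK If) => /ereal_between[a ua aI].
have [d /= d0 hd] : exists2 d : R, 0 < d & forall y, X y -> `|z - y| < d -> (u y < a%:E)%E.
  have := cu z Xz a ua; rewrite near_withinE => /nbhs_ballP[d /= d0 hd].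
  by exists d => // y Xy yd; apply: hd => //; rewrite -ball_normE.
(* [j] is so large that the truncation level [- j] is at most [a], points at distance at least [d]
   contribute at most [M - j d <= a], and the summand [1 / (j + 1)] of [psi j] is less than
   [fine I - a]. *)
pose j := (Num.truncn (`|a| + (M + `|a|) / d + (fine I - a)^-1)).+1.
have jbig : `|a| + (M + `|a|) / d + (fine I - a)^-1 < j%:R by exact: truncnS_gt.
have Ma : 0 <= (M + `|a|) / d by rewrite divr_ge0 ?addr_ge0 // ltW.
have Ia : 0 < (fine I - a)^-1 by rewrite invr_gt0 subr_gt0.
have ja : `|a| <= j%:R by have := normr_ge0 a; move: jbig Ma Ia; lra.
have jd : M - j%:R * d <= a.
  have : (M + `|a|) / d <= j%:R by have := normr_ge0 a; move: jbig Ma Ia; lra.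
  rewrite ler_pdivrMr // => h; have := ler_norm (- a); rewrite normrN; move: h; lra.
have jI : (fine I - a)^-1 < j.+1%:R.
  by rewrite -natr1; have := normr_ge0 a; move: jbig Ma Ia; lra.
have pa : phi j z <= a.
  apply: (phi_le _ _ _ z Xz) => y Xy; have [yd|dy] := ltP `|z - y| d.
    apply: (@le_trans _ _ (g j y)); first by rewrite gerBl mulr_ge0.
    rewrite -lee_fin gE // ge_max (ltW (hd y Xy yd)) /= lee_fin lerNl.
    by apply: le_trans ja; rewrite -normrN ler_norm.
  apply: le_trans jd; apply: lerB; first exact: gM.
  exact: ler_wpM2l.
have : psi j z < fine I.
  apply: (@le_lt_trans _ _ (a + j.+1%:R^-1)); first by rewrite lerD2r.
  by rewrite addrC -ltrBrDr -[ltRHS]invrK ltf_pV2 ?posrE.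
rewrite ltNge => /negP; apply.
by rewrite -lee_fin fineK //; apply: le_trans (Ile j.+1) _; rewrite lee_fin; exact: F2.
Qed.

End edwards.
Theorem theorem2p6 (R : realType) (n m : nat) (hm : (1 <= m <= n)%N)
    (X : set (Cn R n)) (hX : compact X) :
  (forall u : Cn R n -> \bar R, usc_fun X u ->
     (SH m X u /\ real_continuous X u) <->
     (exists u_ : nat -> Cn R n -> R,
        [/\ forall j, SHo m X (u_ j),
            forall z, X z -> {homo (u_^~ z) : i j / (i <= j)%N >-> i <= j} &
            forall z, X z -> (u_ j z)%:E @[j --> \oo] --> u z]))
  /\
  (forall u : Cn R n -> \bar R, (forall z, X z -> (u z < +oo)%E) ->
     SH m X u <->
     (exists u_ : nat -> Cn R n -> R,
        [/\ forall j, SHo m X (u_ j),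
            forall z, X z -> {homo (u_^~ z) : i j / (i <= j)%N >-> j <= i} &
            forall z, X z -> (u_ j z)%:E @[j --> \oo] --> u z])).
Proof.
split=> u hu; split.
- by move=> [su cu]; exact: SH_increasing_approx.
- by move=> [u_ [s1 s2 s3]]; exact: SH_monotone_limit hu s1 s2 s3.
- by move=> su; exact: SH_decreasing_approx.
- by move=> [u_ [s1 s2 s3]]; exact: SH_decreasing_limit hu s1 s2 s3.
Qed.
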